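(* Let $K_1,K_2,K_3$ be three adjacent regions (from left to right, separated by vertical dividing lines) of a simple Legendrian front with Maslov potential, and let $K_{12}=K_1\cup K_2$, $K_{23}=K_2\cup K_3$, $K_{123}=K_1\cup K_2\cup K_3$. Then the commutative diagram of DGAs $$\begin{array}{ccc} DA(K_2) & \longrightarrow & DA(K_{23})\\ {\scriptstyle w}\downarrow & & \downarrow{\scriptstyle w'}\\ DA(K_{12}) & \longrightarrow & DA(K_{123})\end{array}$$ is a pushout square in the category of DGAs. Here the horizontal maps are inclusions, and $w$ and $w'$ fix the vertices of $K_2$ and $K_{23}$ respectively and send each generator $\rho_{ij}$ of the dividing line between $K_1$ and $K_2$ to the element $w(\rho_{ij})\in DA(K_1)$, regarded in $DA(K_{12})$ and $DA(K_{123})$ respectively.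
   Context: **DGAs.** $\mathbb{F}=\mathbb{Z}/2\mathbb{Z}$ and $\Gamma$ is a fixed cyclic group. A DGA is an associative unital $\Gamma$-graded algebra over $\mathbb{F}$ with a differential $\partial$ of degree $-1$ satisfying the Leibniz rule and $\partial^2=0$; all DGAs are assumed semi-free, i.e. freely generated as noncommutative unital algebras by a specified set of generators. A DGA morphism is a unital algebra homomorphism that preserves gradings and commutes with $\partial$. **Fronts.** A front is the (generic) projection to the $xz$-plane of a Legendrian link in $(\mathbb{R}^3,\ker(dz-y\,dx))$; it has no vertical tangents and its singularities are transverse crossings and left/right cusps. At a crossing the strand of smaller slope passes over and is called the top strand; the other is the bottom strand. A front is simple if a planar isotopy makes all of its right cusps have the same $x$-coordinate; a piece of a front cut out by vertical lines is simple if no right cusp lies in a compact region bounded by the front and the vertical lines. The vertices are the crossings and right cusps. A Maslov potential assigns $\mu(s)\in\Gamma$ to each strand so that at every cusp the upper strand has potential one greater than the lower strand. Points on a dividing line are numbered from top to bottom, and $\mu(i)$ is the potential of the strand through the $i$th point. **Disks.** Let $L$ be a simple piece of a front between a left dividing line, met in points $x_1,\dots,x_n$, and a right dividing line, met in points $x'_1,\dots,x'_m$ (either line may be absent, and then $n=0$, respectively $m=0$). For a vertex $v$ of $L$, $\mathrm{Disk}(L;v)$ is the set of disks $D\subset\mathbb{R}^2$ with $\partial D\subset L$ such that (1) $D$ is smoothly embedded except possibly at vertices and left cusps; (2) $v$ is the unique rightmost point of $D$; (3) $D$ has a unique leftmost point, at a left cusp of $L$; (4) at each corner, i.e. each crossing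 $c\neq v$ where $D$ is singular, $D$ occupies near $c$ exactly one of the four regions cut out by $L$. $\mathrm{Half}_D(L;v)$ is defined in the same way except that (3) is replaced by: the leftmost part of the boundary is a segment of the left dividing line between some $x_k$ and $x_l$, $k<l$. $\mathrm{Half}_{DA}(L;i,j)$, $1\le i<j\le m$, is defined in the same way except that (2) is replaced by: the rightmost part of the boundary is the segment of the right dividing line from $x'_i$ to $x'_j$; and the left end may be either a left cusp or a segment of the left dividing line. In each case $\partial D$ (or $\partial H$) is the product of the corners in counterclockwise order, starting from $v$ (respectively from $x'_i$ and ending at $x'_j$), with the generator $\rho_{kl}$ inserted in the place where the boundary runs along the segment from $x_k$ to $x_l$ of the left dividing line. **Algebras.** $I_n$ is the DGA freely generated by $\rho_{ij}$, $1\le i<j\le n$, with $|\rho_{ij}|=\mu(i)-\mu(j)-1$ and $\partial\rho_{ij}=\sum_{i<k<j}\rho_{ik}\rho_{kj}$. $DA(L)$ is the DGA freely generated by the vertices of $L$ and the generators $\rho_{ij}$ of the algebra $I_n$ of the left dividing line of $L$. Right cusps have grading $1$, a crossing with top strand $s_1$ and bottom strand $s_2$ has grading $\mu(s_1)-\mu(s_2)$, $\partial\rho_{ij}$ is as in $I_n$, and $\partial v=\epsilon_v+\sum_{D\in\mathrm{Disk}(L;v)}\partial D+\sum_{H\in\mathrm{Half}_D(L;v)}\partial H$, where $\epsilon_v=1$ if $v$ is a right cusp and $0$ if $v$ is a crossing. Writing $I'_m$ for the algebra of the right dividing line with generators $\rho'_{ij}$, the morphism $w:I'_m\to DA(L)$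 is $w(\rho'_{ij})=\sum_{H\in\mathrm{Half}_{DA}(L;i,j)}\partial H$; this with $L=K_1$ defines the elements $w(\rho_{ij})\in DA(K_1)$ in the statement. *)

(* Defs.v *)
From HB Require Import structures.
From mathcomp Require Import all_boot all_order all_algebra.
From mathcomp Require Import finmap monalg.
From mathcomp Require Import all_classical all_reals all_analysis.

Set Implicit Arguments.
Unset Strict Implicit.
Unset Printing Implicit Defensive.

Import Order.TTheory GRing.Theory Num.Theory.
Import numFieldNormedType.Exports.

Local Open Scope classical_set_scope.
Local Open Scope ring_scope.

(* The free noncommutative unital Z/2-algebra on X: the monoid algebra of the
   free monoid on X. *)
Definition freeAlg (X : choiceType) := {malg 'F_2[{fmonom X}]}.

Definition fgen (X : choiceType) (x : X) : freeAlg X :=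
  mkmalgU (fmu x) (1 : 'F_2).

(* The unital algebra morphism that extends a map defined on generators. *)
Definition alg_ext (X Y : choiceType) (f : X -> freeAlg Y) (a : freeAlg X) :
    freeAlg Y :=
  \sum_(m <- msupp a) mcoeff m a *: \prod_(x <- (m : seq X)) f x.

(* The derivation that extends a map defined on generators. *)
Fixpoint der_word (X : choiceType) (d : X -> freeAlg X) (m : seq X) :
    freeAlg X :=
  if m is x :: m' then
    d x * \prod_(y <- m') fgen y + fgen x * der_word d m'
  else 0.

Definition der_ext (X : choiceType) (d : X -> freeAlg X) (a : freeAlg X) :
    freeAlg X :=
  \sum_(m <- msupp a) mcoeff m a *: der_word d m.

(* Freeness is built in: the underlying algebra is [freeAlg gen].  The axioms
   on the differential are in [is_dga]. *)
Record dgdata (Gam : zmodType) := DGData {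
  gen : choiceType;
  deg : gen -> Gam;
  dif : freeAlg gen -> freeAlg gen }.

Definition homogeneous (Gam : zmodType) (A : dgdata Gam) (g : Gam)
    (a : freeAlg (gen A)) : Prop :=
  forall m, m \in msupp a -> \sum_(x <- (m : seq (gen A))) deg x = g.

(* [u : Gam] is the element of the grading group that plays the role of 1.
   Additivity is the same as linearity over Z/2. *)
Definition is_dga (Gam : zmodType) (u : Gam) (A : dgdata Gam) : Prop :=
  [/\ zmod_morphism (@dif _ A),
      forall a b, @dif _ A (a * b) = dif a * b + a * dif b,
      forall g a, @homogeneous _ A g a -> @homogeneous _ A (g - u) (dif a) &
      forall a, @dif _ A (dif a) = 0].

Definition is_dga_morphism (Gam : zmodType) (A B : dgdata Gam)
    (f : freeAlg (gen A) -> freeAlg (gen B)) : Prop :=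
  [/\ zmod_morphism f, monoid_morphism f,
      forall g a, @homogeneous _ A g a -> @homogeneous _ B g (f a) &
      forall a, f (dif a) = dif (f a)].

(*      f
    A ----> B
  g |       | f'
    v       v
    C ----> D
        g'                                                                    *)
Definition is_pushout_square (Gam : zmodType) (u : Gam) (A B C D : dgdata Gam)
    (f : freeAlg (gen A) -> freeAlg (gen B))
    (g : freeAlg (gen A) -> freeAlg (gen C))
    (f' : freeAlg (gen B) -> freeAlg (gen D))
    (g' : freeAlg (gen C) -> freeAlg (gen D)) : Prop :=
  [/\ [/\ is_dga u A, is_dga u B, is_dga u C & is_dga u D],
      [/\ is_dga_morphism f, is_dga_morphism g,
          is_dga_morphism f' & is_dga_morphism g'],
      f' \o f =1 g' \o g &
      forall (Z : dgdata Gam), is_dga u Z ->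
      forall (p : freeAlg (gen B) -> freeAlg (gen Z))
             (q : freeAlg (gen C) -> freeAlg (gen Z)),
        is_dga_morphism p -> is_dga_morphism q -> p \o f =1 q \o g ->
        exists h : freeAlg (gen D) -> freeAlg (gen Z),
          [/\ is_dga_morphism h, h \o f' =1 p, h \o g' =1 q &
              forall k : freeAlg (gen D) -> freeAlg (gen Z),
                is_dga_morphism k -> k \o f' =1 p -> k \o g' =1 q -> k =1 h]].

Definition smooth_on (R : realType) (A : set R) (f : R -> R) : Prop :=
  forall (n : nat) x, A x -> derivable (derive1n n f) x 1.

(* The graphs of f and g share at x0 a semicubical cusp with f the upper branch,
   and they lie to the right of x0 if e = 1 and to the left if e = -1: the two
   branches together are the curve t |-> (x0 + e t^2, phi t), whose Legendrian
   lift has y-coordinate phi'(t) / (2 e t). *)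
Definition cusp_germ (R : realType) (e : R) (f g : R -> R) (x0 : R) : Prop :=
  exists (phi : R -> R) (d : R),
    [/\ 0 < d, smooth_on [set t | `|t| < d] phi,
        derive1n 1 phi 0 = 0, 0 < derive1n 3 phi 0 &
        forall t, 0 <= t < d ->
          f (x0 + e * t ^+ 2) = phi t /\ g (x0 + e * t ^+ 2) = phi (- t)].

(* A front is cut at its cusps into strands; since it has no vertical tangent,
   the strand s is the graph of [ht s] over [lft s, rgt s].  At its left
   (right) end it meets [lmate s] (resp. [rmate s]) in a cusp.  All other
   intersections are transverse double points in the interior of the two
   strands. *)
Record front (R : realType) := Front {
  strand : finType;
  lft : strand -> R;
  rgt : strand -> R;
  ht : strand -> R -> R;
  lmate : strand -> strand;
  rmate : strand -> strand;
  lft_lt_rgt : forall s, lft s < rgt s;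
  ht_smooth : forall s, smooth_on [set x | lft s < x < rgt s] (ht s);
  lmateK : involutive lmate;
  rmateK : involutive rmate;
  lft_lmate : forall s, lft (lmate s) = lft s;
  rgt_rmate : forall s, rgt (rmate s) = rgt s;
  left_cusps : forall s,
    cusp_germ 1 (ht s) (ht (lmate s)) (lft s) \/
    cusp_germ 1 (ht (lmate s)) (ht s) (lft s);
  right_cusps : forall s,
    cusp_germ (-1) (ht s) (ht (rmate s)) (rgt s) \/
    cusp_germ (-1) (ht (rmate s)) (ht s) (rgt s);
  intersections : forall s t x, s != t ->
    lft s <= x <= rgt s -> lft t <= x <= rgt t -> ht s x = ht t x ->
    [\/ x = lft s /\ t = lmate s,
        x = rgt s /\ t = rmate s |
        [/\ lft s < x < rgt s, lft t < x < rgt t &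
            derive1 (ht s) x != derive1 (ht t) x]];
  no_triple_point : forall s t r x, s != t -> t != r -> s != r ->
    lft s <= x <= rgt s -> lft t <= x <= rgt t -> lft r <= x <= rgt r ->
    ~ (ht s x = ht t x /\ ht t x = ht r x);
  finite_crossings : finite_set [set p : R * R | exists s t,
    [/\ s != t, lft s < p.1 < rgt s, lft t < p.1 < rgt t,
        ht s p.1 = p.2 & ht t p.1 = p.2]] }.

Section Fronts.
Context (R : realType) (F : front R).

Implicit Types (s t : strand F) (p q v : R * R) (D : set (R * R)) (c x : R).

Definition inside s x : bool := lft s < x < rgt s.

Definition front_set : set (R * R) :=
  [set p | exists s, lft s <= p.1 <= rgt s /\ p.2 = ht s p.1].

Definition is_left_cusp p : Prop := exists s, p = (lft s, ht s (lft s)).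

Definition is_right_cusp p : Prop := exists s, p = (rgt s, ht s (rgt s)).

(* s is the top strand, the one of smaller slope. *)
Definition crossing s t p : Prop :=
  [/\ inside s p.1, inside t p.1, ht s p.1 = p.2, ht t p.1 = p.2 &
      derive1 (ht s) p.1 < derive1 (ht t) p.1].

Definition is_crossing p : Prop := exists s t, crossing s t p.

Definition is_maslov (Gam : zmodType) (u : Gam) (mu : strand F -> Gam) : Prop :=
  (forall s, cusp_germ 1 (ht s) (ht (lmate s)) (lft s) ->
     mu s = mu (lmate s) + u) /\
  (forall s, cusp_germ (-1) (ht s) (ht (rmate s)) (rgt s) ->
     mu s = mu (rmate s) + u).

(* The vertical line at c misses the cusps and the crossings.  It may miss the
   front altogether: this covers the case of an absent dividing line. *)
Definition dividing_line c : Prop :=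
  (forall s, lft s != c /\ rgt s != c) /\
  (forall p, is_crossing p -> p.1 != c).

(* The piece of the front between the vertical lines at c and c' is simple.
   Every right cusp is on the boundary of the region to its left; what is
   excluded is a compact region K that contains a right cusp in its interior. *)
Definition simple_piece c c' : Prop :=
  forall p, is_right_cusp p -> c < p.1 < c' ->
  ~ exists K : set (R * R),
      [/\ compact K, K° p &
          forall q, K q -> ~ K° q ->
            [\/ q.1 = c, q.1 = c' | c <= q.1 <= c' /\ front_set q]].

(* The points above the strand s (b = true), or below it (b = false). *)
Definition side (b : bool) s : set (R * R) :=
  [set q | if b then ht s q.1 <= q.2 else q.2 <= ht s q.1].

Definition smooth_at D p : Prop :=
  exists s b, [/\ inside s p.1, ht s p.1 = p.2 &
                  \forall q \near p, D q <-> side b s q].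

(* Near the crossing p of s and t, D is one of the four regions cut out by the
   front: the lower one for b = b' = false, the upper one for b = b' = true. *)
Definition corner_at (b b' : bool) D p : Prop :=
  exists s t, crossing s t p /\
              \forall q \near p, D q <-> side b s q /\ side b' t q.

(* A disk in the piece between c and c', with leftmost and rightmost parts over
   x0 and x1.  In the absence of vertical tangents the boundary can only turn
   back at its leftmost and at its rightmost part, so that it consists of an
   upper arc and a lower arc that are graphs over [x0, x1]. *)
Definition disk_between c c' D (x0 x1 : R) (lo hi : R -> R) : Prop :=
  [/\ [/\ c <= x0, x0 < x1 & x1 <= c'],
      {within `[x0, x1], continuous lo} /\ {within `[x0, x1], continuous hi},
      (forall x, x0 <= x <= x1 -> front_set (x, lo x) /\ front_set (x, hi x)) /\
      (forall x, x0 < x < x1 -> lo x < hi x),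
      D = [set p | x0 <= p.1 <= x1 /\ lo p.1 <= p.2 <= hi p.1] &
      forall p, D p -> ~ D° p -> x0 < p.1 < x1 ->
        smooth_at D p \/ exists b b', corner_at b b' D p].

Definition left_end_cusp (x0 : R) (lo hi : R -> R) : Prop :=
  lo x0 = hi x0 /\ is_left_cusp (x0, hi x0).

Definition left_end_line c (x0 : R) (lo hi : R -> R) : Prop :=
  x0 = c /\ lo x0 < hi x0.

Definition right_end_vertex v (x1 : R) (lo hi : R -> R) : Prop :=
  (x1, lo x1) = v /\ (x1, hi x1) = v.

Definition right_end_line c' s t (x1 : R) (lo hi : R -> R) : Prop :=
  [/\ x1 = c', hi x1 = ht s x1, lo x1 = ht t x1 & lo x1 < hi x1].

Definition Disk c c' v : set (set (R * R)) :=
  [set D | exists x0 x1 lo hi,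
     [/\ disk_between c c' D x0 x1 lo hi,
         left_end_cusp x0 lo hi & right_end_vertex v x1 lo hi]].

Definition Half_D c c' v : set (set (R * R)) :=
  [set D | exists x0 x1 lo hi,
     [/\ disk_between c c' D x0 x1 lo hi,
         left_end_line c x0 lo hi & right_end_vertex v x1 lo hi]].

(* The points of a dividing line are named by the strands through them, s being
   above t. *)
Definition Half_DA c c' s t : set (set (R * R)) :=
  [set D | exists x0 x1 lo hi,
     [/\ disk_between c c' D x0 x1 lo hi,
         left_end_cusp x0 lo hi \/ left_end_line c x0 lo hi &
         right_end_line c' s t x1 lo hi]].

Definition vertices c c' : set (R * R) :=
  [set p | c < p.1 < c' /\ (is_crossing p \/ is_right_cusp p)].

(* (s, t) stands for the pair of indices i < j of the points of s and t on the
   line at c. *)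
Definition line_pairs c : set (strand F * strand F) :=
  [set st | [/\ inside st.1 c, inside st.2 c & ht st.2 c < ht st.1 c]].

Definition DA_gen c c' : choiceType :=
  (set_type (vertices c c') + set_type (line_pairs c))%type.

(* The generators attached to a vertex and to a pair of strands.  The value 0
   is only a default for arguments that do not name a generator. *)
Definition vgen c c' p : freeAlg (DA_gen c c') :=
  if insub p is Some v then @fgen (DA_gen c c') (inl v) else 0.

Definition rho c c' s t : freeAlg (DA_gen c c') :=
  if insub (s, t) is Some r then @fgen (DA_gen c c') (inr r) else 0.

(* The factor of the boundary word that comes from the left end of D. *)
Definition left_letter c c' D : freeAlg (DA_gen c c') :=
  if [pick st : strand F * strand F | `[< line_pairs c st /\
        forall z, D (c, z) <-> ht st.2 c <= z <= ht st.1 c >]] is Some st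
  then rho c c' st.1 st.2 else 1.

(* Counterclockwise from the right end: the upper arc from right to left, the
   left end, the lower arc from left to right.  On the upper (lower) arc the
   disk lies below (above) both strands at a corner. *)
Definition bdry_word c c' D : freeAlg (DA_gen c c') :=
  (\prod_(p <- sort (fun p q : R * R => q.1 <= p.1)
                 (fset_set [set p | corner_at false false D p]))
      vgen c c' p) *
  left_letter c c' D *
  (\prod_(p <- sort (fun p q : R * R => p.1 <= q.1)
                 (fset_set [set p | corner_at true true D p]))
      vgen c c' p).

Definition DA_dif_vertex c c' v : freeAlg (DA_gen c c') :=
  (if `[< is_right_cusp v >] then 1 else 0)
  + \sum_(D \in Disk c c' v) bdry_word c c' D
  + \sum_(D \in Half_D c c' v) bdry_word c c' D.

Definition DA_dif_rho c c' s t : freeAlg (DA_gen c c') :=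
  \sum_(r | inside r c && (ht t c < ht r c < ht s c))
     rho c c' s r * rho c c' r t.

Definition DA_dif_gen c c' (x : DA_gen c c') : freeAlg (DA_gen c c') :=
  match x with
  | inl v => DA_dif_vertex c c' (val v)
  | inr r => DA_dif_rho c c' (val r).1 (val r).2
  end.

Section Grading.
Context (Gam : zmodType) (u : Gam) (mu : strand F -> Gam).

Definition vertex_deg v : Gam :=
  if [pick st : strand F * strand F | `[< crossing st.1 st.2 v >]] is Some st
  then mu st.1 - mu st.2 else u.

Definition DA_deg c c' (x : DA_gen c c') : Gam :=
  match x with
  | inl v => vertex_deg (val v)
  | inr r => mu (val r).1 - mu (val r).2 - u
  end.

Definition DA c c' : dgdata Gam :=
  @DGData Gam (DA_gen c c') (@DA_deg c c') (der_ext (@DA_dif_gen c c')).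

End Grading.

Definition DA_incl c c' c'' : freeAlg (DA_gen c c') -> freeAlg (DA_gen c c'') :=
  alg_ext (fun x : DA_gen c c' =>
    match x with
    | inl v => vgen c c'' (val v)
    | inr r => rho c c'' (val r).1 (val r).2
    end).
Arguments DA_incl : clear implicits.

Definition w_elt c c' s t : freeAlg (DA_gen c c') :=
  \sum_(D \in Half_DA c c' s t) bdry_word c c' D.

(* The part [c, c'] of the piece [c, c''] is the one on the left of the dividing
   line at c'. *)
Definition DA_w c c' c'' : freeAlg (DA_gen c' c'') -> freeAlg (DA_gen c c'') :=
  alg_ext (fun x : DA_gen c' c'' =>
    match x with
    | inl v => vgen c c'' (val v)
    | inr r => DA_incl c c' c'' (w_elt c c' (val r).1 (val r).2)
    end).

Arguments DA_w : clear implicits.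

End Fronts.

Arguments DA_incl [R F] c c' c'' _.
Arguments DA_w [R F] c c' c'' _.

(* Main.v *)
Require Import Defs.
From mathcomp Require Import all_boot all_order all_algebra.
From mathcomp Require Import finmap monalg.
From mathcomp Require Import all_classical all_reals all_analysis.
From mathcomp Require Import lra.

Set Implicit Arguments.
Unset Strict Implicit.
Unset Printing Implicit Defensive.

Import Order.TTheory GRing.Theory Num.Theory.
Import numFieldNormedType.Exports.

Local Open Scope classical_set_scope.
Local Open Scope ring_scope.

(** The square is understood by sweeping a vertical line across the front.

    Fix the left dividing line at [c], and let [W] be the matrix, indexed by pairs
    of strands [s] above [t], of the sums of the boundary words of all half-disks
    whose right end is the segment from [s] to [t] over the abscissa [x]
    ([disk_mx]).  Just after the dividing line there is one half-disk for each
    pair, so that [W] consists of the generators [rho].  When [x] passes the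
    abscissa of some cusps and crossings, a half-disk goes on along its two
    strands or turns at a crossing, and a new one is born at each left cusp.
    Hence the transfer formula [disk_mx_step]: the new matrix is [U W U], plus 1
    for each birth, where [U = 1 + V] and [V] is the matrix of these crossings.
    Its geometric input is local.  As there are no vertical tangents, a disk lies
    between two arcs that are graphs, and the condition on its boundary says that
    near each abscissa an arc is a strand or an extremum of two strands that
    cross ([boundary_arcs]); so an arc can pass the event exactly in the ways that
    [U] lists ([half_cases], [half_extend]).

    The boundary of a vertex is 0 or 1 plus the entry of [W], just before the
    vertex, for the two strands that meet there ([dif_vertex]).  Thus everything
    can be read off [W], by induction on the events ([event_ind]).

    The differential.  The generators [rho] satisfy [d W = W * W].  At
    crossings [V * V = 0], and [d V] consists of entries of [W], so the transfer
    is a gauge transformation and conjugates the curvature [d W + W * W]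
    ([gauge]).  At a right cusp the products in [W * W] that pass through one of
    the two ending strands are lost.  Such a product comes from two half-disks,
    one above and one below that strand, which together with the strips that
    follow surround the cusp ([trapped_cusp]).  So the relation [d W = W * W] can
    only fail for two strands that enclose a right cusp ([defect_trapped]), and
    simplicity forbids this over a dividing line and at a vertex.  At a vertex
    the entry of [W * W] is an empty sum, and the square of the differential is 0.

    The maps.  The inclusion and [w] are algebra maps that fix the crossings and
    match the matrices [W] just after the dividing line of their source, so they
    match them everywhere by the transfer formula ([incl_disk_mx],
    [w_disk_mx]).  Hence they commute with the boundaries of vertices.  On the
    generators [rho] of the line in the middle, [w] is a chain map because of
    [d W = W * W] over that line, and the square commutes because both ways
    around it give [W].

    The pushout.  Each generator of the whole piece is the image of an element of
    one of the other two corners ([generator_cases]), so the map out of it is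
    determined.  It exists because the algebra is free; the two given maps agree
    on the vertices of the middle piece, which are the only generators that come
    from both corners. *)

(** * Free algebras over the field with two elements *)

Lemma leibniz_assoc (A : nzRingType) (a b c e a' b' : A) :
  e * (a * b) + c * (a' * b + a * b') = (e * a + c * a') * b + c * a * b'.
Proof. by rewrite mulrDl mulrDr !mulrA addrA. Qed.

(** All that matters about the free algebra is that words span it additively
    and multiply by concatenation: additive identities need only be checked on
    words, and multiplicative ones on letters. *)
Section SpannedRing.
Context (X : Type) (A : nzRingType) (w : seq X -> A).
Hypothesis spanned : forall P : A -> Prop, P 0 ->
  (forall a b, P a -> P b -> P (a + b)) -> (forall m, P (w m)) -> forall a, P a.
Hypothesis w_nil : w [::] = 1.
Hypothesis w_cat : forall m n, w (m ++ n) = w m * w n.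

Lemma spanned_additive0 (B : nzRingType) (F : A -> B) :
  (forall a b, F (a + b) = F a + F b) -> F 0 = 0.
Proof. by move=> FD; apply: (@addrI _ (F 0)); rewrite -FD !addr0. Qed.

Lemma spanned_morph (B : nzRingType) (F : A -> B) :
  (forall a b, F (a + b) = F a + F b) ->
  (forall m n, F (w (m ++ n)) = F (w m) * F (w n)) ->
  forall a b, F (a * b) = F a * F b.
Proof.
move=> FD Fw a b; have F0 := spanned_additive0 FD.
elim/spanned: a => [|a a' IH IH'|m]; first by rewrite mul0r F0 mul0r.
  by rewrite mulrDl !FD IH IH' mulrDl.
elim/spanned: b => [|b b' IH IH'|n]; first by rewrite mulr0 F0 mulr0.
  by rewrite mulrDr !FD IH IH' mulrDr.
by rewrite -w_cat Fw.
Qed.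

Lemma spanned_derivation (d : A -> A) :
  (forall a b, d (a + b) = d a + d b) ->
  (forall m n, d (w (m ++ n)) = d (w m) * w n + w m * d (w n)) ->
  forall a b, d (a * b) = d a * b + a * d b.
Proof.
move=> dD dw a b; have d0 := spanned_additive0 dD.
elim/spanned: a => [|a a' IH IH'|m]; first by rewrite !(mul0r, d0) addr0.
  by rewrite mulrDl !dD IH IH' !mulrDl addrACA.
elim/spanned: b => [|b b' IH IH'|n]; first by rewrite !(mulr0, d0) addr0.
  by rewrite mulrDr !dD IH IH' !mulrDr addrACA.
by rewrite -w_cat dw.
Qed.

Lemma spanned_morph_eq (B : nzRingType) (f g : A -> B) :
  (forall a b, f (a + b) = f a + f b) -> (forall a b, g (a + b) = g a + g b) ->
  (forall a b, f (a * b) = f a * f b) -> (forall a b, g (a * b) = g a * g b) ->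
  f 1 = 1 -> g 1 = 1 -> (forall x, f (w [:: x]) = g (w [:: x])) -> f =1 g.
Proof.
move=> fD gD fM gM f1 g1 fg; elim/spanned => [|a b IHa IHb|m].
- by rewrite !spanned_additive0.
- by rewrite fD gD IHa IHb.
elim: m => [|x m IH]; first by rewrite w_nil f1 g1.
by rewrite -cat1s w_cat fM gM IH fg.
Qed.

Lemma spanned_chain (B : nzRingType) (f : A -> B) (dA : A -> A) (dB : B -> B) :
  (forall a b, f (a + b) = f a + f b) -> (forall a b, f (a * b) = f a * f b) ->
  f 1 = 1 ->
  (forall a b, dA (a + b) = dA a + dA b) -> (forall a b, dB (a + b) = dB a + dB b) ->
  (forall a b, dA (a * b) = dA a * b + a * dA b) ->
  (forall a b, dB (a * b) = dB a * b + a * dB b) ->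
  (forall x, f (dA (w [:: x])) = dB (f (w [:: x]))) ->
  forall a, f (dA a) = dB (f a).
Proof.
move=> fD fM f1 dAD dBD dAM dBM H.
have f0 := spanned_additive0 fD; have dA0 := spanned_additive0 dAD.
have dB0 : dB 0 = 0 by apply: (@addrI _ (dB 0)); rewrite -dBD !addr0.
have dA1 : dA 1 = 0.
  by apply: (@addrI _ (dA 1)); have := dAM 1 1; rewrite !mulr1 mul1r addr0.
have dB1 : dB 1 = 0.
  by apply: (@addrI _ (dB 1)); have := dBM 1 1; rewrite !mulr1 mul1r addr0.
elim/spanned => [|a b IHa IHb|m]; first by rewrite dA0 f0 dB0.
  by rewrite dAD !fD dBD IHa IHb.
elim: m => [|x m IH]; first by rewrite w_nil f1 dB1 dA1.
by rewrite -cat1s w_cat dAM fD !fM dBM H IH.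
Qed.

(** In characteristic 2 the square of a derivation is again a derivation, so it
    vanishes as soon as it does so on generators. *)
Lemma spanned_der_sq (d : A -> A) : (forall a : A, a + a = 0) ->
  (forall a b, d (a + b) = d a + d b) ->
  (forall a b, d (a * b) = d a * b + a * d b) ->
  (forall x, d (d (w [:: x])) = 0) -> forall a, d (d a) = 0.
Proof.
move=> add2 dD dM d2; have d0 := spanned_additive0 dD.
have d1 : d 1 = 0.
  by apply: (@addrI _ (d 1)); have := dM 1 1; rewrite !mulr1 mul1r addr0.
elim/spanned => [|a b IHa IHb|m]; first by rewrite !d0.
  by rewrite !dD IHa IHb addr0.
elim: m => [|x m IH]; first by rewrite w_nil d1 d0.
by rewrite -cat1s w_cat !(dM, dD) IH d2 mul0r mulr0 addr0 add0r add2.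
Qed.

End SpannedRing.

Section FreeAlgebra.
Implicit Types X Y : choiceType.

Lemma F2_cases (a : 'F_2) : a = 0 \/ a = 1.
Proof.
by case: a => [[|[|m]] /= H]; [left|right|]; try exact/val_inj.
Qed.

Lemma addff X (a : freeAlg X) : a + a = 0.
Proof.
apply/malgP => k; rewrite mcoeffD mcoeff0.
by case: (F2_cases (mcoeff k a)) => ->; apply/val_inj.
Qed.

Lemma oppf X (a : freeAlg X) : - a = a.
Proof. by apply/eqP; rewrite eq_sym -subr_eq0 opprK addff. Qed.

Definition word X (m : seq X) : freeAlg X := \prod_(x <- m) fgen x.

Lemma wordE X (m : {fmonom X}) : mkmalgU m (1 : 'F_2) = word m.
Proof.
rewrite /word; case: m => m /=.
elim: m => [|x m IH].
  rewrite big_nil -mpolyC1E.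
  by congr mkmalgU; apply/eqP; rewrite fmP fm1.
rewrite big_cons -IH /fgen malgM_def fgmulUU mul1r.
by congr mkmalgU; apply/eqP; rewrite fmP fmM fmU.
Qed.

Lemma free_ind X (P : freeAlg X -> Prop) :
  P 0 -> (forall a b, P a -> P b -> P (a + b)) -> (forall m, P (word m)) ->
  forall a, P a.
Proof.
move=> P0 PD Pw a; rewrite (monalgE a).
apply: (big_ind P) => // m _.
case: (F2_cases (mcoeff m a)) => ->; first by rewrite monalgU0.
by rewrite wordE.
Qed.

Definition lin_ext X Y (h : seq X -> freeAlg Y) (a : freeAlg X) : freeAlg Y :=
  \sum_(m <- msupp a) mcoeff m a *: h (m : {fmonom X}).

Lemma lin_extEw X Y (h : seq X -> freeAlg Y) (a : freeAlg X) (d : {fset {fmonom X}}) :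
  (msupp a `<=` d)%fset -> lin_ext h a = \sum_(m <- d) mcoeff m a *: h m.
Proof.
move=> le; rewrite /lin_ext (big_fset_incl _ le) // => m _ /mcoeff_outdom ->.
by rewrite scale0r.
Qed.

Lemma lin_extD X Y (h : seq X -> freeAlg Y) a b : lin_ext h (a + b) = lin_ext h a + lin_ext h b.
Proof.
pose d := (msupp a `|` msupp b)%fset.
rewrite (lin_extEw h (d := d) (msuppD_le a b)) (lin_extEw h (d := d) (fsubsetUl _ _))
  (lin_extEw h (d := d) (fsubsetUr _ _)) -big_split /=.
by apply: eq_bigr => m _; rewrite mcoeffD scalerDl.
Qed.

Lemma lin_extW X Y (h : seq X -> freeAlg Y) m : lin_ext h (word m) = h m.
Proof.
have -> : word m = mkmalgU (FMonom m) (1 : 'F_2) by rewrite wordE.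
by rewrite /lin_ext msuppU oner_eq0 big_seq_fset1 mcoeffUU scale1r.
Qed.

Lemma lin_ext0 X Y (h : seq X -> freeAlg Y) : lin_ext h 0 = 0.
Proof. by rewrite /lin_ext msupp0 big_seq_fset0. Qed.

Lemma word_cat X (m n : seq X) : word (m ++ n) = word m * word n.
Proof. by rewrite /word big_cat. Qed.

Lemma word_nil X : @word X [::] = 1.
Proof. by rewrite /word big_nil. Qed.

Lemma word1 X (x : X) : word [:: x] = fgen x.
Proof. by rewrite /word big_seq1. Qed.

Lemma add_zmod X Y (f : freeAlg X -> freeAlg Y) :
  (forall a b, f (a + b) = f a + f b) -> zmod_morphism f.
Proof. by move=> fD a b; rewrite !oppf fD. Qed.

Lemma zmod_addP X Y (f : freeAlg X -> freeAlg Y) : zmod_morphism f ->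
  (forall a b, f (a + b) = f a + f b).
Proof. by move=> fB a b; rewrite -(oppf b) fB !oppf. Qed.

Lemma add_zero X Y (f : freeAlg X -> freeAlg Y) :
  (forall a b, f (a + b) = f a + f b) -> f 0 = 0.
Proof. by move=> fD; rewrite -(addff 0) fD addff. Qed.

Lemma add_sum X Y (f : freeAlg X -> freeAlg Y) :
  (forall a b, f (a + b) = f a + f b) ->
  forall (I : Type) (r : seq I) P (F : I -> freeAlg X),
    f (\sum_(i <- r | P i) F i) = \sum_(i <- r | P i) f (F i).
Proof. by move=> fD I r P F; apply: (big_morph f fD (add_zero fD)). Qed.

Section AlgExt.
Context X Y (f : X -> freeAlg Y).

Lemma alg_extD a b : alg_ext f (a + b) = alg_ext f a + alg_ext f b.
Proof. exact: (lin_extD (fun m => \prod_(x <- m) f x)). Qed.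

Lemma alg_extW m : alg_ext f (word m) = \prod_(x <- m) f x.
Proof. exact: (lin_extW (fun m => \prod_(x <- m) f x)). Qed.

Lemma alg_ext0 : alg_ext f 0 = 0.
Proof. exact: (lin_ext0 (fun m => \prod_(x <- m) f x)). Qed.

Lemma alg_ext_gen x : alg_ext f (fgen x) = f x.
Proof. by rewrite -word1 alg_extW big_seq1. Qed.

Lemma alg_ext1 : alg_ext f 1 = 1.
Proof. by have := alg_extW [::]; rewrite /word !big_nil. Qed.

Lemma alg_extM a b : alg_ext f (a * b) = alg_ext f a * alg_ext f b.
Proof.
apply: (spanned_morph (@free_ind X) (@word_cat X) alg_extD) => m n.
by rewrite !alg_extW big_cat.
Qed.

Lemma alg_ext_sum I (r : seq I) (P : pred I) F :
  alg_ext f (\sum_(i <- r | P i) F i) = \sum_(i <- r | P i) alg_ext f (F i).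
Proof. exact: (add_sum alg_extD). Qed.

End AlgExt.

Definition alg_map X Y (f : freeAlg X -> freeAlg Y) : Prop :=
  zmod_morphism f /\ monoid_morphism f.

Lemma alg_map_ext X Y (f : X -> freeAlg Y) : alg_map (alg_ext f).
Proof. by split; [apply: add_zmod; exact: alg_extD|split; [exact: alg_ext1|exact: alg_extM]]. Qed.

Lemma alg_map_comp X Y Z (f : freeAlg X -> freeAlg Y) (g : freeAlg Y -> freeAlg Z) :
  alg_map g -> alg_map f -> alg_map (g \o f).
Proof.
move=> [gB [g1 gM]] [fB [f1 fM]]; split; last split.
- exact: (fun a b => etrans (congr1 g (fB a b)) (gB _ _)).
- exact: etrans (congr1 g f1) g1.
- exact: (fun a b => etrans (congr1 g (fM a b)) (gM _ _)).
Qed.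

Lemma alg_map_eq X Y (f g : freeAlg X -> freeAlg Y) : alg_map f -> alg_map g ->
  (forall x, f (fgen x) = g (fgen x)) -> f =1 g.
Proof.
move=> [fB [f1 fM]] [gB [g1 gM]] fg.
apply: (spanned_morph_eq (@free_ind X) (word_nil X) (@word_cat X)
          (zmod_addP fB) (zmod_addP gB) fM gM f1 g1).
by move=> x; rewrite word1.
Qed.

Section DerExt.
Context X (d : X -> freeAlg X).

Lemma der_extD a b : der_ext d (a + b) = der_ext d a + der_ext d b.
Proof. exact: (lin_extD (der_word d)). Qed.

Lemma der_extW m : der_ext d (word m) = der_word d m.
Proof. exact: (lin_extW (der_word d)). Qed.

Lemma der_ext0 : der_ext d 0 = 0.
Proof. exact: (lin_ext0 (der_word d)). Qed.

Lemma der_ext_gen x : der_ext d (fgen x) = d x.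
Proof. by rewrite -word1 der_extW /= big_nil mulr1 mulr0 addr0. Qed.

Lemma der_ext1 : der_ext d 1 = 0.
Proof. by have := der_extW [::]; rewrite /word !big_nil. Qed.

Lemma der_word_cat m n :
  der_word d (m ++ n) = der_word d m * word n + word m * der_word d n.
Proof.
elim: m => [|x m IH] /=; first by rewrite /word big_nil mul0r add0r mul1r.
have -> : word (x :: m) = fgen x * word m by rewrite -cat1s word_cat word1.
rewrite big_cat /= -/(word m) -/(word n).
move: (word m) (word n) (fgen x) (d x) (der_word d m) (der_word d n)
  (der_word d (m ++ n)) IH => a b c e a' b' i ->.
exact: leibniz_assoc.
Qed.

Lemma der_extM a b : der_ext d (a * b) = der_ext d a * b + a * der_ext d b.
Proof.
apply: (spanned_derivation (@free_ind X) (@word_cat X) der_extD) => m n.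
by rewrite !der_extW der_word_cat.
Qed.

Lemma der_ext_sq : (forall x, der_ext d (d x) = 0) ->
  forall a, der_ext d (der_ext d a) = 0.
Proof.
move=> d2.
apply: (spanned_der_sq (@free_ind X) (word_nil X) (@word_cat X) (@addff X)).
- exact: der_extD.
- exact: der_extM.
by move=> x; rewrite word1 der_ext_gen d2.
Qed.

End DerExt.

(** Both sides are derivations along [f], so generators are enough. *)
Lemma chain_gen X Y (f : freeAlg X -> freeAlg Y) dX dY :
  (forall a b, f (a + b) = f a + f b) -> (forall a b, f (a * b) = f a * f b) ->
  f 1 = 1 ->
  (forall a b, dX (a + b) = dX a + dX b) ->
  (forall a b, dY (a + b) = dY a + dY b) ->
  (forall a b, dX (a * b) = dX a * b + a * dX b) ->
  (forall a b, dY (a * b) = dY a * b + a * dY b) ->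
  (forall x, f (dX (fgen x)) = dY (f (fgen x))) ->
  forall a, f (dX a) = dY (f a).
Proof.
move=> fD fM f1 dXD dYD dXM dYM H.
apply: (spanned_chain (@free_ind X) (word_nil X) (@word_cat X) fD fM f1 dXD dYD dXM dYM).
by move=> x; rewrite word1.
Qed.

Section Homogeneous.
Context (Gam : zmodType) (A : dgdata Gam).
Notation hom := (@homogeneous Gam A).

Lemma hom0 g : hom g 0.
Proof. by move=> m; rewrite msupp0 in_fset0. Qed.

Lemma homD g a b : hom g a -> hom g b -> hom g (a + b).
Proof.
move=> ha hb m /(fsubsetP (msuppD_le a b)).
by rewrite in_fsetU => /orP[/ha|/hb].
Qed.

Lemma hom_word m : hom (\sum_(x <- m) deg x) (word m).
Proof.
have -> : word m = mkmalgU (FMonom m) (1 : 'F_2) by rewrite wordE.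
by move=> k; rewrite msuppU oner_eq0 in_fset1 => /eqP ->.
Qed.

Lemma hom1 : hom 0 1.
Proof. by have := @hom_word [::]; rewrite big_nil /word big_nil. Qed.

Lemma hom_gen x : hom (deg x) (fgen x).
Proof. by have := @hom_word [:: x]; rewrite big_seq1 word1. Qed.

Lemma homM g h a b : hom g a -> hom h b -> hom (g + h) (a * b).
Proof.
move=> ha hb m /(msuppM_le).
move=> [k1] [k2] [k1a k2b ->].
by rewrite fmM big_cat /= ha // hb.
Qed.

Lemma hom_sum g I (r : seq I) (P : pred I) (F : I -> freeAlg (gen A)) :
  (forall i, P i -> hom g (F i)) -> hom g (\sum_(i <- r | P i) F i).
Proof. by move=> H; apply: (big_ind (hom g)) => //; [exact: hom0|exact: homD]. Qed.

(** A homogeneous element is a sum of words of its degree. *)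
Lemma hom_ind g (P : freeAlg (gen A) -> Prop) :
  P 0 -> (forall a b, P a -> P b -> P (a + b)) ->
  (forall m, \sum_(x <- m) deg x = g -> P (word m)) ->
  forall a, hom g a -> P a.
Proof.
move=> P0 PD Pw a ha; rewrite (monalgE a).
rewrite big_seq; apply: (big_ind P) => // m ma.
case: (F2_cases (mcoeff m a)) => ->; first by rewrite monalgU0.
by rewrite wordE; apply: Pw; apply: ha.
Qed.

End Homogeneous.

Lemma hom_alg_ext (Gam : zmodType) (A B : dgdata Gam) (f : gen A -> freeAlg (gen B)) :
  (forall x, @homogeneous _ B (deg x) (f x)) ->
  forall g a, @homogeneous _ A g a -> @homogeneous _ B g (alg_ext f a).
Proof.
move=> hf g; apply: hom_ind => [|a b|m <-].
- by rewrite alg_ext0; exact: hom0.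
- by rewrite alg_extD; exact: homD.
rewrite alg_extW; elim: m => [|x m IH]; first by rewrite !big_nil; exact: hom1.
by rewrite !big_cons; exact: homM.
Qed.

Lemma hom_der_ext (Gam : zmodType) (u : Gam) (A : dgdata Gam)
    (d : gen A -> freeAlg (gen A)) :
  (forall x, @homogeneous _ A (deg x - u) (d x)) ->
  forall g a, @homogeneous _ A g a -> @homogeneous _ A (g - u) (der_ext d a).
Proof.
move=> hd g; apply: hom_ind => [|a b|m <-].
- by rewrite der_ext0; exact: hom0.
- by rewrite der_extD; exact: homD.
rewrite der_extW; elim: m => [|x m IH] /=; first exact: hom0.
rewrite !big_cons; apply: homD.
  by rewrite addrAC; apply: homM => //; exact: hom_word.
by rewrite -addrA; apply: homM => //; exact: hom_gen.
Qed.

Lemma dga_alg_map (Gam : zmodType) (A B : dgdata Gam) (f : freeAlg (gen A) -> freeAlg (gen B)) :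
  @is_dga_morphism _ A B f -> alg_map f.
Proof. by case. Qed.

(** Degrees add up along words, and both [alg_ext f \o dif] and [dif \o alg_ext f]
    obey the Leibniz rule along [f], so it is enough to look at generators. *)
Lemma alg_ext_morphism (Gam : zmodType) (A B : dgdata Gam) (f : gen A -> freeAlg (gen B)) :
  (forall a b, @dif _ A (a + b) = dif a + dif b) ->
  (forall a b, @dif _ B (a + b) = dif a + dif b) ->
  (forall a b, @dif _ A (a * b) = dif a * b + a * dif b) ->
  (forall a b, @dif _ B (a * b) = dif a * b + a * dif b) ->
  (forall x, @homogeneous _ B (deg x) (f x)) ->
  (forall x, alg_ext f (@dif _ A (fgen x)) = @dif _ B (alg_ext f (fgen x))) ->
  @is_dga_morphism _ A B (alg_ext f).
Proof.
move=> dAD dBD dAM dBM fh fd; have [fB fM] := alg_map_ext f; split=> //.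
  exact: hom_alg_ext.
exact: (chain_gen (alg_extD f) (alg_extM f) (alg_ext1 f) dAD dBD dAM dBM fd).
Qed.

End FreeAlgebra.

(** * Continuity on the real line *)

Section RealLine.
Context (R : realType).
Implicit Types (f g : R -> R) (x y z a b d e : R) (P : R -> Prop).

Lemma nearP P x :
  (\forall z \near x, P z) <-> exists2 d, 0 < d & forall z, `|z - x| < d -> P z.
Proof.
split=> [/nbhs_ballP[d /= d0 H]|[d d0 H]].
  by exists d => // z zx; apply: H; rewrite /ball /= distrC.
apply/nbhs_ballP; exists d => //= z; rewrite /ball /= distrC; exact: H.
Qed.

Lemma near2P (P : R * R -> Prop) (p : R * R) :
  (\forall q \near p, P q) <-> exists2 d, 0 < d & forall q,
     `|q.1 - p.1| < d -> `|q.2 - p.2| < d -> P q.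
Proof.
split=> [/nbhs_ballP[d /= d0 H]|[d d0 H]].
  by exists d => // z zx zy; apply: H; split; rewrite /ball /= distrC.
apply/nbhs_ballP; exists d => //= z [] /=; rewrite /ball /=.
by rewrite distrC => h1; rewrite distrC => h2; exact: H.
Qed.

Definition cts f x := forall e, 0 < e -> exists2 d, 0 < d &
  forall z, `|z - x| < d -> `|f z - f x| < e.

Lemma ctsP f x : cts f x <-> {for x, continuous f}.
Proof.
split=> [H|/cvgrPdist_lt H e e0].
  apply/cvgrPdist_lt => e e0; have [d d0 Hd] := H e e0.
  by apply/nearP; exists d => // z; rewrite distrC; rewrite (distrC (f x)) distrC; exact: Hd.
have /nearP[d d0 Hd] := H e e0.
by exists d => // z /Hd; rewrite distrC.
Qed.

Definition ctsw a b f := forall x, a <= x <= b ->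
  forall e, 0 < e -> exists2 d, 0 < d &
  forall z, a <= z <= b -> `|z - x| < d -> `|f z - f x| < e.

Lemma ctswP a b f : ctsw a b f <-> {within `[a, b], continuous f}.
Proof.
split=> [H x|H x xab e e0].
  case: (pselect (a <= x <= b)) => xab; last first.
    move=> A /nbhs_singleton Afx /=.
    rewrite /nbhs /= /nbhs_subspace; case: ifPn => [|_].
      by rewrite inE /= in_itv /= => /xab.
    by move=> _ ->.
  apply/cvgrPdist_lt => e e0; have [d d0 Hd] := H x xab e e0.
  rewrite /prop_near1 /nbhs /= /nbhs_subspace; case: ifPn => [_|]; last first.
    by rewrite notin_setE /= in_itv /=.
  apply/nearP; exists d => // z zx /=; rewrite in_itv /= => zab.
  by rewrite distrC; apply: Hd.
have /cvgrPdist_lt/(_ _ e0) := H x.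
rewrite /prop_near1 /nbhs /= /nbhs_subspace; case: ifPn => [_|]; last first.
  by rewrite notin_setE /= in_itv /= xab.
move=> /nearP[d d0 Hd]; exists d => // z zab zx; rewrite distrC; exact: Hd.
Qed.

Lemma cts_ctsw a b f : (forall x, a <= x <= b -> cts f x) -> ctsw a b f.
Proof.
by move=> H x xab e e0; have [d d0 Hd] := H x xab e e0; exists d => // z _; apply: Hd.
Qed.

Lemma ctsw_cts a b f x : ctsw a b f -> a < x < b -> cts f x.
Proof.
move=> H xab e e0; have [d d0 Hd] := H x ltac:(lra) e e0.
exists (Num.min d (Num.min (x - a) (b - x))).
  by rewrite !lt_min; lra.
move=> z; rewrite !lt_min => /and3P[z1 z2 z3]; apply: Hd => //.
by move: z2 z3; rewrite !ltr_norml; lra.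
Qed.

Lemma ctsw_sub a b a' b' f : a <= a' -> b' <= b -> ctsw a b f -> ctsw a' b' f.
Proof.
move=> aa bb H x xab e e0; have [d d0 Hd] := H x ltac:(lra) e e0.
by exists d => // z zab; apply: Hd; lra.
Qed.

Lemma ctsw_eq a b f g : (forall x, a <= x <= b -> f x = g x) ->
  ctsw a b f -> ctsw a b g.
Proof.
move=> fg H x xab e e0; have [d d0 Hd] := H x xab e e0.
by exists d => // z zab; rewrite -!fg //; exact: Hd.
Qed.

Lemma ctsw_glue a b c f g : a <= b -> b <= c -> f b = g b ->
  ctsw a b f -> ctsw b c g -> ctsw a c (fun x => if x <= b then f x else g x).
Proof.
move=> ab bc fgb cf cg x xac e e0.
have [xb|xb|xb] := ltgtP x b.
- have [d d0 Hd] := cf x ltac:(lra) e e0.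
  exists (Num.min d (b - x)); first by rewrite lt_min; lra.
  move=> z zac; rewrite lt_min => /andP[zd zb].
  have zb' : z < b by move: zb; rewrite ltr_norml; lra.
  by rewrite (ltW zb'); apply: Hd; lra.
- have [d d0 Hd] := cg x ltac:(lra) e e0.
  exists (Num.min d (x - b)); first by rewrite lt_min; lra.
  move=> z zac; rewrite lt_min => /andP[zd zb].
  have zb' : b < z by move: zb; rewrite ltr_norml; lra.
  by rewrite leNgt zb' /=; apply: Hd; lra.
- rewrite xb in xac *.
  have [d d0 Hd] := cf b ltac:(lra) e e0.
  have [d' d0' Hd'] := cg b ltac:(lra) e e0.
  exists (Num.min d d'); first by rewrite lt_min; lra.
  move=> z zac; rewrite lt_min => /andP[zd zb].
  case: (leP z b) => zb'; first by apply: Hd; lra.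
  by rewrite fgb; apply: Hd'; lra.
Qed.

Lemma ctsB f g x : cts f x -> cts g x -> cts (fun z => f z - g z) x.
Proof. by move=> /ctsP cf /ctsP cg; apply/ctsP; exact: cvgB. Qed.

Lemma cts_min f g x : cts f x -> cts g x -> cts (fun z => Num.min (f z) (g z)) x.
Proof.
move=> cf cg e e0; have [d d0 Hd] := cf e e0; have [d' d0' Hd'] := cg e e0.
exists (Num.min d d'); first by rewrite lt_min d0.
move=> z; rewrite lt_min => /andP[/Hd + /Hd'].
rewrite !ltr_norml => h1 h2.
by case: (leP (f z) (g z)); case: (leP (f x) (g x)); lra.
Qed.

Lemma cts_max f g x : cts f x -> cts g x -> cts (fun z => Num.max (f z) (g z)) x.
Proof.
move=> cf cg e e0; have [d d0 Hd] := cf e e0; have [d' d0' Hd'] := cg e e0.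
exists (Num.min d d'); first by rewrite lt_min d0.
move=> z; rewrite lt_min => /andP[/Hd + /Hd'].
rewrite !ltr_norml => h1 h2.
by case: (leP (f z) (g z)); case: (leP (f x) (g x)); lra.
Qed.

Lemma ivt0 a b f : a <= b -> ctsw a b f -> f a < 0 -> 0 < f b ->
  exists2 c, a < c < b & f c = 0.
Proof.
move=> ab /ctswP cf fa fb.
have [|c] := IVT (v := 0) ab cf.
  by rewrite ge_min le_max (ltW fa) (ltW fb) orbT.
rewrite in_itv /= => cab fc; exists c => //.
have ca : c != a by apply: contraTneq fa => <-; rewrite fc ltxx.
have cb : c != b by apply: contraTneq fb => <-; rewrite fc ltxx.
by move: cab; rewrite !le_eqVlt (eq_sym a) (negbTE ca) (negbTE cb).
Qed.

(** On an interval where two functions never agree, continuity freezes their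
    order. *)
Lemma order_const a b f g x y : (forall z, a <= z <= b -> f z <> g z) ->
  ctsw a b (fun z => f z - g z) -> a <= x <= b -> a <= y <= b ->
  f x < g x -> f y < g y.
Proof.
move=> ne cf xab yab fx; rewrite ltNge; apply/negP => fy.
have {}fy : g y < f y.
  by rewrite lt_neqAle fy andbT; apply/eqP => /esym; exact: ne.
have [xy|yx] := leP x y.
  have [||||c cxy] := @ivt0 x y (fun z => f z - g z) => //; try lra.
    by apply: ctsw_sub cf; lra.
  by move=> fc; apply: (ne c); lra.
have cf' : ctsw a b (fun z => g z - f z).
  by move=> z zab e e0; have [d d0 Hd] := cf z zab e e0; exists d => // t tab tz;
     have := Hd t tab tz; rewrite !ltr_norml; lra.
have [||||c cxy] := @ivt0 y x (fun z => g z - f z) => //; try lra.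
  by apply: ctsw_sub cf'; lra.
by move=> fc; apply: (ne c); lra.
Qed.

(** Intervals are connected. *)
Lemma locally_constant P a b :
  (forall x, a <= x <= b -> \forall z \near x, a <= z <= b -> (P z <-> P x)) ->
  forall x y, a <= x <= b -> a <= y <= b -> P x -> P y.
Proof.
move=> H x y xab yab Px; apply: contrapT => Py.
pose f z : R := if `[< P z >] then -1 else 1.
have cf : ctsw a b f.
  move=> z zab e e0; have /nearP[d d0 Hd] := H z zab; exists d => // t tab tz.
  have [h1 h2] := Hd t tz tab; rewrite /f.
  case: asboolP => Pt; case: asboolP => Pz; rewrite ?subrr ?normr0 //; tauto.
have f0 z : f z <> 0 by rewrite /f; case: ifP; lra.
have fx : f x = -1 by rewrite /f asboolT.
have fy : f y = 1 by rewrite /f asboolF.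
have : f y < 0.
  apply: (@order_const a b f (fun => 0) x y) => //; last by rewrite fx; lra.
  by apply: ctsw_eq cf => z _; rewrite subr0.
by rewrite fy; lra.
Qed.

Lemma avoid (S : set R) a b : finite_set S -> a < b ->
  exists2 c, a < c < b & forall z, c <= z < b -> ~ S z.
Proof.
move=> /finite_seqP[s ->] ab.
suff [c cab H] : exists2 c, a < c < b & forall z, z \in s -> z < b -> z < c.
  exists c => // z /andP[cz zb] /= zs; have := H _ zs zb; lra.
elim: s => [|z s [c cab IH]]; first by exists ((a + b) / 2) => //; lra.
have [zb|zb] := ltP z b.
  exists ((Num.max c z + b) / 2).
    by case: (leP c z) => ?; lra.
  move=> t; rewrite inE => /orP[/eqP->|/IH H] tb.
    by case: (leP c z) => ?; lra.
  by have := H tb; case: (leP c z) => ?; lra.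
by exists c => // t; rewrite inE => /orP[/eqP->|]; [lra|exact: IH].
Qed.

End RealLine.

(** * Semicubical cusps *)

Section Derivatives.
Context (R : realType).
Implicit Types (f g : R -> R) (x y z a b d e : R).

Lemma derivable_cts f x : derivable f x 1 -> cts f x.
Proof. by move=> df; apply/ctsP/differentiable_continuous/derivable1_diffP. Qed.

Lemma derive_pos_local f x : derivable f x 1 -> 0 < derive1 f x ->
  exists2 d, 0 < d & forall z, `|z - x| < d ->
    (z < x -> f z < f x) /\ (x < z -> f x < f z).
Proof.
move=> df; rewrite derive1E => L0.
have cv : h^-1 *: (f (h *: 1 + x) - f x) @[h --> (0:R)^'] --> 'D_1 f x by exact: df.
have /nearP[d d0 Hd] : \forall h \near (0 : R), h != 0 ->
    0 < h^-1 *: (f (h *: 1 + x) - f x) by exact: (cvgr_gt _ cv _ L0).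
exists d => // z zx.
have key : z != x -> 0 < (z - x)^-1 * (f z - f x).
  move=> zneq; have := Hd (z - x); rewrite subr0 => /(_ zx).
  rewrite subr_eq0 => /(_ zneq).
  by rewrite [(z - x) *: 1]mulr1 subrK.
split=> zlt.
  have := key ltac:(by rewrite lt_eqF).
  by rewrite nmulr_rgt0 ?subr_lt0 // invr_lt0 subr_lt0.
have := key ltac:(by rewrite gt_eqF).
by rewrite pmulr_rgt0 ?subr_gt0 // invr_gt0 subr_gt0.
Qed.

Lemma derivable_sub_fun f g x : derivable f x 1 -> derivable g x 1 ->
  derivable (fun z => f z - g z) x 1 /\
  derive1 (fun z => f z - g z) x = derive1 f x - derive1 g x.
Proof.
move=> df dg; rewrite !derive1E; split; first exact: (@derivableB _ _ _ f g).
exact: (@deriveB _ _ _ f g).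
Qed.

Lemma derivable_add_fun f g x : derivable f x 1 -> derivable g x 1 ->
  derivable (fun z => f z + g z) x 1 /\
  derive1 (fun z => f z + g z) x = derive1 f x + derive1 g x.
Proof.
move=> df dg; rewrite !derive1E; split; first exact: (@derivableD _ _ _ f g).
exact: (@deriveD _ _ _ f g).
Qed.

Lemma derive_pos_incr f a b : a < b -> ctsw a b f ->
  (forall x, a < x < b -> derivable f x 1) ->
  (forall x, a < x < b -> 0 < derive1 f x) -> f a < f b.
Proof.
move=> ab /ctswP cf df f'0.
have [|c] := MVT (df := derive1 f) ab _ cf.
  move=> x; rewrite in_itv /= => /df dfx.
  by rewrite derive1E; apply: DeriveDef.
rewrite in_itv /= => /f'0 fc E.
by rewrite -subr_gt0 E mulr_gt0 // subr_gt0.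
Qed.

End Derivatives.

Section CuspGerms.
Context (R : realType).
Implicit Types (f g phi : R -> R) (x y z a b d e : R).

(** The odd part of a curve with vanishing first and positive third derivative
    has increasing derivative at 0, hence is positive to the right of 0. *)
Lemma odd_part_pos phi d : 0 < d -> smooth_on [set t | `|t| < d] phi ->
  derive1n 1 phi 0 = 0 -> 0 < derive1n 3 phi 0 ->
  exists2 r, 0 < r & forall t, 0 < t < r -> phi (- t) < phi t.
Proof.
move=> d0 sm phi1 phi3.
have sm0 t : `|t| < d -> derivable phi t 1 by exact: (sm 0%N).
have sm1 t : `|t| < d -> derivable (derive1 phi) t 1 by exact: (sm 1%N).
have sm2 : derivable (derive1n 2 phi) 0 1 by apply: (sm 2%N); rewrite /= normr0.
have [r r0 Hr] := derive_pos_local sm2 phi3.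
have reflD (f : R -> R) t : derivable f (- t) 1 ->
    derivable (fun z => f (- z)) t 1 /\ derive1 (fun z => f (- z)) t = - derive1 f (- t).
  move=> df; rewrite !derive1E.
  have [d1 d2] : is_derive t (1 : R) (f \o -%R) ('D_1 f (- t) * -1).
    by apply: is_derive1_comp; exact: DeriveDef.
  by split => //; rewrite d2 mulrN1.
exists (Num.min d r); first by rewrite lt_min d0.
move=> t; rewrite lt_min => /and3P[t0 td tr].
pose chi z := derive1 phi z + derive1 phi (- z).
pose psi z := phi z - phi (- z).
have bd z : 0 <= z <= t -> `|z| < d /\ `|- z| < d.
  by rewrite normrN => zt; rewrite ger0_norm; lra.
have psiD z : 0 <= z <= t -> derivable psi z 1 /\ derive1 psi z = chi z.
  move=> /bd[z1 z2]; have [h1 h2] := reflD _ _ (sm0 _ z2).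
  have [h3 h4] := derivable_sub_fun (sm0 _ z1) h1.
  by split; [exact: h3|rewrite [LHS]h4 h2 opprK].
have chiD z : 0 <= z <= t -> derivable chi z 1 /\
    derive1 chi z = derive1n 2 phi z - derive1n 2 phi (- z).
  move=> /bd[z1 z2]; have [h1 h2] := reflD _ _ (sm1 _ z2).
  have [h3 h4] := derivable_add_fun (sm1 _ z1) h1.
  by split; [exact: h3|rewrite [LHS]h4 h2].
have chi_pos z : 0 < z <= t -> 0 < chi z.
  move=> zt; have chi0 : chi 0 = 0 by rewrite /chi oppr0; move: phi1; rewrite /derive1n /= => ->; rewrite addr0.
  rewrite -chi0; apply: derive_pos_incr; first by lra.
  - by apply: cts_ctsw => u ut; have [h _] := chiD u ltac:(lra); exact: derivable_cts h.
  - by move=> u ut; have [h _] := chiD u ltac:(lra); exact: h.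
  move=> u ut; have [_ ->] := chiD u ltac:(lra).
  have [u0 u1] : 0 < u /\ u < r by lra.
  have ub : `|u - 0| < r by rewrite subr0 gtr0_norm.
  have ub' : `|(- u) - 0| < r by rewrite subr0 normrN gtr0_norm.
  have nu : - u < 0 by rewrite oppr_lt0.
  have [_ /(_ u0) h] := Hr u ub; have [/(_ nu) h' _] := Hr (- u) ub'.
  by rewrite subr_gt0; exact: lt_trans h' h.
have psi0 : psi 0 = 0 by rewrite /psi oppr0 subrr.
suff : psi 0 < psi t by rewrite psi0 subr_gt0.
apply: derive_pos_incr => //.
- by apply: cts_ctsw => u ut; have [h _] := psiD u ltac:(lra); exact: derivable_cts h.
- by move=> u ut; have [h _] := psiD u ltac:(lra); exact: h.
move=> u ut; have [_ ->] := psiD u ltac:(lra); apply: chi_pos; lra.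
Qed.

Lemma sqrt_param e x0 z : (e = 1 \/ e = -1) -> 0 <= e * (z - x0) ->
  x0 + e * (Num.sqrt (e * (z - x0))) ^+ 2 = z.
Proof. by move=> ee z0; rewrite sqr_sqrtr // mulrA; case: ee => ->; lra. Qed.

Lemma sqrt_small e x0 z d : 0 < d -> 0 <= e * (z - x0) < d ^+ 2 ->
  0 <= Num.sqrt (e * (z - x0)) < d.
Proof.
move=> d0 zz; rewrite sqrtr_ge0 /= -(ger0_norm (ltW d0)) -sqrtr_sqr ltr_sqrt; first lra.
by rewrite exprn_gt0.
Qed.

(** The two branches are the values of one curve at [t] and at [- t], so the odd
    part of the curve tells which branch is the upper one. *)
Lemma germ_order e f g x0 : (e = 1 \/ e = -1) -> cusp_germ e f g x0 ->
  exists2 d, 0 < d & forall z, 0 < e * (z - x0) < d -> g z < f z.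
Proof.
move=> ee [phi [d [d0 sm p1 p3 H]]]; have [r r0 Hr] := odd_part_pos d0 sm p1 p3.
exists ((Num.min d r) ^+ 2); first by rewrite exprn_gt0 // lt_min d0.
move=> z zx; pose t := Num.sqrt (e * (z - x0)).
have := @sqrt_small e x0 z (Num.min d r) _ _; rewrite lt_min d0 r0 /= => /(_ isT).
have -> : 0 <= e * (z - x0) < Num.min d r ^+ 2 by lra.
move=> /(_ isT); rewrite -/t lt_min => /and3P[t0 td tr].
have [h1 h2] := H t ltac:(lra).
move: h1 h2; rewrite sqrt_param //; last lra; move=> -> ->; apply: Hr.
by rewrite tr andbT sqrtr_gt0; lra.
Qed.

Lemma germ_meet e f g x0 : cusp_germ e f g x0 -> f x0 = g x0.
Proof.
move=> [phi [d [d0 _ _ _ H]]]; have [] := H 0 ltac:(lra).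
by rewrite expr0n /= mulr0 addr0 oppr0 => -> ->.
Qed.

Lemma germ_cts e f g x0 : (e = 1 \/ e = -1) -> cusp_germ e f g x0 ->
  forall r, 0 < r -> exists2 d, 0 < d & forall z, 0 <= e * (z - x0) < d ->
    `|f z - f x0| < r /\ `|g z - g x0| < r.
Proof.
move=> ee cg r r0; have fg := germ_meet cg.
case: cg => [phi [d [d0 sm _ _ H]]].
have cphi : cts phi 0.
  by apply: derivable_cts; apply: (sm 0%N); rewrite /= normr0.
have [d' d0' Hd'] := cphi _ r0.
exists ((Num.min d d') ^+ 2); first by rewrite exprn_gt0 // lt_min d0.
have [f0 _] := H 0 ltac:(lra).
move: f0; rewrite expr0n /= mulr0 addr0 => f0.
move=> z zx; pose t := Num.sqrt (e * (z - x0)).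
have := @sqrt_small e x0 z (Num.min d d') _ zx; rewrite lt_min d0 d0' /= => /(_ isT).
rewrite -/t lt_min => /and3P[t0 td tr].
have [h1 h2] := H t ltac:(lra).
move: h1 h2; rewrite sqrt_param //; last lra; move=> -> ->; rewrite -fg f0.
by split; apply: Hd'; rewrite subr0 ?normrN ger0_norm.
Qed.

End CuspGerms.

(** * Strands of a front and the events on them *)

Section FrontGeometry.
Context (R : realType) (F : front R).
Implicit Types (s t r : strand F) (p q v : R * R) (a b c x y z e : R).

Lemma ht_cts s x : inside s x -> cts (ht s) x.
Proof. by move=> sx; apply: derivable_cts; exact: (ht_smooth (s := s) (n := 0%N)). Qed.

Lemma ht_derivable s x : inside s x -> derivable (ht s) x 1.
Proof. by move=> sx; exact: (ht_smooth (s := s) (n := 0%N)). Qed.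

Lemma ht_cts_lft s e : 0 < e -> exists2 d, 0 < d &
  forall z, lft s <= z < lft s + d -> `|ht s z - ht s (lft s)| < e.
Proof.
move=> e0.
by have [] := left_cusps s => /(germ_cts (or_introl erefl))/(_ _ e0)[d d0 Hd];
   exists d => // z zd; have [] := Hd z ltac:(lra).
Qed.

Lemma ht_cts_rgt s e : 0 < e -> exists2 d, 0 < d &
  forall z, rgt s - d < z <= rgt s -> `|ht s z - ht s (rgt s)| < e.
Proof.
move=> e0.
by have [] := right_cusps s => /(germ_cts (or_intror erefl))/(_ _ e0)[d d0 Hd];
   exists d => // z zd; have [] := Hd z ltac:(lra).
Qed.

Lemma ht_ctsw s : ctsw (lft s) (rgt s) (ht s).
Proof.
move=> x xs e e0.
have [xl|xl] := eqVneq x (lft s).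
  have [d d0 Hd] := ht_cts_lft s e0; exists d => // z zs; rewrite xl ltr_norml => zd.
  by apply: Hd; lra.
have [xr|xr] := eqVneq x (rgt s).
  have [d d0 Hd] := ht_cts_rgt s e0; exists d => // z zs; rewrite xr ltr_norml => zd.
  by apply: Hd; lra.
have xin : inside s x by rewrite /inside !lt_neqAle eq_sym xl xr; lra.
by have [d d0 Hd] := ht_cts xin e0; exists d => // z _; exact: Hd.
Qed.

Lemma lmate_meet s : ht s (lft s) = ht (lmate s) (lft s).
Proof. by have [] := left_cusps s => /germ_meet ->. Qed.

Lemma rmate_meet s : ht s (rgt s) = ht (rmate s) (rgt s).
Proof. by have [] := right_cusps s => /germ_meet ->. Qed.

Lemma rmate_neq s : rmate s <> s.
Proof.
move=> E; have [] := right_cusps s => /(germ_order (or_intror erefl))[d d0 Hd];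
by have := Hd (rgt s - d / 2) ltac:(lra); rewrite E ltxx.
Qed.

(** The abscissas at which the combinatorics of the front changes. *)
Definition event : set R :=
  [set e | (exists s : strand F, lft s = e \/ rgt s = e) \/
           exists2 p, is_crossing F p & p.1 = e].

Lemma finite_event : finite_set event.
Proof.
pose X := [set p : R * R | exists s t : strand F,
    [/\ s != t, lft s < p.1 < rgt s, lft t < p.1 < rgt t,
        ht s p.1 = p.2 & ht t p.1 = p.2]].
pose E := (@lft _ F @` [set: strand F] `|` @rgt _ F @` [set: strand F]) `|` fst @` X.
suff fE : finite_set E.
  apply: sub_finite_set fE.
  move=> e [[s [<-|<-]]|[p [s [t [s1 s2 s3 s4 s5]]] <-]].
  - by left; left; exists s.
  - by left; right; exists s.
  - right; exists p => //; exists s, t; split => //.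
    by apply: contraTneq s5 => ->; rewrite ltxx.
rewrite /E !finite_setU; split; last exact/finite_image/finite_crossings.
by split; apply: finite_image; apply: finite_finset.
Qed.

Lemma dividing_event c : dividing_line F c -> ~ event c.
Proof.
move=> [H1 H2] [[s [E|E]]|[p cp E]].
- by have [] := H1 s; rewrite E eqxx.
- by have [_] := H1 s; rewrite E eqxx.
- by have := H2 p cp; rewrite E eqxx.
Qed.

Lemma meet_crossing s t x : s <> t -> inside s x -> inside t x -> ht s x = ht t x ->
  crossing s t (x, ht s x) \/ crossing t s (x, ht s x).
Proof.
move=> /eqP st sx tx E.
have sx' : lft s <= x <= rgt s by move: sx; rewrite /inside; lra.
have tx' : lft t <= x <= rgt t by move: tx; rewrite /inside; lra.
have [[xs _]|[xs _]|[_ _]] := @intersections _ F s t x st sx' tx' E.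
- by move: sx; rewrite /inside xs; lra.
- by move: sx; rewrite /inside xs; lra.
by rewrite neq_lt => /orP[h|h]; [left|right]; split.
Qed.

Lemma no_meet s t x : ~ event x -> s <> t -> inside s x -> inside t x ->
  ht s x <> ht t x.
Proof.
move=> nx st sx tx E; apply: nx; right; exists (x, ht s x) => //.
by have [] := meet_crossing st sx tx E; [exists s, t|exists t, s].
Qed.

(** At its ends a strand meets nothing but its mate. *)
Lemma meet_end s t x : s <> t -> lft s <= x <= rgt s -> lft t <= x <= rgt t ->
  ht s x = ht t x -> ~ inside s x ->
  (x = lft s /\ t = lmate s) \/ (x = rgt s /\ t = rmate s).
Proof.
move=> /eqP st sx tx E ns.
by have [|h|[]//] := @intersections _ F s t x st sx tx E; [left|right].
Qed.

Lemma inside_no_end s t x : inside s x -> lft t <= x <= rgt t -> s <> t ->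
  ht s x = ht t x -> inside t x.
Proof.
move=> sx tx /eqP st E.
have sx' : lft s <= x <= rgt s by move: sx; rewrite /inside; lra.
have [[h _]|[h _]|[]//] := @intersections _ F s t x st sx' tx E;
by move: sx; rewrite /inside h; lra.
Qed.

Lemma triple s t r x : lft s <= x <= rgt s -> lft t <= x <= rgt t ->
  lft r <= x <= rgt r -> ht s x = ht t x -> ht t x = ht r x ->
  [\/ s = t, t = r | s = r].
Proof.
move=> sx tx rx E E'.
have [->|st] := eqVneq s t; first by constructor 1.
have [->|tr] := eqVneq t r; first by constructor 2.
have [->|sr] := eqVneq s r; first by constructor 3.
by exfalso; exact: (no_triple_point st tr sr sx tx rx).
Qed.

Definition above x s t : Prop := [/\ inside s x, inside t x & ht t x < ht s x].

Lemma above_trans x s t r : above x s t -> above x t r -> above x s r.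
Proof. by move=> [h1 _ h2] [_ h3 h4]; split => //; exact: lt_trans h4 h2. Qed.

Lemma above_asym x s t : above x s t -> above x t s -> False.
Proof. by move=> [_ _ h] [_ _ h']; lra. Qed.

Lemma above_irr x s : ~ above x s s.
Proof. by move=> [_ _]; rewrite ltxx. Qed.

Lemma above_total x s t : ~ event x -> inside s x -> inside t x -> s <> t ->
  above x s t \/ above x t s.
Proof.
move=> nx sx tx st; have := no_meet nx st sx tx.
by move=> /eqP; rewrite neq_lt => /orP[h|h]; [right|left].
Qed.

Definition no_event a b : Prop := forall z, a <= z <= b -> ~ event z.

Lemma inside_const a b s x y : no_event a b -> a <= x <= b -> a <= y <= b ->
  inside s x -> inside s y.
Proof.
move=> ne xab yab; rewrite /inside => sx.
have h1 : lft s < y.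
  rewrite ltNge; apply/negP => h; apply: (ne (lft s)); first lra.
  by left; exists s; left.
have h2 : y < rgt s.
  rewrite ltNge; apply/negP => h; apply: (ne (rgt s)); first lra.
  by left; exists s; right.
lra.
Qed.

Lemma above_const a b s t x y : no_event a b -> a <= x <= b -> a <= y <= b ->
  above x s t -> above y s t.
Proof.
move=> ne xab yab [sx tx h]; have hs z := @inside_const a b s x z ne xab.
have ht_ z := @inside_const a b t x z ne xab.
split; [exact: hs|exact: ht_|].
apply: (@order_const _ a b (ht t) (ht s) x y) => //.
  move=> z zab; apply: no_meet; [exact: ne| |exact: ht_|exact: hs].
  by move=> E; move: h; rewrite E ltxx.
by apply: cts_ctsw => z zab; apply: ctsB; apply: ht_cts; [exact: ht_|exact: hs].
Qed.

Lemma crossing_meet s t p : crossing s t p -> ht s p.1 = ht t p.1.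
Proof. by move=> [_ _ -> ->]. Qed.

Lemma crossing_neq s t p : crossing s t p -> s <> t.
Proof. by move=> [_ _ _ _ h] E; move: h; rewrite E ltxx. Qed.

(** The strand of smaller slope is above the other one before the crossing and
    below it afterwards. *)
Lemma crossing_local s t p : crossing s t p ->
  exists2 d, 0 < d & forall z, `|z - p.1| < d ->
    (z < p.1 -> above z s t) /\ (p.1 < z -> above z t s).
Proof.
move=> [sp tp h1 h2 h3].
have [d d0 Hd] : exists2 d, 0 < d & forall z, `|z - p.1| < d ->
   (z < p.1 -> ht t z - ht s z < ht t p.1 - ht s p.1) /\
   (p.1 < z -> ht t p.1 - ht s p.1 < ht t z - ht s z).
  have [dD dE] := derivable_sub_fun (ht_derivable tp) (ht_derivable sp).
  by apply: (derive_pos_local dD); rewrite dE; lra.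
exists (Num.min d (Num.min (Num.min (p.1 - lft s) (p.1 - lft t))
                  (Num.min (rgt s - p.1) (rgt t - p.1)))).
  by move: sp tp; rewrite /inside !lt_min; lra.
move=> z; rewrite !lt_min => /and3P[zd /andP[z1 z2] /andP[z3 z4]].
have [g1 g2] := Hd z zd.
have sz : inside s z by move: z1 z2 z3 z4; rewrite /inside !ltr_norml; lra.
have tz : inside t z by move: z1 z2 z3 z4; rewrite /inside !ltr_norml; lra.
by split=> zp; split => //; [have := g1 zp|have := g2 zp]; rewrite h1 h2; lra.
Qed.

(** [e] is the only possible event in [[y, x]]; several cusps and crossings may
    lie over it. *)
Definition lone y e x : Prop :=
  [/\ y < e, e < x & forall z, y <= z <= x -> z <> e -> ~ event z].

Lemma lone_left y e x z : lone y e x -> z < e -> no_event y z.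
Proof. by move=> [ye ex H] ze t tz; apply: H; lra. Qed.

Lemma lone_right y e x z : lone y e x -> e < z -> no_event z x.
Proof. by move=> [ye ex H] ze t tz; apply: H; lra. Qed.

Lemma lone_inside_left' y e x z s : lone y e x -> y <= z < e -> inside s y ->
  inside s z.
Proof. by move=> L zz; apply: (inside_const (lone_left L (z := z) _)); lra. Qed.

Lemma lone_inside_right' y e x z s : lone y e x -> e < z <= x -> inside s x ->
  inside s z.
Proof. by move=> L zz; apply: (inside_const (lone_right L (z := z) _)); lra. Qed.

Lemma lone_above_left y e x z s t : lone y e x -> y <= z < e -> above y s t ->
  above z s t.
Proof. by move=> L zz; apply: (above_const (lone_left L (z := z) _)); lra. Qed.

Lemma lone_above_left' y e x z s t : lone y e x -> y <= z < e -> above z s t ->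
  above y s t.
Proof. by move=> L zz; apply: (above_const (lone_left L (z := z) _)); lra. Qed.

Lemma lone_above_right y e x z s t : lone y e x -> e < z <= x -> above x s t ->
  above z s t.
Proof. by move=> L zz; apply: (above_const (lone_right L (z := z) _)); lra. Qed.

Lemma lone_above_right' y e x z s t : lone y e x -> e < z <= x -> above z s t ->
  above x s t.
Proof. by move=> L zz; apply: (above_const (lone_right L (z := z) _)); lra. Qed.

Lemma lone_closed_left y e x s : lone y e x -> inside s y -> lft s <= e <= rgt s.
Proof.
move=> [ye ex H]; rewrite /inside => sy.
suff : e <= rgt s by lra.
rewrite leNgt; apply/negP => h; apply: (H (rgt s)); [lra|lra|].
by left; exists s; right.
Qed.

Lemma lone_closed_right y e x s : lone y e x -> inside s x -> lft s <= e <= rgt s.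
Proof.
move=> [ye ex H]; rewrite /inside => sx.
suff : lft s <= e by lra.
rewrite leNgt; apply/negP => h; apply: (H (lft s)); [lra|lra|].
by left; exists s; left.
Qed.

Lemma lone_inside_event y e x s : lone y e x -> inside s e -> inside s y /\ inside s x.
Proof.
move=> L; have [ye ex H] := L; rewrite /inside => se; split.
  suff : lft s < y by lra.
  rewrite ltNge; apply/negP => h; apply: (H (lft s)); [lra|lra|].
  by left; exists s; left.
suff : x < rgt s by lra.
rewrite ltNge; apply/negP => h; apply: (H (rgt s)); [lra|lra|].
by left; exists s; right.
Qed.

Lemma lone_probe_left y e x d : lone y e x -> 0 < d ->
  exists2 w, y <= w < e & `|w - e| < d.
Proof.
move=> [ye ex _] d0; exists (Num.max y (e - d / 2)).
  by case: (leP y (e - d / 2)); lra.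
by rewrite ltr0_norm; case: (leP y (e - d / 2)); lra.
Qed.

Lemma lone_probe_right y e x d : lone y e x -> 0 < d ->
  exists2 w, e < w <= x & `|w - e| < d.
Proof.
move=> [ye ex _] d0; exists (Num.min x (e + d / 2)).
  by case: (leP x (e + d / 2)); lra.
by rewrite gtr0_norm; case: (leP x (e + d / 2)); lra.
Qed.

Lemma lone_crossing y e x s t z : lone y e x -> crossing s t (e, z) ->
  above y s t /\ above x t s.
Proof.
move=> L cr; have [d d0 Hd] := crossing_local cr; split.
  have [w wy wd] := lone_probe_left L d0.
  by apply: (lone_above_left' L wy); apply: (proj1 (Hd w wd)) => /=; lra.
have [w wx wd] := lone_probe_right L d0.
by apply: (lone_above_right' L wx); apply: (proj2 (Hd w wd)) => /=; lra.
Qed.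

(** A weak order survives at the event, by continuity. *)
Lemma lone_above_event y e x s t : lone y e x -> above y s t -> ht t e <= ht s e.
Proof.
move=> L st; have [ye ex _] := L; have [sy ty _] := st.
have [sc tc] := (lone_closed_left L sy, lone_closed_left L ty).
rewrite leNgt; apply/negP => h.
have r0 : 0 < (ht t e - ht s e) / 2 by lra.
have [d d0 Hd] := ht_ctsw sc r0; have [d' d0' Hd'] := ht_ctsw tc r0.
have m0 : 0 < Num.min d d' by rewrite lt_min d0.
have [w wy wd] := lone_probe_left L m0.
have [sw tw g] := lone_above_left L wy st.
move: wd; rewrite lt_min => /andP[wd wd'].
have := Hd w ltac:(move: sw; rewrite /inside; lra) wd.
have := Hd' w ltac:(move: tw; rewrite /inside; lra) wd'.
by rewrite !ltr_norml; lra.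
Qed.

Lemma lone_event_above y e x s t : lone y e x -> inside s x -> inside t x ->
  ht t e < ht s e -> above x s t.
Proof.
move=> L sx tx h; have [ye ex _] := L.
have [sc tc] := (lone_closed_right L sx, lone_closed_right L tx).
have r0 : 0 < (ht s e - ht t e) / 2 by lra.
have [d d0 Hd] := ht_ctsw sc r0; have [d' d0' Hd'] := ht_ctsw tc r0.
have m0 : 0 < Num.min d d' by rewrite lt_min d0.
have [w wx wd] := lone_probe_right L m0.
have sw := lone_inside_right' L wx sx; have tw := lone_inside_right' L wx tx.
apply: (lone_above_right' L wx); split => //.
move: wd; rewrite lt_min => /andP[wd wd'].
have := Hd w ltac:(move: sw; rewrite /inside; lra) wd.
have := Hd' w ltac:(move: tw; rewrite /inside; lra) wd'.
by rewrite !ltr_norml; lra.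
Qed.

End FrontGeometry.

(** * Disks as regions between two arcs *)

Section DiskArcs.
Context (R : realType) (F : front R).
Implicit Types (s t r : strand F) (p q v : R * R) (a b c x y z e : R).
Implicit Types (f g lo hi : R -> R) (k : bool) (D : set (R * R)).

(** Throughout, [k = true] refers to the lower arc of a disk, above which the disk
    lies, and [k = false] to the upper arc.  A corner on the lower arc is a local
    maximum of two strands, a corner on the upper arc a minimum. *)
Definition extr k (u v : R) : R := if k then Num.max u v else Num.min u v.

Definition beyond k f : set (R * R) :=
  [set q | if k then f q.1 <= q.2 else q.2 <= f q.1].

Lemma side_extr k s t q :
  side k s q /\ side k t q <-> beyond k (fun z => extr k (ht s z) (ht t z)) q.
Proof.
rewrite /side /beyond /extr /=; case: k; rewrite ?ge_max ?le_min.
  by split=> [[-> ->]//|/andP[-> ->]].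
by split=> [[-> ->]//|/andP[-> ->]].
Qed.

Lemma cts_extr k f g x : cts f x -> cts g x -> cts (fun z => extr k (f z) (g z)) x.
Proof. by rewrite /extr; case: k => cf cg; [exact: cts_max|exact: cts_min]. Qed.

Lemma extrxx k (u : R) : extr k u u = u.
Proof. by rewrite /extr; case: k; rewrite ?maxxx ?minxx. Qed.

Lemma near_graph f x P : cts f x -> (\forall q \near ((x, f x) : R * R), P q) ->
  \forall z \near x, P (z, f z).
Proof.
move=> cf /near2P[d d0 Hd]; have [d' d0' Hd'] := cf d d0.
apply/nearP; exists (Num.min d d'); first by rewrite lt_min d0.
by move=> z; rewrite lt_min => /andP[zd /Hd' zd']; exact: Hd.
Qed.

Lemma near_point p (P : R * R -> Prop) : (\forall q \near p, P q) -> P p.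
Proof. exact: nbhs_singleton. Qed.

Lemma near_vertical p (P : R * R -> Prop) : (\forall q \near p, P q) ->
  exists2 d, 0 < d & forall h, `|h| < d -> P (p.1, p.2 + h).
Proof.
move=> /near2P[d d0 Hd]; exists d => // h hd; apply: Hd => /=.
  by rewrite subrr normr0.
by rewrite addrAC subrr add0r.
Qed.

(** The germ of a side of a graph determines the side and the germ of the
    function: probe it along both graphs and along the vertical. *)
Lemma beyond_unique k k' f g x : cts f x -> cts g x -> f x = g x ->
  (\forall q \near ((x, f x) : R * R), beyond k f q <-> beyond k' g q) ->
  k = k' /\ \forall z \near x, f z = g z.
Proof.
move=> cf cg fg H.
have kk : k = k'.
  have [d d0 Hd] := near_vertical H.
  have := Hd (d / 2) ltac:(by rewrite gtr0_norm; lra).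
  rewrite /beyond /= -fg.
  by case: k {H Hd}; case: k' => // -[h1 h2]; [have := h1|have := h2]; lra.
split=> //; rewrite -{k'}kk in H.
have h1 := near_graph cf H; rewrite fg in H; have h2 := near_graph cg H.
move: h1 h2 => /nearP[d d0 Hd] /nearP[d' d0' Hd'].
apply/nearP; exists (Num.min d d'); first by rewrite lt_min d0.
move=> z; rewrite lt_min => /andP[/Hd [h1 _] /Hd' [_ h2]].
move: h1 h2; rewrite /beyond /=; clear; case: k => h1 h2.
  by have := h1 (lexx _); have := h2 (lexx _); lra.
by have := h1 (lexx _); have := h2 (lexx _); lra.
Qed.

(** The left and right regions of a crossing meet the vertical through it in the
    crossing alone, whereas a disk contains a vertical segment at each boundary
    point between its ends. *)
Lemma mixed_corner k k' s t p : crossing s t p -> k <> k' ->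
  exists2 d, 0 < d & forall h, h != 0 -> `|h| < d ->
    ~ (side k s (p.1, p.2 + h) /\ side k' t (p.1, p.2 + h)).
Proof.
move=> [_ _ h1 h2 _] kk; exists 1 => // h /eqP h0 _; rewrite /side /= h1 h2.
by case: k kk; case: k' => //= _ [? ?]; apply: h0; lra.
Qed.

(** Near an interior abscissa the arc is a single strand, or it switches at a
    crossing so as to make a corner of the region on its side [k]. *)
Definition arc_at k f x : Prop :=
  (exists r, inside r x /\ \forall z \near x, f z = ht r z) \/
  (exists s t, crossing s t (x, f x) /\
     \forall z \near x, f z = extr k (ht s z) (ht t z)).

Definition region x0 x1 lo hi : set (R * R) :=
  [set p | x0 <= p.1 <= x1 /\ lo p.1 <= p.2 <= hi p.1].

Definition arc k lo hi := if k then lo else hi.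

Definition arcs c x1 x0 lo hi : Prop :=
  [/\ c <= x0 /\ x0 < x1,
      ctsw x0 x1 lo /\ ctsw x0 x1 hi,
      forall x, x0 <= x <= x1 -> front_set F (x, lo x) /\ front_set F (x, hi x),
      forall x, x0 < x < x1 -> lo x < hi x &
      forall k x, x0 < x < x1 -> arc_at k (arc k lo hi) x].

Lemma region_interior x0 x1 lo hi x z : cts lo x -> cts hi x -> x0 < x < x1 ->
  lo x < z < hi x -> \forall q \near ((x, z) : R * R), region x0 x1 lo hi q.
Proof.
move=> cl ch xx zz.
have [d d0 Hd] := cl _ (ltac:(lra) : 0 < (z - lo x) / 2).
have [d' d0' Hd'] := ch _ (ltac:(lra) : 0 < (hi x - z) / 2).
pose m := Num.min (Num.min (x - x0) (x1 - x)) (Num.min ((z - lo x) / 2) ((hi x - z) / 2)).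
apply/near2P; exists (Num.min m (Num.min d d')); first by rewrite !lt_min; lra.
move=> q /=; rewrite !lt_min => /and3P[/andP[/andP[q1 q2] _] qd qd'].
move=> /and3P[/andP[_ /andP[q3 q4]] _ _]; move: (Hd _ qd) (Hd' _ qd').
by move: q1 q2 q3 q4; rewrite /region /= !ltr_norml; lra.
Qed.

Lemma region_near_arc k x0 x1 lo hi x : cts lo x -> cts hi x -> x0 < x < x1 ->
  lo x < hi x ->
  \forall q \near ((x, arc k lo hi x) : R * R),
    region x0 x1 lo hi q <-> beyond k (arc k lo hi) q.
Proof.
move=> cl ch xx lh.
have [d d0 Hd] := cl _ (ltac:(lra) : 0 < (hi x - lo x) / 2).
have [d' d0' Hd'] := ch _ (ltac:(lra) : 0 < (hi x - lo x) / 2).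
pose m := Num.min (Num.min (x - x0) (x1 - x)) ((hi x - lo x) / 2).
apply/near2P; exists (Num.min m (Num.min d d')); first by rewrite !lt_min; lra.
move=> q /=; rewrite !lt_min => /and3P[/andP[/andP[q1 q2] _] qd qd'].
move=> /and3P[/andP[_ q3] _ _]; move: (Hd _ qd) (Hd' _ qd').
move: q1 q2 q3; rewrite /region /beyond /arc /=; case: k; rewrite !ltr_norml => *.
  by split=> [[_ /andP[]]//|h]; lra.
by split=> [[_ /andP[]]//|h]; lra.
Qed.

Lemma region_frontier x0 x1 lo hi x z : cts lo x -> cts hi x -> x0 < x < x1 ->
  region x0 x1 lo hi (x, z) -> ~ (region x0 x1 lo hi)° (x, z) ->
  exists k, z = arc k lo hi x.
Proof.
move=> cl ch xx [/= _ zz] nD.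
have [zl|zl] := eqVneq z (lo x); first by exists true.
have [zh|zh] := eqVneq z (hi x); first by exists false.
exfalso; apply: nD; apply: region_interior => //.
by rewrite !lt_neqAle eq_sym zl zh.
Qed.

Lemma beyond_frontier k f x D :
  (\forall q \near ((x, f x) : R * R), D q <-> beyond k f q) -> ~ D° (x, f x).
Proof.
rewrite /interior => /near_vertical[d d0 Hd] /near_vertical[d' d0' Hd'].
pose m := Num.min d d' / 2.
have m0 : 0 < Num.min d d' by rewrite lt_min d0.
have [md md'] : `|m| < d /\ `|m| < d'.
  by apply/andP; rewrite -lt_min gtr0_norm; rewrite /m; lra.
case: k Hd => Hd.
  have /(Hd _) := Hd' (- m) ltac:(by rewrite normrN).
  by rewrite /beyond /= normrN => /(_ md); rewrite /m; lra.
have /(Hd _) := Hd' m md'.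
by rewrite /beyond /= => /(_ md); rewrite /m; lra.
Qed.

Lemma beyond_eq k f g x D : (\forall z \near x, f z = g z) ->
  (\forall q \near ((x, f x) : R * R), D q <-> beyond k f q) ->
  \forall q \near ((x, f x) : R * R), D q <-> beyond k g q.
Proof.
move=> /nearP[d d0 Hd] /near2P[d' d0' Hd'].
apply/near2P; exists (Num.min d d'); first by rewrite lt_min d0.
move=> q; rewrite !lt_min => /andP[q1 q2] /andP[_ q3].
by rewrite Hd' // /beyond /= Hd.
Qed.

Lemma near_iff_trans (p : R * R) (A B C : set (R * R)) :
  (\forall q \near p, A q <-> B q) -> (\forall q \near p, A q <-> C q) ->
  \forall q \near p, B q <-> C q.
Proof. by move=> h1 h2; near=> q; rewrite -(near h1 q) // (near h2 q). Unshelve. all: by end_near.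
Qed.

(** Close to a point of an arc the disk is one side of the graph of the arc.  As
    the germ of this side determines the germ of the graph, the disk is smooth
    there if and only if the arc is a strand, and it has a corner if and only if
    the arc is an extremum of two strands that cross. *)
Lemma boundary_arcs x0 x1 lo hi x D : cts lo x -> cts hi x -> x0 < x < x1 ->
  lo x < hi x -> D = region x0 x1 lo hi ->
  (forall z, D (x, z) -> ~ D° (x, z) ->
     smooth_at F D (x, z) \/ exists k k', corner_at F k k' D (x, z)) <->
  forall k, arc_at k (arc k lo hi) x.
Proof.
move=> cl ch xx lh ->; set D' := region _ _ _ _; split=> H.
  move=> k; pose f := arc k lo hi.
  have cf : cts f x by rewrite /f /arc; case: (k).
  have nr : \forall q \near ((x, f x) : R * R), D' q <-> beyond k f q.
    exact: region_near_arc.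
  have Dx : D' (x, f x).
    by apply/(near_point nr); rewrite /beyond /=; case: (k).
  have [[s [k' [sx hx Hs]]]|[k1 [k2 [s [t [cr Hs]]]]]] :=
      H _ Dx (beyond_frontier nr).
    left; exists s; split=> //.
    have [] := @beyond_unique k k' f (ht s) x cf (ht_cts sx) (esym hx).
      exact: near_iff_trans nr Hs.
    by move=> _.
  have [sx tx hx hx' _] := cr.
  have [kk|/eqP kk] := eqVneq k1 k2; last first.
    have [d d0 Hd] := mixed_corner cr kk.
    have [d' d0' Hd'] := near_vertical (near_iff_trans nr Hs).
    pose m := Num.min d d' / 2.
    have m0 : 0 < Num.min d d' by rewrite lt_min d0.
    have [md md'] : `|m| < d /\ `|m| < d'.
      by apply/andP; rewrite -lt_min gtr0_norm; rewrite /m; lra.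
    exfalso; case: (k) Hd' => Hd'.
      apply: (Hd m _ md); first by rewrite gt_eqF // /m; lra.
      by apply/(Hd' m md'); rewrite /beyond /= /m; lra.
    apply: (Hd (- m)); rewrite ?oppr_eq0 ?normrN //; first by rewrite gt_eqF // /m; lra.
    by apply/(Hd' (- m) ltac:(by rewrite normrN)); rewrite /beyond /= /m; lra.
  right; exists s, t; split=> //; move: Hs; rewrite -kk => Hs.
  have [] := @beyond_unique k k1 f (fun z => extr k1 (ht s z) (ht t z)) x cf.
  - by apply: cts_extr; exact: ht_cts.
  - by move: hx hx' => /= -> ->; rewrite extrxx.
  - have := near_iff_trans nr Hs; apply: filterS => q.
    by rewrite side_extr.
  by move=> <-.
move=> z Dz nD; have [k zk] := region_frontier cl ch xx Dz nD.
have nr : \forall q \near ((x, arc k lo hi x) : R * R), D' q <-> beyond k (arc k lo hi) q.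
  exact: region_near_arc.
rewrite zk; case: (H k) => [[r [rx Hr]]|[s [t [cr Hst]]]].
  left; exists r, k; split=> //; first by rewrite /= (nbhs_singleton Hr).
  exact: beyond_eq Hr nr.
right; exists k, k, s, t; split=> //.
by apply: filterS (beyond_eq Hst nr) => q ->; rewrite side_extr.
Qed.

Lemma arcs_cts c x1 x0 lo hi x : arcs c x1 x0 lo hi -> x0 < x < x1 ->
  cts lo x /\ cts hi x.
Proof. by move=> [_ [cl ch] _ _ _] xx; split; [exact: ctsw_cts cl xx|exact: ctsw_cts ch xx]. Qed.

Lemma disk_between_arcs c c' D x0 x1 lo hi :
  disk_between F c c' D x0 x1 lo hi <->
  [/\ arcs c x1 x0 lo hi, x1 <= c' & D = region x0 x1 lo hi].
Proof.
split.
  move=> [[h1 h2 h3] [h4 h5] [h6 h7] h8 h9].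
  have cl : ctsw x0 x1 lo by apply/ctswP.
  have ch : ctsw x0 x1 hi by apply/ctswP.
  split=> //; split=> // k x xx; move: k.
  apply: (iffLR (@boundary_arcs x0 x1 lo hi x D _ _ xx (h7 x xx) h8)).
  - exact: ctsw_cts cl xx.
  - exact: ctsw_cts ch xx.
  by move=> z Dz nDz; apply: h9.
move=> [A h3 h8]; have [[h1 h2] [cl ch] h6 h7 h9] := A.
split=> //; first by split; apply/ctswP.
move=> [x z] Dz nDz xx.
have [cl' ch'] := arcs_cts A xx.
by apply: (iffRL (@boundary_arcs x0 x1 lo hi x D cl' ch' xx (h7 x xx) h8)) => // k; exact: h9.
Qed.

Lemma arcs_sub c x1 x0 lo hi y : arcs c x1 x0 lo hi -> x0 < y <= x1 ->
  arcs c y x0 lo hi.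
Proof.
move=> [[h1 h2] [cl ch] h6 h7 h9] xy; split=> //; first by lra.
- by split; [apply: ctsw_sub cl|apply: ctsw_sub ch]; lra.
- by move=> x xx; apply: h6; lra.
- by move=> x xx; apply: h7; lra.
- by move=> k x xx; apply: h9; lra.
Qed.

Definition arc_corner k f x0 x1 : set (R * R) :=
  [set p | [/\ x0 < p.1 < x1, p.2 = f p.1 & exists s t, crossing s t p /\
      \forall z \near p.1, f z = extr k (ht s z) (ht t z)]].

Lemma corner_arc k c x1 x0 lo hi : arcs c x1 x0 lo hi ->
  [set p | corner_at F k k (region x0 x1 lo hi) p] = arc_corner k (arc k lo hi) x0 x1.
Proof.
move=> A; apply/seteqP; split=> -[x z] /=; last first.
  move=> [/= xx -> [s [t [cr Hst]]]].
  have [cl ch] := arcs_cts A xx; have [_ _ _ lh _] := A.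
  have nr := region_near_arc k cl ch xx (lh x xx).
  exists s, t; split=> //.
  by apply: filterS (beyond_eq Hst nr) => q ->; rewrite side_extr.
move=> [s [t [cr Hst]]].
pose g w := extr k (ht s w) (ht t w).
have [/= sx tx hx hx' _] := cr.
have cg : cts g x by apply: cts_extr; exact: ht_cts.
have gx : g x = z by rewrite /g hx hx' extrxx.
have Hg : \forall q \near ((x, z) : R * R), region x0 x1 lo hi q <-> beyond k g q.
  by apply: filterS Hst => q; rewrite side_extr.
have xx : x0 < x < x1.
  have /nearP[d d0 Hd] : \forall w \near x, region x0 x1 lo hi (w, g w).
    have := @near_graph g x _ cg; rewrite gx => /(_ _ Hg); apply: filterS => w ->.
    by rewrite /beyond /=; case: (k).
  have [h1 _] := Hd (x + d / 2) ltac:(rewrite addrAC subrr add0r gtr0_norm; lra).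
  have [h2 _] := Hd (x - d / 2) ltac:(rewrite addrAC subrr add0r normrN gtr0_norm; lra).
  by move: h1 h2 => /=; lra.
have [cl ch] := arcs_cts A xx; have [_ _ _ /(_ x xx) lh _] := A.
have Dz : region x0 x1 lo hi (x, z).
  by apply/(near_point Hg); rewrite /beyond /= gx; case: (k).
have nD : ~ (region x0 x1 lo hi)° (x, z).
  by rewrite -gx; apply: (@beyond_frontier k g); rewrite gx.
have [k' zf] := region_frontier cl ch xx Dz nD.
have nr := region_near_arc k' cl ch xx lh; rewrite zf in Hg.
have cf : cts (arc k' lo hi) x by rewrite /arc; case: (k').
have [||kk Hfg] := @beyond_unique k' k (arc k' lo hi) g x cf cg.
- by rewrite gx.
- exact: near_iff_trans nr Hg.
by subst k'; split=> //=; exists s, t.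
Qed.

End DiskArcs.

(** * Arcs across an event *)

Section ArcSteps.
Context (R : realType) (F : front R).
Implicit Types (s t r : strand F) (p q v : R * R) (a b c x y z e : R).
Implicit Types (f g lo hi : R -> R) (k : bool) (D : set (R * R)).

Lemma limit_eq f g a b x : a < b -> ctsw a b f -> ctsw a b g ->
  (forall z, a < z < b -> f z = g z) -> a <= x <= b -> f x = g x.
Proof.
move=> ab cf cg fg xab; apply/eqP/contraT; rewrite -subr_eq0 -normr_gt0 => h.
have r0 : 0 < `|f x - g x| / 2 by lra.
have [d d0 Hd] := cf x xab _ r0; have [d' d0' Hd'] := cg x xab _ r0.
have [w wab] : exists2 w, a < w < b & `|w - x| < Num.min d d'.
  have m0 : 0 < Num.min (Num.min d d') (b - a) by rewrite !lt_min d0 d0' subr_gt0.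
  have [m1 m2] : Num.min (Num.min d d') (b - a) <= Num.min d d' /\
      Num.min (Num.min d d') (b - a) <= b - a by split; rewrite ge_min lexx ?orbT.
  move: m0 m1 m2; move: (Num.min d d') (Num.min (Num.min d d') _) => M m m0 m1 m2.
  have [xm|xm] := leP x ((a + b) / 2).
    by exists (x + m / 4); rewrite ?ltr_norml; lra.
  by exists (x - m / 4); rewrite ?ltr_norml; lra.
rewrite lt_min => /andP[wd wd'].
have := Hd w ltac:(lra) wd; have := Hd' w ltac:(lra) wd'.
have := ler_distD (g w) (f x) (g x); rewrite (fg _ wab) (distrC (f x) (g w)).
lra.
Qed.

Lemma arc_at_strand k f x : ~ event F x -> arc_at F k f x ->
  exists r, inside r x /\ \forall z \near x, f z = ht r z.
Proof.
move=> nx [//|[s [t [cr _]]]]; exfalso; apply: nx; right; exists (x, f x) => //.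
by exists s, t.
Qed.

(** Away from events the abscissas at which an arc is on a given strand form an
    open and closed set. *)
Lemma arc_follow k f s a b x y : no_event F a b ->
  (forall z, a <= z <= b -> arc_at F k f z) -> a <= x <= b -> a <= y <= b ->
  inside s x -> f x = ht s x -> inside s y /\ f y = ht s y.
Proof.
move=> ne H xab yab sx fx.
apply: (@locally_constant _ (fun z => inside s z /\ f z = ht s z) a b _ x y) => //.
move=> u uab; have [r [ru Hr]] := arc_at_strand (ne u uab) (H u uab).
have fu := nbhs_singleton Hr; near=> z => zab.
have fz : f z = ht r z by near: z.
have rz := inside_const ne uab zab ru.
have [->|/eqP rs] := eqVneq s r; first by split.
split=> [[sz E]|[su E]].
  by case: (no_meet (ne z zab) rs sz rz); rewrite -E -fz.
by case: (no_meet (ne u uab) rs su ru); rewrite -E -fu.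
Unshelve. all: by end_near.
Qed.

Lemma front_inside x (w : R) : ~ event F x -> front_set F (x, w) ->
  exists s, inside s x /\ w = ht s x.
Proof.
move=> nx [s [/= sx ->]]; exists s; split=> //; rewrite /inside !lt_neqAle.
have -> : lft s != x by apply/eqP => E; apply: nx; left; exists s; left.
have -> : x != rgt s by apply/eqP => E; apply: nx; left; exists s; right.
exact: sx.
Qed.

Section Arcs.
Context (c x1 x0 : R) (lo hi : R -> R).
Hypothesis A : arcs F c x1 x0 lo hi.

Lemma arcs_ctsw k : ctsw x0 x1 (arc k lo hi).
Proof. by have [_ [? ?] _ _ _] := A; case: k. Qed.

Lemma arcs_front k x : x0 <= x <= x1 -> front_set F (x, arc k lo hi x).
Proof. by have [_ _ H _ _] := A; move=> /H[? ?]; case: k. Qed.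

(** At its right end only the value of an arc is known: the strand is identified
    at an intermediate abscissa, and the value at the end by continuity. *)
Lemma arc_back k s a : x0 <= a -> a < x1 ->
  (forall z, a < z <= x1 -> ~ event F z) ->
  inside s x1 -> arc k lo hi x1 = ht s x1 ->
  forall z, a < z <= x1 -> inside s z /\ arc k lo hi z = ht s z.
Proof.
move=> xa ax ne sx fx z zax.
have nez u w : a < u -> w <= x1 -> no_event F u w by move=> h1 h2 v vv; apply: ne; lra.
have sz u : a < u <= x1 -> inside s u.
  by move=> uu; apply: (inside_const (nez u x1 _ _) _ _ sx); lra.
split; first exact: sz.
have [_ _ _ _ Aat] := A.
pose w := (a + x1) / 2.
have wx : a < w < x1 by rewrite /w; lra.
have nw : ~ event F w by apply: ne; lra.
have [r [rw fw]] := front_inside nw (arcs_front k (x := w) ltac:(lra)).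
have fr u : a < u < x1 -> inside r u /\ arc k lo hi u = ht r u.
  move=> uu; have [uw|wu] := leP u w.
    apply: (arc_follow (k := k) (nez u w _ _) _ _ _ rw fw); try lra.
    by move=> v vv; apply: Aat; lra.
  apply: (arc_follow (k := k) (nez w u _ _) _ _ _ rw fw); try lra.
  by move=> v vv; apply: Aat; lra.
have rx : inside r x1 by apply: (inside_const (nez w x1 _ _) _ _ rw); lra.
have fx' : arc k lo hi x1 = ht r x1.
  apply: (@limit_eq (arc k lo hi) (ht r) w x1); [lra| | | |lra].
  - by apply: (ctsw_sub _ _ (arcs_ctsw k)); lra.
  - apply: (ctsw_sub _ _ (@ht_ctsw _ F r)); first by move: rw; rewrite /inside; lra.
    by move: rx; rewrite /inside; lra.
  by move=> u uu; have [] := fr u ltac:(lra).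
have rs : r = s.
  apply: contrapT => /(no_meet (ne x1 ltac:(lra))) H.
  by apply: (H rx sx); rewrite -fx.
have [zx|zx] := ltP z x1; first by rewrite -rs; have [] := fr z ltac:(lra).
by have -> : z = x1 by lra.
Qed.

Lemma arc_left k y e x s : lone F y e x -> x0 < y -> e <= x1 -> inside s y ->
  arc k lo hi y = ht s y -> forall z, y <= z <= e -> arc k lo hi z = ht s z.
Proof.
move=> L xy ex sy fy.
have [ye ex' _] := L; have [_ _ _ _ Aat] := A.
have H z : y <= z < e -> arc k lo hi z = ht s z.
  move=> zz; have ne := lone_left L (z := z) ltac:(lra).
  have [|||//] := arc_follow (k := k) ne _ _ _ sy fy (y := z); try lra.
  by move=> v vv; apply: Aat; lra.
move=> z zz; have [ze|ze] := ltP z e; first by apply: H; lra.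
have -> : z = e by lra.
apply: (@limit_eq (arc k lo hi) (ht s) y e) => //; last lra.
- by apply: (ctsw_sub _ _ (arcs_ctsw k)); lra.
- apply: (ctsw_sub _ _ (@ht_ctsw _ F s)); first by move: sy; rewrite /inside; lra.
  by have := lone_closed_left L sy; lra.
by move=> u uu; apply: H; lra.
Qed.

Lemma arc_right k y e s : lone F y e x1 -> x0 <= e -> inside s x1 ->
  arc k lo hi x1 = ht s x1 -> forall z, e <= z <= x1 -> arc k lo hi z = ht s z.
Proof.
move=> L xe sx fx; have [ye ex Lz] := L.
have H z : e < z <= x1 -> arc k lo hi z = ht s z.
  move=> zz; have [] := arc_back xe ex _ sx fx zz => // u uu.
  by apply: Lz; lra.
move=> z zz; have [ze|ze] := ltP e z; first by apply: H; lra.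
have -> : z = e by lra.
apply: (@limit_eq (arc k lo hi) (ht s) e x1) => //; last lra.
- by apply: (ctsw_sub _ _ (arcs_ctsw k)); lra.
- apply: (ctsw_sub _ _ (@ht_ctsw _ F s)); last by move: sx; rewrite /inside; lra.
  by have := lone_closed_right L sx; lra.
by move=> u uu; apply: H; lra.
Qed.

End Arcs.

(** [cross k s s' e]: over [e] an arc may pass from [s'] to [s] making a corner
    of the disk that lies below it ([k = false]) or above it ([k = true]). *)
Definition cross k s s' e : Prop :=
  if k then crossing s' s (e, ht s e) else crossing s s' (e, ht s e).

Definition arc_step k e s s' : Prop := (s = s' /\ inside s e) \/ cross k s s' e.

Lemma cross_meet k s s' e : cross k s s' e ->
  [/\ inside s e, inside s' e, ht s e = ht s' e & s <> s'].
Proof.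
by case: k => /= cr; have := crossing_neq cr; case: cr => /= *; split=> // ?; subst.
Qed.

Lemma arc_step_meet k s s' e : arc_step k e s s' ->
  [/\ inside s e, inside s' e & ht s e = ht s' e].
Proof. by move=> [[<-]//|/cross_meet[]]. Qed.

(** At a corner over [e] an arc must change strands, because an extremum of two
    strands that cross follows one before and the other one after. *)
Lemma corner_germ k y e x f s s' (a b : strand F) : lone F y e x ->
  (forall z, y <= z <= e -> f z = ht s' z) ->
  (forall z, e <= z <= x -> f z = ht s z) -> inside s' y -> inside s x ->
  crossing a b (e, f e) ->
  (\forall z \near e, f z = extr k (ht a z) (ht b z)) -> cross k s s' e.
Proof.
move=> L fl fr sy sx cr /nearP[d d0 Hd]; have [ye ex Lz] := L.
have [ab ba] := lone_crossing L cr.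
have [w wy wd] := lone_probe_left L d0; have [w' wx wd'] := lone_probe_right L d0.
have [ha hb hab] := lone_above_left L wy ab.
have [hb' ha' hba] := lone_above_right L wx ba.
have sw := lone_inside_left' L wy sy; have sw' := lone_inside_right' L wx sx.
have nw : ~ event F w by apply: Lz; lra.
have nw' : ~ event F w' by apply: Lz; lra.
have E1 := Hd w wd; rewrite fl in E1; last lra.
have E2 := Hd w' wd'; rewrite fr in E2; last lra.
have fe : f e = ht s e by rewrite fr //; lra.
rewrite fe in cr.
rewrite /extr in E1 E2; case: (k) E1 E2 => E1 E2.
  have <- : a = s'.
    apply: contrapT => /(no_meet nw)/(_ ha sw); apply; rewrite E1.
    by rewrite max_l // ltW.
  have <- : b = s.
    apply: contrapT => /(no_meet nw')/(_ hb' sw'); apply; rewrite E2.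
    by rewrite max_r // ltW.
  rewrite /cross; suff -> : ht b e = ht s e by [].
  by have [_ _ _ /= ->] := cr.
have <- : b = s'.
  apply: contrapT => /(no_meet nw)/(_ hb sw); apply; rewrite E1.
  by rewrite min_r // ltW.
have <- : a = s.
  apply: contrapT => /(no_meet nw')/(_ ha' sw'); apply; rewrite E2.
  by rewrite min_l // ltW.
rewrite /cross; suff -> : ht a e = ht s e by [].
by have [_ _ /= -> _] := cr.
Qed.

Lemma strand_germ y e x f s s' r : lone F y e x ->
  (forall z, y <= z <= e -> f z = ht s' z) ->
  (forall z, e <= z <= x -> f z = ht s z) -> inside s' y -> inside s x ->
  inside r e -> (\forall z \near e, f z = ht r z) -> s' = r /\ s = r.
Proof.
move=> L fl fr sy sx re /nearP[d d0 Hd]; have [ye ex Lz] := L.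
have [ry rx] := lone_inside_event L re.
have [w wy wd] := lone_probe_left L d0; have [w' wx wd'] := lone_probe_right L d0.
have sw := lone_inside_left' L wy sy; have sw' := lone_inside_right' L wx sx.
have rw := lone_inside_left' L wy ry; have rw' := lone_inside_right' L wx rx.
have nw : ~ event F w by apply: Lz; lra.
have nw' : ~ event F w' by apply: Lz; lra.
have E1 := Hd w wd; rewrite fl in E1; last lra.
have E2 := Hd w' wd'; rewrite fr in E2; last lra.
split; apply: contrapT.
  by move=> /(no_meet nw)/(_ sw rw); apply.
by move=> /(no_meet nw')/(_ sw' rw'); apply.
Qed.

Lemma arc_at_step k y e x f s s' : lone F y e x ->
  (forall z, y <= z <= e -> f z = ht s' z) ->
  (forall z, e <= z <= x -> f z = ht s z) -> inside s' y -> inside s x ->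
  arc_at F k f e -> arc_step k e s s'.
Proof.
move=> L fl fr sy sx [[r [re H]]|[a [b [cr H]]]]; last first.
  by right; exact: corner_germ L fl fr sy sx cr H.
by have [-> ->] := strand_germ L fl fr sy sx re H; left.
Qed.

Lemma step_arc_at k y e x f s s' : lone F y e x ->
  (forall z, y <= z <= e -> f z = ht s' z) ->
  (forall z, e <= z <= x -> f z = ht s z) ->
  arc_step k e s s' -> arc_at F k f e.
Proof.
move=> L fl fr; have [ye ex Lz] := L.
have nb : \forall z \near e, y <= z <= x.
  apply/nearP; exists (Num.min (e - y) (x - e)); first by rewrite lt_min; lra.
  by move=> z; rewrite lt_min !ltr_norml; lra.
have fe : f e = ht s e by rewrite fr; lra.
move=> [[E se]|].
  left; exists s; split=> //; apply: filterS nb => z zz.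
  have [ze|ze] := leP z e; last by apply: fr; lra.
  by rewrite [in RHS]E; apply: fl; lra.
move=> cr; right.
have H (a b : strand F) : crossing a b (e, ht s e) -> \forall z \near e,
     (z < e -> ht b z < ht a z) /\ (e < z -> ht a z < ht b z).
  move=> /crossing_local[d d0 Hd]; apply/nearP; exists d => // z /Hd /= [h1 h2].
  by split=> [/h1[]|/h2[]].
have E : ht s e = ht s' e by have [] := cross_meet cr.
case: k cr => /= cr.
  exists s', s; split; first by rewrite fe.
  apply: filterS2 nb (H _ _ cr) => z zz [h1 h2].
  have [ze|ze|ze] := ltgtP z e.
  - by rewrite fl ?max_l //; [rewrite ltW // h1|lra].
  - by rewrite fr ?max_r //; [rewrite ltW // h2|lra].
  - by rewrite ze -E maxxx fe.
exists s, s'; split; first by rewrite fe.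
apply: filterS2 nb (H _ _ cr) => z zz [h1 h2].
have [ze|ze|ze] := ltgtP z e.
- by rewrite fl ?min_r //; [rewrite ltW // h1|lra].
- by rewrite fr ?min_l //; [rewrite ltW // h2|lra].
- by rewrite ze -E minxx fe.
Qed.

(** If the two arcs meet over the event, the absence of triple points leaves two
    strands at that point, and their order before it rules out that either arc
    turns. *)
Lemma steps_apart y e x s s' t t' : lone F y e x ->
  arc_step false e s s' -> arc_step true e t t' -> above y s' t' ->
  ht t e <= ht s e /\ (ht t e = ht s e -> s <> t ->
    [/\ s' = s, t' = t & crossing s t (e, ht s e)]).
Proof.
move=> L us lt st'.
have [se se' Es] := arc_step_meet us; have [te te' Et] := arc_step_meet lt.
split; first by rewrite Es Et; exact: lone_above_event L st'.
move=> E st.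
have cl r : inside r e -> lft r <= e <= rgt r by rewrite /inside; lra.
have s't' : s' <> t' by move=> h; apply: (@above_irr _ F y s'); rewrite {2}h.
have hs : s' = s \/ s' = t.
  have [||//|h|h] := triple (cl _ se') (cl _ se) (cl _ te) => //; first by left.
  by right.
have ht' : t' = s \/ t' = t.
  have [||h|h|h] := triple (cl _ te') (cl _ se) (cl _ te) => //.
  - by rewrite -Et.
  - by left.
  - by right.
case: hs => hs; case: ht' => ht'; rewrite hs ht' // in st' us lt s't' *.
  split=> //; have [//|cr] := meet_crossing st se te (esym E).
  have [ts _] : above y t s /\ above x s t by apply: lone_crossing L cr.
  by case: (above_asym ts st').
case: us => [[/esym]//|/= cr].
have [ts _] : above y s t /\ above x t s by apply: lone_crossing L cr.
by case: (above_asym ts st').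
Qed.

Lemma steps_strict y e x s s' t t' : lone F y e x ->
  arc_step false e s s' -> arc_step true e t t' -> above y s' t' ->
  above x s t -> ht t e < ht s e.
Proof.
move=> L us lt st' st; have [h1 h2] := steps_apart L us lt st'.
rewrite lt_neqAle h1 andbT; apply/eqP => /h2 H.
have sNt : s <> t by move=> h; apply: (@above_irr _ F x s); rewrite {2}h.
have [_ _ cr] := H sNt.
by have [_ /above_asym] := lone_crossing L cr; apply.
Qed.

End ArcSteps.

(** * Half-disks across an event and at a vertex *)

Section HalfDisks.
Context (R : realType) (F : front R).
Implicit Types (s t r : strand F) (p q v : R * R) (a b c x y z e : R).
Implicit Types (f g lo hi : R -> R) (k : bool) (D : set (R * R)).

Definition left_end c x0 lo hi : Prop :=
  left_end_cusp F x0 lo hi \/ left_end_line c x0 lo hi.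

(** The half-disks of [Half_DA] for a right line at [x], with the boundary
    condition put on the arcs. *)
Definition half_disk c x s t D : Prop := exists x0 lo hi,
  [/\ arcs F c x x0 lo hi, left_end c x0 lo hi, hi x = ht s x, lo x = ht t x &
      D = region x0 x lo hi].

(** The union of [Disk] and [Half_D], in the same form. *)
Definition full_disk c v D : Prop := exists x0 lo hi,
  [/\ arcs F c v.1 x0 lo hi, left_end c x0 lo hi, hi v.1 = v.2, lo v.1 = v.2 &
      D = region x0 v.1 lo hi].

Lemma Half_DAP c x s t D : above x s t -> Half_DA c x s t D <-> half_disk c x s t D.
Proof.
move=> [_ _ st]; split.
  move=> [x0 [x1 [lo [hi [/disk_between_arcs[A _ E] le [h1 h2 h3 h4]]]]]].
  by subst x1; exists x0, lo, hi.
move=> [x0 [lo [hi [A le h1 h2 E]]]]; exists x0, x, lo, hi; split=> //.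
  by apply/disk_between_arcs.
by split=> //; rewrite h1 h2.
Qed.

Lemma Disk_fullP c c' v D : v.1 <= c' ->
  Disk F c c' v D \/ Half_D F c c' v D <-> full_disk c v D.
Proof.
move=> vc; split.
  move=> [] [x0 [x1 [lo [hi [/disk_between_arcs[A _ E] le [h1 h2]]]]]];
  have vx : v.1 = x1 by rewrite -h1.
    exists x0, lo, hi; rewrite vx; split=> //; first by left.
    - by rewrite -h2.
    - by rewrite -h1.
  exists x0, lo, hi; rewrite vx; split=> //; first by right.
  - by rewrite -h2.
  - by rewrite -h1.
move=> [x0 [lo [hi [A [le|le] h1 h2 E]]]]; [left|right];
exists x0, v.1, lo, hi; split=> //; try (by apply/disk_between_arcs);
by split; rewrite ?h1 ?h2 -surjective_pairing.
Qed.

Lemma region_line x0 x1 lo hi x z : x0 <= x <= x1 ->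
  region x0 x1 lo hi (x, z) <-> lo x <= z <= hi x.
Proof. by move=> xx; split=> [[]|]. Qed.

(** Over the dividing line a disk that starts at a cusp has at most one point. *)
Lemma Disk_Half_disj c c' v : Disk F c c' v `&` Half_D F c c' v = set0.
Proof.
apply/seteqP; split=> // D [[x0 [x1 [lo [hi [dA [leq _] _]]]]]].
move=> [x0' [x1' [lo' [hi' [dA' [E lh] _]]]]].
move: dA dA' => /disk_between_arcs[[[h1 h2] _ _ _ _] _ E1].
move=> /disk_between_arcs[[[h1' h2'] _ _ _ _] _ E2]; subst x0'.
have H z : lo' c <= z <= hi' c -> x0 <= c <= x1 /\ lo c <= z <= hi c.
  move=> zz; have : D (c, z) by rewrite E2; apply/region_line => //; lra.
  by rewrite E1.
have [x0c l1] := H (lo' c) ltac:(lra); have [_ l2] := H (hi' c) ltac:(lra).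
have E : x0 = c by lra.
by subst x0; move: lh; rewrite leq in l1 l2; lra.
Qed.

Lemma near_between a b x : a < x < b -> \forall z \near x, a < z < b.
Proof.
move=> xx; apply/nearP; exists (Num.min (x - a) (b - x)); first by rewrite lt_min; lra.
by move=> z; rewrite lt_min !ltr_norml; lra.
Qed.

Definition glue y f g z : R := if z <= y then f z else g z.

Lemma glue_left y f g z : z <= y -> glue y f g z = f z.
Proof. by rewrite /glue => ->. Qed.

Lemma left_end_glue c x0 y lo hi glo ghi : x0 <= y -> left_end c x0 lo hi ->
  left_end c x0 (glue y lo glo) (glue y hi ghi).
Proof. by move=> xy; rewrite /left_end /left_end_cusp /left_end_line !glue_left. Qed.

Lemma arc_glue k y lo hi glo ghi :
  arc k (glue y lo glo) (glue y hi ghi) = glue y (arc k lo hi) (arc k glo ghi).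
Proof. by case: k. Qed.

Lemma arc_corner_glue k y x0 lo hi glo ghi :
  arc_corner F k (arc k (glue y lo glo) (glue y hi ghi)) x0 y =
  arc_corner F k (arc k lo hi) x0 y.
Proof.
have E z : x0 < z < y -> arc k (glue y lo glo) (glue y hi ghi) z = arc k lo hi z.
  by move=> zz; rewrite arc_glue glue_left //; lra.
apply/seteqP; split=> -[u z] [/= uu zf [s [t [cr H]]]]; have nb := near_between uu.
  split=> //=; first by rewrite zf E.
  by exists s, t; split=> //; apply: filterS2 nb H => w ww; rewrite E.
split=> //=; first by rewrite zf E.
by exists s, t; split=> //; apply: filterS2 nb H => w ww; rewrite E.
Qed.

Lemma arc_at_near k f g x : (\forall z \near x, f z = g z) -> arc_at F k f x ->
  arc_at F k g x.
Proof.
move=> fg; have fgx := nbhs_singleton fg.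
move=> [[r [rx H]]|[s [t [cr H]]]]; [left|right].
  by exists r; split=> //; apply: filterS2 fg H => z ->.
exists s, t; split; first by rewrite -fgx.
by apply: filterS2 fg H => z ->.
Qed.

(** On both sides of [y] the arcs follow the same strands, so that gluing them
    over [y] makes no corner there. *)
Lemma arcs_extend c y x0 lo hi x1 glo ghi s t :
  arcs F c y x0 lo hi -> y < x1 -> ~ event F y -> inside s y -> inside t y ->
  hi y = ht s y -> lo y = ht t y -> ctsw y x1 glo -> ctsw y x1 ghi ->
  (forall z, y <= z <= x1 -> front_set F (z, glo z) /\ front_set F (z, ghi z)) ->
  (forall z, y <= z < x1 -> glo z < ghi z) ->
  (forall k z, y < z < x1 -> arc_at F k (arc k glo ghi) z) ->
  (exists2 b, y < b & forall z, y <= z <= b -> ghi z = ht s z /\ glo z = ht t z) ->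
  arcs F c x1 x0 (glue y lo glo) (glue y hi ghi).
Proof.
move=> A yx ny sy ty hy ly cl ch fr lt Aat [b yb gb].
have [[cx xy] [cl' ch'] fr' lt' Aat'] := A.
have [gy1 gy2] := gb y ltac:(lra).
split.
- by split; lra.
- by split; apply: ctsw_glue => //; rewrite ?gy1 ?gy2; try lra.
- move=> z zz; rewrite /glue; case: (leP z y) => zy; first by apply: fr'; lra.
  by apply: fr; lra.
- move=> z zz; rewrite /glue; case: (ltgtP z y) => zy.
  + by apply: lt'; lra.
  + by apply: lt; lra.
  + by rewrite zy hy ly -gy1 -gy2; apply: lt; lra.
move=> k z zz; rewrite arc_glue.
have [zy|zy|->] := ltgtP z y.
- apply: (arc_at_near _ (Aat' k z ltac:(lra))).
  have nb : x0 < z < y by lra.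
  apply: filterS (near_between nb) => w ww.
  by rewrite /glue (_ : (w <= y) = true) //; lra.
- apply: (arc_at_near _ (Aat k z ltac:(lra))).
  have nb : y < z < x1 by lra.
  apply: filterS (near_between nb) => w ww.
  by rewrite /glue (_ : (w <= y) = false) //; apply/negbTE; rewrite -ltNge; lra.
left; exists (if k then t else s); split; first by case: k.
have [a' ay H] := avoid (finite_event F) xy.
have nb : a' < y < b by lra.
  apply: filterS (near_between nb) => w ww.
rewrite /glue; case: (leP w y) => wy.
  have nev z' : a' < z' <= y -> ~ event F z'.
    move=> z1; have [z2|z2] := ltP z' y; first by apply: H; lra.
    by rewrite (_ : z' = y) //; lra.
  have kin : inside (if k then t else s) y by case: (k).
  have kE : arc k lo hi y = ht (if k then t else s) y by rewrite /arc; case: (k).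
  have xa : x0 <= a' by lra.
  have ay' : a' < y by lra.
  by have [] := arc_back A xa ay' nev kin kE (z := w) ltac:(lra).
have [h1 h2] := gb w ltac:(lra).
by rewrite /arc; case: k.
Qed.

Lemma region_glue x0 y x1 lo hi glo ghi : x0 <= y -> y <= x1 ->
  glo y = lo y -> ghi y = hi y ->
  region x0 x1 (glue y lo glo) (glue y hi ghi) =
  region x0 y lo hi `|` region y x1 glo ghi.
Proof.
move=> xy yx E1 E2; apply/seteqP; split=> -[x z]; rewrite /region /glue /=.
  by case: (leP x y) => xy' [h1 h2]; [left|right]; split=> //; lra.
move=> [[h1 h2]|[h1 h2]].
  by rewrite (_ : (x <= y) = true); [split=> //; lra|lra].
case: (ltgtP x y) => xy'; [lra|split=> //; lra|].
by rewrite xy' -E1 -E2 -xy'; split=> //; lra.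
Qed.

Definition cut y D : set (R * R) := D `&` [set p | p.1 <= y].

Lemma cut_region y x0 x1 lo hi : y <= x1 ->
  cut y (region x0 x1 lo hi) = region x0 y lo hi.
Proof.
move=> yx; apply/seteqP; split=> -[x z]; rewrite /cut /region /=.
  by move=> [[h1 h2] h3]; split=> //; lra.
by move=> [h1 h2]; split; [split=> //|]; lra.
Qed.

Definition follow e s s' : R -> R := glue e (ht s') (ht s).

Lemma follow_left e s s' z : z <= e -> follow e s s' z = ht s' z.
Proof. by rewrite /follow /glue => ->. Qed.

Lemma follow_right e s s' z : ht s e = ht s' e -> e <= z -> follow e s s' z = ht s z.
Proof.
rewrite /follow /glue => E ez; case: (ltgtP z e) => ze //; first by lra.
by rewrite ze E.
Qed.

Definition strip y x e s s' t t' : set (R * R) :=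
  region y x (follow e t t') (follow e s s').

Section Step.
Context (c y e x : R).
Hypotheses (L : lone F y e x) (cy : c < y).

Lemma step_inside k s s' : arc_step k e s s' -> inside s' y /\ inside s x.
Proof.
have [ye ex _] := L.
move=> /arc_step_meet[se se' _]; split.
  by have [] := lone_inside_event L se'.
by have [] := lone_inside_event L se.
Qed.

Lemma follow_ctsw k s s' : arc_step k e s s' -> ctsw y x (follow e s s').
Proof.
have [ye ex _] := L.
move=> st; have [se se' E] := arc_step_meet st; have [sy sx] := step_inside st.
apply: ctsw_glue; rewrite ?E //; try exact: ltW.
- by apply: (ctsw_sub _ _ (@ht_ctsw _ F s')); move: sy se'; rewrite /inside; lra.
- by apply: (ctsw_sub _ _ (@ht_ctsw _ F s)); move: sx se; rewrite /inside; lra.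
Qed.

Lemma follow_front k s s' z : arc_step k e s s' -> y <= z <= x ->
  front_set F (z, follow e s s' z).
Proof.
have [ye ex _] := L.
move=> st zz; have [se se' E] := arc_step_meet st; have [sy sx] := step_inside st.
have [ze|ze] := leP z e.
  exists s'; rewrite follow_left //=; split=> //.
  by move: sy se'; rewrite /inside; lra.
exists s; rewrite follow_right //=; last exact: ltW.
by split=> //; move: sx se; rewrite /inside; lra.
Qed.

Lemma follow_arc_at k s s' z : arc_step k e s s' -> y < z < x ->
  arc_at F k (follow e s s') z.
Proof.
have [ye ex _] := L.
move=> st zz; have [se se' E] := arc_step_meet st; have [sy sx] := step_inside st.
have [ze|ze|->] := ltgtP z e.
- left; exists s'; split; first by apply: (lone_inside_left' L) sy; lra.
  have nb : y < z < e by lra.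
  apply: filterS (near_between nb) => w ww.
  by rewrite follow_left //; lra.
- left; exists s; split; first by apply: (lone_inside_right' L) sx; lra.
  have nb : e < z < x by lra.
  apply: filterS (near_between nb) => w ww.
  by rewrite follow_right //; lra.
apply: (step_arc_at L _ _ st) => w ww; first by rewrite follow_left; lra.
by rewrite follow_right //; lra.
Qed.

Lemma follow_lt s s' t t' z : arc_step false e s s' -> arc_step true e t t' ->
  above y s' t' -> above x s t -> y <= z <= x ->
  follow e t t' z < follow e s s' z.
Proof.
have [ye ex _] := L.
move=> us lt st' st zz.
have [_ _ Es] := arc_step_meet us; have [_ _ Et] := arc_step_meet lt.
have [ze|ze|->] := ltgtP z e.
- by rewrite !follow_left; try lra; have [] := lone_above_left L (z := z) ltac:(lra) st'.
- by rewrite !follow_right //; try lra; have [] := lone_above_right L (z := z) ltac:(lra) st.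
by rewrite !follow_right //; exact: steps_strict L us lt st' st.
Qed.

Lemma extend_arcs x0 lo hi s s' t t' : arc_step false e s s' ->
  arc_step true e t t' -> above y s' t' -> above x s t ->
  arcs F c y x0 lo hi -> hi y = ht s' y -> lo y = ht t' y ->
  arcs F c x x0 (glue y lo (follow e t t')) (glue y hi (follow e s s')).
Proof.
have [ye ex Lz] := L; have ny : ~ event F y by apply: Lz; lra.
move=> us lt st' st A h1 h2; have [[cx xy] _ _ _ _] := A; have [sy ty _] := st'.
apply: (arcs_extend A _ ny sy ty h1 h2).
- by lra.
- exact: follow_ctsw lt.
- exact: follow_ctsw us.
- by move=> z zz; split; [exact: follow_front lt zz|exact: follow_front us zz].
- by move=> z zz; apply: follow_lt => //; lra.
- by move=> k z zz; rewrite /arc; case: k; apply: follow_arc_at.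
by exists e => // z zz; rewrite !follow_left //; lra.
Qed.

Lemma extend_region x0 lo hi s s' t t' : x0 <= y -> hi y = ht s' y ->
  lo y = ht t' y ->
  region x0 x (glue y lo (follow e t t')) (glue y hi (follow e s s')) =
  region x0 y lo hi `|` strip y x e s s' t t'.
Proof.
have [ye ex Lz] := L.
by move=> xy h1 h2; rewrite region_glue // ?follow_left ?h1 ?h2 //; lra.
Qed.

Lemma half_extend s s' t t' D : arc_step false e s s' -> arc_step true e t t' ->
  above y s' t' -> above x s t -> half_disk c y s' t' D ->
  half_disk c x s t (D `|` strip y x e s s' t t').
Proof.
have [ye ex _] := L.
move=> us lt st' st [x0 [lo [hi [A le h1 h2 ->]]]].
have [[cx xy] _ _ _ _] := A.
have [_ _ Es] := arc_step_meet us; have [_ _ Et] := arc_step_meet lt.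
exists x0, (glue y lo (follow e t t')), (glue y hi (follow e s s')); split.
- exact: extend_arcs.
- by apply: left_end_glue => //; exact: ltW.
- by rewrite /glue leNgt (lt_trans ye ex) /= follow_right //; lra.
- by rewrite /glue leNgt (lt_trans ye ex) /= follow_right //; lra.
- by rewrite extend_region //; exact: ltW.
Qed.

Lemma cut_extend s s' t t' D : above y s' t' -> half_disk c y s' t' D ->
  cut y (D `|` strip y x e s s' t t') = D.
Proof.
have [ye ex _] := L.
move=> _ [x0 [lo [hi [A le h1 h2 ->]]]]; have [[cx xy] _ _ _ _] := A.
apply/seteqP; split=> -[u z]; last first.
  by move=> H; split; [left|case: H => /= uu _; lra].
move=> [[//|[/= uu zz]] /= uy].
have E : u = y by lra.
subst u; move: zz; rewrite !follow_left; try lra.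
by rewrite -h1 -h2 => zz; split=> //=; lra.
Qed.

(** A left cusp over [e] bears a half-disk. *)
Lemma cusp_arcs s t : lft s = e -> t = lmate s -> above x s t ->
  arcs F c x e (ht t) (ht s) /\ left_end c e (ht t) (ht s).
Proof.
have [ye ex _] := L.
move=> se ts st; have [sx tx lts] := st.
have te : lft t = e by rewrite ts lft_lmate.
have sz r z : inside r x -> e < z <= x -> inside r z.
  by move=> rx zz; exact: (lone_inside_right' L zz rx).
split.
- split; first by split=> //; exact: ltW (lt_trans cy ye).
  + split.
      by apply: (ctsw_sub _ _ (@ht_ctsw _ F t)); move: tx; rewrite /inside; lra.
    by apply: (ctsw_sub _ _ (@ht_ctsw _ F s)); move: sx; rewrite /inside; lra.
  + move=> z zz; split; [exists t|exists s] => /=; split=> //.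
      by move: tx; rewrite /inside; lra.
    by move: sx; rewrite /inside; lra.
  + by move=> z zz; have [] := lone_above_right L (z := z) ltac:(lra) st.
  move=> k z zz; left; exists (if k then t else s); split.
    by case: k; [apply: sz tx _|apply: sz sx _]; lra.
  by apply: filterE => w; rewrite /arc; case: k.
- left; split; last by exists s; rewrite se.
  by rewrite ts -se lmate_meet.
Qed.

Lemma half_cusp s t : lft s = e -> t = lmate s -> above x s t ->
  half_disk c x s t (region e x (ht t) (ht s)).
Proof.
by move=> se ts st; have [A le] := cusp_arcs se ts st; exists e, (ht t), (ht s).
Qed.

(** A half-disk that starts before [y] is cut over [y], and each of its arcs goes
    on with one step; one that starts later starts at [e], since a left cusp is an
    event, and its arcs are then the two strands of the cusp. *)
Lemma half_cases s t D : above x s t -> half_disk c x s t D ->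
  (exists s' t', [/\ above y s' t', arc_step false e s s', arc_step true e t t',
      half_disk c y s' t' (cut y D) & D = cut y D `|` strip y x e s s' t t']) \/
  [/\ lft s = e, t = lmate s & D = region e x (ht t) (ht s)].
Proof.
have [ye ex Lz] := L; have cy' := cy; have ny : ~ event F y by apply: Lz; lra.
move=> st [x0 [lo [hi [A le h1 h2 ->]]]].
have [[cx x0x] _ fr lt Aat] := A; have [sx tx lts] := st.
have x0e : x0 < y \/ x0 = e /\ left_end_cusp F x0 lo hi.
  case: le => [[E cu]|[E l]]; last by left; lra.
  have [r [E1 _]] := cu.
  have [h|h] := ltP x0 y; first by left.
  right; split; last by split.
  apply: contrapT => xe; have [_ _ H] := L; apply: (H x0) => //; first by lra.
  by left; exists r; left.
case: x0e => [xy|[xe [E [r [E1 E2]]]]]; last first.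
  right; subst x0.
  have fs z : e <= z <= x -> hi z = ht s z.
    by move=> zz; apply: (arc_right A (k := false) L _ sx h1 zz).
  have ft z : e <= z <= x -> lo z = ht t z.
    by move=> zz; apply: (arc_right A (k := true) L _ tx h2 zz).
  have sc := lone_closed_right L sx; have tc := lone_closed_right L tx.
  have re : lft r <= e <= rgt r by rewrite E1; have := @lft_lt_rgt _ F r; lra.
  have nr : ~ inside r e by rewrite /inside E1 ltxx.
  have Er : hi e = ht r e by rewrite E2 -E1.
  have one (q' : strand F) : inside q' x -> lft q' <= e <= rgt q' -> ht q' e = ht r e ->
      q' = r \/ q' = lmate r.
    move=> qx qe qr; have [->|/eqP rq] := eqVneq r q'; first by left.
    have [[_ ->]|[h _]] := meet_end rq re qe (esym qr) nr; first by right.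
    by exfalso; have := @lft_lt_rgt _ F r; rewrite -h -E1 ltxx.
  have sNt : s <> t by move=> h; apply: (@above_irr _ F x s); rewrite {2}h.
  have hs : s = r \/ s = lmate r by apply: one => //; rewrite -fs ?Er //; lra.
  have ht' : t = r \/ t = lmate r by apply: one => //; rewrite -ft -?Er ?E //; lra.
  split.
  - by case: hs => ->; rewrite ?lft_lmate.
  - by case: hs ht' sNt => -> [] ->; rewrite ?lmateK.
  apply/seteqP; split=> -[u z] [/= uu].
    by rewrite fs // ft // => zz; split.
  by move=> zz; split=> //=; rewrite fs // ft.
left.
have Ay := arcs_sub A (y := y) ltac:(lra).
have fry := fr y ltac:(lra).
have [s' [s'y hs']] := front_inside ny fry.2; have [t' [t'y ht']] := front_inside ny fry.1.
have fsl z : y <= z <= e -> hi z = ht s' z.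
  by apply: (arc_left A (k := false) L) => //; lra.
have ftl z : y <= z <= e -> lo z = ht t' z.
  by apply: (arc_left A (k := true) L) => //; lra.
have fsr z : e <= z <= x -> hi z = ht s z.
  by apply: (arc_right A (k := false) L) => //; lra.
have ftr z : e <= z <= x -> lo z = ht t z.
  by apply: (arc_right A (k := true) L) => //; lra.
have us : arc_step false e s s'.
  by apply: (arc_at_step L fsl fsr s'y sx); apply: (Aat false); lra.
have lt' : arc_step true e t t'.
  by apply: (arc_at_step L ftl ftr t'y tx); apply: (Aat true); lra.
have st' : above y s' t' by split=> //; rewrite -hs' -ht'; apply: lt; lra.
exists s', t'; split=> //; first by exists x0, lo, hi; split=> //; apply: cut_region; lra.
have [_ _ Es] := arc_step_meet us; have [_ _ Et] := arc_step_meet lt'.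
have hiE z : y <= z <= x -> hi z = follow e s s' z.
  move=> zz; have [ze|ze] := leP z e; first by rewrite follow_left // fsl //; lra.
  by rewrite follow_right //; [rewrite fsr //; lra|lra].
have loE z : y <= z <= x -> lo z = follow e t t' z.
  move=> zz; have [ze|ze] := leP z e; first by rewrite follow_left // ftl //; lra.
  by rewrite follow_right //; [rewrite ftr //; lra|lra].
apply/seteqP; split=> -[u z].
  move=> [/= uu zz]; have [uy|uy] := leP u y; first by left.
  by right; split=> /=; [lra|rewrite -hiE -?loE //; lra].
move=> [[]//|[/= uu]]; rewrite -hiE -?loE; try lra.
by move=> zz; split=> //=; lra.
Qed.

(** A corner lies at a crossing, and the only event in sight is [e]; whether there
    is one over [e] depends on the strands before and after. *)
Lemma arc_corner_step x0 lo hi k s s' : arcs F c x x0 lo hi -> x0 < y ->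
  inside s' y -> inside s x ->
  (forall z, y <= z <= e -> arc k lo hi z = ht s' z) ->
  (forall z, e <= z <= x -> arc k lo hi z = ht s z) ->
  arc_corner F k (arc k lo hi) x0 x =
  arc_corner F k (arc k lo hi) x0 y `|`
    [set p | p = (e, ht s e) /\ cross k s s' e].
Proof.
have [ye ex _] := L.
move=> A xy sy sx fl fr; set f := arc k lo hi in fl fr *.
have fe : f e = ht s e by apply: fr; lra.
apply/seteqP; split=> -[u z].
  move=> [/= uu zf [a [b [cr Hab]]]].
  have [uy|uy] := ltP u y; first by left; split=> //=; [lra|exists a, b].
  right; have ue : u = e.
    apply: contrapT => une; have [_ _ H] := L; apply: (H u) => //; first lra.
    by right; exists (u, z) => //; exists a, b.
  subst u z; rewrite fe; split=> //.
  by apply: (corner_germ L fl fr sy sx cr Hab).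
move=> [[/= uu zf H]|[[-> ->] cr]]; first by split=> //=; lra.
split=> //=; first by lra.
have [_ _ _ _ Aat] := A.
have [[r [re H]]|[a [b [cr' H]]]] := Aat k e ltac:(lra).
  have [E1 E2] := strand_germ L fl fr sy sx re H.
  by have [_ _ _] := cross_meet cr; rewrite E1 E2.
by exists a, b; split=> //; rewrite -fe.
Qed.

End Step.

(** Disks ending at a vertex over [e], on the two strands that meet there. *)
Section EndAtVertex.
Context (c y e x : R) (z0 : R) (a b : strand F).
Hypotheses (L : lone F y e x) (cy : c < y) (ab : above y a b).
Hypotheses (ae : ht a e = z0) (be : ht b e = z0).
Hypothesis only : forall r, inside r y -> ht r e = z0 -> r = a \/ r = b.

Definition wedge : set (R * R) := region y e (ht b) (ht a).

Lemma wedge_arcs x0 lo hi : arcs F c y x0 lo hi -> hi y = ht a y -> lo y = ht b y ->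
  arcs F c e x0 (glue y lo (ht b)) (glue y hi (ht a)).
Proof.
have [ye ex Lz] := L; have ny : ~ event F y by apply: Lz; lra.
move=> A h1 h2; have [[cx xy] _ _ _ _] := A; have [ay by_ _] := ab.
have ac := lone_closed_left L ay; have bc := lone_closed_left L by_.
apply: (arcs_extend A _ ny ay by_ h1 h2) => //.
- by apply: (ctsw_sub _ _ (@ht_ctsw _ F b)); move: by_; rewrite /inside; lra.
- by apply: (ctsw_sub _ _ (@ht_ctsw _ F a)); move: ay; rewrite /inside; lra.
- move=> z zz; split; [exists b|exists a] => /=; split=> //.
    by move: by_; rewrite /inside; lra.
  by move: ay; rewrite /inside; lra.
- by move=> z zz; have [] := lone_above_left L zz ab.
- move=> k z zz; left; exists (if k then b else a); split.
    by case: k; [apply: (lone_inside_left' L) by_|apply: (lone_inside_left' L) ay]; lra.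
  by apply: filterE => w; rewrite /arc; case: k.
by exists e.
Qed.

Lemma wedge_region x0 lo hi : x0 <= y -> hi y = ht a y -> lo y = ht b y ->
  region x0 e (glue y lo (ht b)) (glue y hi (ht a)) = region x0 y lo hi `|` wedge.
Proof.
by have [ye ex Lz] := L; move=> xy h1 h2; rewrite region_glue // ltW.
Qed.

Lemma full_extend D : half_disk c y a b D -> full_disk c (e, z0) (D `|` wedge).
Proof.
have [ye ex Lz] := L.
move=> [x0 [lo [hi [A le h1 h2 ->]]]]; have [[cx xy] _ _ _ _] := A.
exists x0, (glue y lo (ht b)), (glue y hi (ht a)); split=> /=.
- exact: wedge_arcs.
- by apply: left_end_glue => //; exact: ltW.
- by rewrite /glue leNgt ye.
- by rewrite /glue leNgt ye.
- by rewrite wedge_region //; exact: ltW.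
Qed.

Lemma cut_full D : half_disk c y a b D -> cut y (D `|` wedge) = D.
Proof.
have [ye ex _] := L.
move=> [x0 [lo [hi [A le h1 h2 ->]]]]; have [[cx xy] _ _ _ _] := A.
apply/seteqP; split=> -[u z]; last first.
  by move=> H; split; [left|case: H => /= uu _; lra].
move=> [[//|[/= uu zz]] /= uy].
have E : u = y by lra.
by subst u; move: zz; rewrite -h1 -h2 => zz; split=> //=; lra.
Qed.

Lemma full_cases x0 lo hi : ~ is_left_cusp F (e, z0) ->
  arcs F c e x0 lo hi -> left_end c x0 lo hi -> hi e = z0 -> lo e = z0 ->
  [/\ x0 < y, half_disk c y a b (region x0 y lo hi) &
      region x0 e lo hi = region x0 y lo hi `|` wedge].
Proof.
have [ye ex Lz] := L; have cy' := cy; have ny : ~ event F y by apply: Lz; lra.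
move=> nlc A le h1 h2; have [[cx xe] _ fr lt Aat] := A.
have xy : x0 < y.
  case: le => [[E [r [E1 E2]]]|[E l]]; last by lra.
  rewrite ltNge; apply/negP => h.
  have [_ _ H] := L; apply: (H x0); [lra|lra|].
  by left; exists r; left.
have fry := fr y ltac:(lra).
have [s [sy hs]] := front_inside ny fry.2; have [t [ty ht']] := front_inside ny fry.1.
have fs z : y <= z <= e -> hi z = ht s z.
  by apply: (arc_left A (k := false) L) => //; lra.
have ft z : y <= z <= e -> lo z = ht t z.
  by apply: (arc_left A (k := true) L) => //; lra.
have st : above y s t by split=> //; rewrite -hs -ht'; apply: lt; lra.
have sa : s = a \/ s = b by apply: only => //; rewrite -fs ?h1 //; lra.
have tb : t = a \/ t = b by apply: only => //; rewrite -ft ?h2 //; lra.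
have [Es Et] : s = a /\ t = b.
  case: sa tb st => -> [] -> // H; first by case: (above_irr H).
  - by case: (above_asym ab H).
  - by case: (above_irr H).
subst s t; split=> //.
  by exists x0, lo, hi; split=> //; apply: arcs_sub A _; lra.
apply/seteqP; split=> -[u z].
  move=> [/= uu zz]; have [uy|uy] := leP u y; first by left; split=> //=; lra.
  by right; split=> /=; [lra|rewrite -fs -?ft //; lra].
move=> [[/= uu zz]|[/= uu]]; first by split=> //=; lra.
by rewrite -fs // -ft // => zz; split=> //=; lra.
Qed.

Lemma arc_corner_end x0 lo hi k : x0 < y ->
  arc_corner F k (arc k lo hi) x0 e = arc_corner F k (arc k lo hi) x0 y.
Proof.
have [ye ex _] := L.
move=> xy; apply/seteqP; split=> -[u z] [/= uu zf [s [t [cr H]]]].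
  split=> //=; last by exists s, t.
  suff : u < y by lra.
  rewrite ltNge; apply/negP => yu; have [_ _ N] := L; apply: (N u); [lra|lra|].
  by right; exists (u, z) => //; exists s, t.
by split=> //=; [lra|exists s, t].
Qed.

End EndAtVertex.

Lemma line_arcs c x s t : c < x -> no_event F c x -> above x s t ->
  arcs F c x c (ht t) (ht s) /\ left_end c c (ht t) (ht s).
Proof.
move=> cx ne st; have [sx tx lts] := st.
have stz z : c <= z <= x -> above z s t by move=> zz; apply: (above_const ne _ _ st); lra.
split.
- split=> //.
  + have [sc tc _] := stz c ltac:(lra).
    split.
      by apply: (ctsw_sub _ _ (@ht_ctsw _ F t)); move: tx tc; rewrite /inside; lra.
    by apply: (ctsw_sub _ _ (@ht_ctsw _ F s)); move: sx sc; rewrite /inside; lra.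
  + move=> z /stz [sz tz _]; split; [exists t|exists s] => /=; split=> //.
      by move: tz; rewrite /inside; lra.
    by move: sz; rewrite /inside; lra.
  + by move=> z zz; have [] := stz z ltac:(lra).
  + move=> k z zz; left; exists (if k then t else s); split.
      by have [sz tz _] := stz z ltac:(lra); case: k.
    by apply: filterE => w; rewrite /arc; case: k.
- by right; split=> //; have [] := stz c ltac:(lra).
Qed.

(** Before the first event there are no left cusps to start from, and the arcs
    cannot leave their strands. *)
Lemma half_line c x s t D : c < x -> no_event F c x ->
  above x s t -> half_disk c x s t D <-> D = region c x (ht t) (ht s).
Proof.
move=> cx ne st; have [sx tx lts] := st.
have nc := ne.
have stz z : c <= z <= x -> above z s t by move=> zz; apply: (above_const nc _ _ st); lra.
split.
  move=> [x0 [lo [hi [A le h1 h2 ->]]]]; have [[cx0 x0x] [cl ch] fr lt Aat] := A.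
  have E : x0 = c.
    case: le => [[_ [r [E1 _]]]|[]//]; exfalso; apply: (ne x0); first by lra.
    by left; exists r; left.
  subst x0.
  have H k r : inside r x -> arc k lo hi x = ht r x -> forall z, c <= z <= x ->
      arc k lo hi z = ht r z.
    move=> rx E; have H z : c < z <= x -> arc k lo hi z = ht r z.
      by move=> zz; have [] := arc_back A (lexx _) cx _ rx E zz => // w ww; apply: ne; lra.
    move=> z zz; have [zc|zc] := ltP c z; first by apply: H; lra.
    have -> : z = c by lra.
    apply: (@limit_eq _ (arc k lo hi) (ht r) c x) => //; last lra.
    - exact: (arcs_ctsw A k).
    - have rc : inside r c by apply: (inside_const nc _ _ rx); lra.
      by apply: (ctsw_sub _ _ (@ht_ctsw _ F r)); move: rx rc; rewrite /inside; lra.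
    by move=> w ww; apply: H; lra.
  have fs := H false s sx h1; have ft := H true t tx h2.
  apply/seteqP; split=> -[u z] [/= uu].
    by rewrite [hi u]fs // [lo u]ft // => zz; split.
  by move=> zz; split=> //=; rewrite [hi u]fs // [lo u]ft.
move=> ->; have [A le] := line_arcs cx ne st.
by exists c, (ht t), (ht s).
Qed.

End HalfDisks.

(** * Sums over sets of disks, and induction on events *)

Section FiniteSums.

Lemma fsum_partition (A : nmodType) (T : choiceType) (I : finType) (S S0 : set T)
    (P : I -> set T) (f : T -> A) : finite_set S ->
  (forall D, S D <-> S0 D \/ exists i, P i D) ->
  (forall i D, P i D -> ~ S0 D) -> (forall i j D, P i D -> P j D -> i = j) ->
  \sum_(D \in S) f D = \sum_(D \in S0) f D + \sum_i \sum_(D \in P i) f D.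
Proof.
move=> fS SE dis0 dis.
have sub0 : S0 `<=` S by move=> D ?; apply/SE; left.
have subP i : P i `<=` S by move=> D ?; apply/SE; right; exists i.
have toS (Q : set T) : Q `<=` S ->
    \sum_(D \in Q) f D = \sum_(D <- fset_set S) (if D \in Q then f D else 0).
  by move=> QS; rewrite -{1}(setIidr QS) fsbig_mkcondr fsbig_finite.
rewrite (toS S0 sub0).
rewrite (eq_bigr (fun i => \sum_(D <- fset_set S) (if D \in P i then f D else 0)));
  last by move=> i _; exact: toS.
rewrite exchange_big /= -big_split /= fsbig_finite //=.
apply: eq_big_seq => D; rewrite in_fset_set // => /set_mem/SE.
move=> [S0D|[i PiD]].
  rewrite mem_set // big1 ?addr0 // => i _.
  by case: ifPn => // /set_mem /dis0.
rewrite memNset; last by move: PiD => /dis0.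
rewrite add0r (bigD1 i) //= mem_set // big1 ?addr0 // => j ji.
by case: ifPn => // /set_mem PjD; case/eqP: ji; exact: dis PjD PiD.
Qed.

Lemma fsum_distr (A : nzRingType) (T : choiceType) (S : set T) (f : T -> A) (a b : A) :
  finite_set S -> \sum_(D \in S) (a * f D * b) = a * (\sum_(D \in S) f D) * b.
Proof.
by move=> fS; rewrite !fsbig_finite //= mulr_sumr mulr_suml.
Qed.

Lemma finite_max (R : realType) (S : set R) : finite_set S -> S !=set0 ->
  exists2 e, S e & forall z, S z -> z <= e.
Proof.
move=> /finite_seqP[s ->]; elim: s => [|a s IH]; first by move=> [z].
move=> _; case: s IH => [|b s] IH.
  by exists a => [/=|z /=]; rewrite inE // => /eqP ->.
have [|e es H] := IH; first by exists b; rewrite /= inE eqxx.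
have [ae|ea] := leP a e.
  by exists e => [/=|z /=]; rewrite inE; [rewrite es orbT|move=> /orP[/eqP->|/H]].
exists a => [/=|z /=]; rewrite inE ?eqxx // => /orP[/eqP->//|/H ze].
exact: le_trans ze (ltW ea).
Qed.

End FiniteSums.

Section EventInduction.
Context (R : realType) (F : front R).
Implicit Types (c x y e z : R).

(** Induction on the number of event abscissas to the left of [x]: just before the
    last one there is an event-free abscissa [y]. *)
Lemma event_ind c c' (P : R -> Prop) : ~ event F c ->
  (forall x, c < x <= c' -> no_event F c x -> P x) ->
  (forall y e x, c < y -> x <= c' -> lone F y e x -> P y -> P x) ->
  forall x, c < x <= c' -> ~ event F x -> P x.
Proof.
move=> nc base step; have /finite_seqP[s Es] := finite_event F.
pose N x := count (fun z => c < z < x) s.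
suff H n x : (N x < n)%N -> c < x <= c' -> ~ event F x -> P x by move=> x; exact: (H (N x).+1).
elim: n x => // n IH x Nx cx nx.
have [[e0 E0]|none] := pselect ([set z | event F z /\ c < z < x] !=set0); last first.
  apply: base => // z zz ez; apply: none; exists z; split=> //.
  have zc : c != z by apply/eqP => h; apply: nc; rewrite h.
  have zx : z != x by apply/eqP => h; apply: nx; rewrite -h.
  by rewrite !lt_neqAle zc zx.
have fE : finite_set [set z | event F z /\ c < z < x].
  by apply: sub_finite_set (finite_event F) => z [].
have [e [Ee ce] emax] := finite_max fE (ex_intro _ e0 E0).
have [y cy yne] := avoid (finite_event F) (ltac:(lra) : c < e).
have L : lone F y e x.
  split; [lra|lra|move=> z zz ze ez].
  have [h|h] := ltP z e; first by apply: (yne z) => //; lra.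
  have [zx|zx] := ltP z x; last by apply: nx; rewrite (_ : x = z) //; lra.
  have cz : c < z < x by lra.
  by apply: ze; apply/eqP; rewrite eq_le h andbT; exact: emax.
clear emax fE E0; apply: (step y e x _ _ L); [lra|lra|].
apply: IH; [|lra|by apply: yne; lra].
move: Nx; rewrite ltnS; apply: leq_trans; rewrite /N.
have es : e \in s by move: Ee; rewrite Es.
have e1 : (0 < count_mem e s)%N by rewrite -has_count has_pred1.
apply: (@leq_trans (count (fun z => (c < z < y)%R) s + count_mem e s)%N).
  by rewrite -addn1 leq_add2l.
rewrite -count_predUI [X in (_ + X <= _)%N](_ : _ = 0%N).
  rewrite addn0; clear Es; apply: sub_count => z /= /orP[zz|/eqP->]; lra.
apply/eqP; rewrite -leqn0 leqNgt -has_count; apply/hasP => -[z _ /=].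
by move=> /andP[zz /eqP ze]; clear Es; subst z; lra.
Qed.

End EventInduction.

(** * Corners in the order of their abscissas *)

Section Words.
Context (R : realType) (F : front R).
Implicit Types (s t r : strand F) (p q v : R * R) (a b c x y z e : R).
Implicit Types (f g lo hi : R -> R) (k : bool) (D : set (R * R)).

Definition along k : rel (R * R) := fun p q => if k then p.1 <= q.1 else q.1 <= p.1.

Lemma along_total k : total (along k).
Proof. by move=> p q; rewrite /along; case: k; exact: le_total. Qed.

Lemma along_trans k : transitive (along k).
Proof.
move=> p q r; rewrite /along; case: k => h1 h2; first exact: le_trans h1 h2.
exact: le_trans h2 h1.
Qed.

(** Along a graph the abscissa determines the point, so sorting is canonical. *)
Lemma sort_graph k f (S : set (R * R)) e (w : R) : finite_set S ->
  (forall p, S p -> p.2 = f p.1 /\ p.1 < e) ->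
  sort (along k) (fset_set (S `|` [set (e, w)])) =
    if k then rcons (sort (along k) (fset_set S)) (e, w)
    else (e, w) :: sort (along k) (fset_set S).
Proof.
move=> fS SP; set s2 := RHS.
have notin : (e, w) \notin fset_set S.
  by rewrite in_fset_set //; apply/negP => /set_mem /SP[] /=; rewrite ltxx.
have perm2 : perm_eq s2 ((e, w) :: fset_set S).
  rewrite /s2; case: (k); first by rewrite perm_rcons perm_cons perm_sort.
  by rewrite perm_cons perm_sort.
have fU : finite_set (S `|` [set (e, w)]) by rewrite finite_setU.
have perm1 : perm_eq (fset_set (S `|` [set (e, w)])) ((e, w) :: fset_set S).
  apply: uniq_perm; rewrite ?fset_uniq //= ?notin ?fset_uniq //.
  move=> p; rewrite inE !in_fset_set //.
  apply/idP/idP.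
    by move=> /set_mem[h|->]; [rewrite mem_set ?orbT|rewrite eqxx].
  by move=> /orP[/eqP->|/set_mem h]; apply/mem_set; [apply: or_intror|apply: or_introl].
apply: (@sorted_eq_in _ (along k)).
- by move=> p q r _ _ _; exact: along_trans.
- move=> p q; rewrite !mem_sort !in_fset_set // => /set_mem Sp /set_mem Sq.
  rewrite /along => H; have E : p.1 = q.1.
    by apply/eqP; rewrite eq_le; case: (k) H => /andP[-> ->].
  case: Sp => [/SP[p2 pe]|pE]; case: Sq => [/SP[q2 qe]|qE].
  + by rewrite [p]surjective_pairing [q]surjective_pairing p2 q2 E.
  + by move: pe; rewrite E qE ltxx.
  + by move: qe; rewrite -E pE ltxx.
  + by rewrite pE qE.
- exact/sort_sorted/along_total.
- rewrite /s2; case: (k).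
    have : sorted (along true) (sort (along true) (fset_set S)) by exact/sort_sorted/along_total.
    move: (mem_sort (along true) (fset_set S)); case: (sort _ _) => //= a l Hl H.
    rewrite rcons_path H /= /along.
    have : last a l \in a :: l by exact: mem_last.
    by rewrite Hl in_fset_set // => /set_mem/SP[_ /ltW].
  rewrite /= path_min_sorted; first exact/sort_sorted/along_total.
  by apply/allP => p; rewrite mem_sort in_fset_set // => /set_mem/SP[_ /ltW].
- by rewrite perm_sort (perm_trans perm1) // perm_sym.
Qed.

End Words.

(** * Boundary words *)

Lemma mul5_assoc (A : nzRingType) (a b c d e : A) :
  a * b * c * (d * e) = a * (b * c * d) * e.
Proof. by rewrite !mulrA. Qed.

Section BoundaryWords.
Context (R : realType) (F : front R) (c c' : R).
Implicit Types (s t r : strand F) (p q v : R * R) (a b x y z e : R).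
Implicit Types (f g lo hi : R -> R) (k : bool) (D : set (R * R)).

Notation A := (freeAlg (DA_gen F c c')).
Notation vg := (vgen F c c').

Definition corner_prod k D : A :=
  \prod_(p <- sort (along k) (fset_set [set p | corner_at F k k D p])) vg p.

Lemma bdry_wordE D :
  bdry_word F c c' D = corner_prod false D * left_letter F c c' D * corner_prod true D.
Proof. by []. Qed.

Lemma finite_arc_corner k f a b : finite_set (arc_corner F k f a b).
Proof.
apply: sub_finite_set (finite_crossings F) => p [_ _ [s [t [[h1 h2 h3 h4 h5] _]]]].
by exists s, t; split=> //; apply: contraTneq h5 => ->; rewrite ltxx.
Qed.

Definition turn k s s' e : A := if `[< cross k s s' e >] then vg (e, ht s e) else 1.

Lemma corner_prod_step k f (S S0 : set (R * R)) e (w : R) (Q : Prop) :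
  S = S0 `|` [set p | p = (e, w) /\ Q] -> finite_set S0 ->
  (forall p, S0 p -> p.2 = f p.1 /\ p.1 < e) ->
  let t : A := if `[< Q >] then vg (e, w) else 1 in
  \prod_(p <- sort (along k) (fset_set S)) vg p =
  if k then (\prod_(p <- sort (along k) (fset_set S0)) vg p) * t
  else t * \prod_(p <- sort (along k) (fset_set S0)) vg p.
Proof.
move=> -> fS S0P /=; case: asboolP => q.
  rewrite (_ : [set p | _] = [set (e, w)]); last first.
    by apply/seteqP; split=> p /=; [case|].
  rewrite (sort_graph _ _ fS S0P); case: k.
    by rewrite -cats1 big_cat /= big_seq1.
  by rewrite big_cons.
rewrite (_ : [set p | _] = set0) ?setU0; last by apply/seteqP; split=> // p [].
by case: k; rewrite ?mulr1 ?mul1r.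
Qed.

Lemma corner_prod0 k D : [set p | corner_at F k k D p] = set0 -> corner_prod k D = 1.
Proof.
by rewrite /corner_prod => ->; rewrite fset_set0 (_ : sort _ _ = [::]) ?big_nil //=;
  apply: size0nil; rewrite size_sort.
Qed.

Lemma left_letter_slice D D' : (forall z, D (c, z) <-> D' (c, z)) ->
  left_letter F c c' D = left_letter F c c' D'.
Proof.
move=> DD; rewrite /left_letter; congr (if _ is Some st then _ else _).
apply: eq_pick => st /=; apply/asboolP/asboolP => -[h1 h2]; split=> // z.
  by rewrite -DD h2.
by rewrite DD h2.
Qed.

Lemma half_slice x s t D : half_disk c x s t D ->
  forall z, D (x, z) <-> ht t x <= z <= ht s x.
Proof.
move=> [x0 [lo [hi [[[_ xx] _ _ _ _] _ h1 h2 ->]]]] z.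
by rewrite -h1 -h2; apply: region_line; lra.
Qed.

Lemma slice_unique x s t s' t' : ~ event F x -> above x s t -> above x s' t' ->
  (forall z, ht t x <= z <= ht s x <-> ht t' x <= z <= ht s' x) -> s = s' /\ t = t'.
Proof.
move=> nx [sx tx st] [sx' tx' st'] H.
have h1 := H (ht t x); have h2 := H (ht s x).
have h3 := H (ht t' x); have h4 := H (ht s' x).
have l1 : ht t' x <= ht t x <= ht s' x by apply/h1; lra.
have l2 : ht t' x <= ht s x <= ht s' x by apply/h2; lra.
have l3 : ht t x <= ht t' x <= ht s x by apply/h3; lra.
have l4 : ht t x <= ht s' x <= ht s x by apply/h4; lra.
by split; apply: contrapT => /(no_meet nx) ne; [apply: (ne sx sx')|apply: (ne tx tx')]; lra.
Qed.

(** The word starts and ends at the right end, so that the new corners are the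
    first letter on the upper arc and the last letter on the lower one. *)
Lemma word_extend y e x s s' t t' D : lone F y e x -> c < y ->
  arc_step false e s s' -> arc_step true e t t' -> above y s' t' -> above x s t ->
  half_disk c y s' t' D ->
  bdry_word F c c' (D `|` strip y x e s s' t t') =
  turn false s s' e * bdry_word F c c' D * turn true t t' e.
Proof.
move=> L cy us lt st' st hD.
have [ye ex Lz] := L; have [sy ty _] := st'; have [sx tx _] := st.
have EL : left_letter F c c' (D `|` strip y x e s s' t t') = left_letter F c c' D.
  apply: left_letter_slice => z; split=> [[//|[/= ]]|]; first by lra.
  by left.
move: hD EL => [x0 [lo [hi [Ay le h1 h2 ->]]]].
have [[cx xy] _ _ _ _] := Ay.
rewrite -(extend_region L s t (ltW xy) h1 h2).
set lo' := glue y lo _; set hi' := glue y hi _ => EL.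
have Ax : arcs F c x x0 lo' hi' by exact: extend_arcs.
have [_ _ Es] := arc_step_meet us; have [_ _ Et] := arc_step_meet lt.
pose ss k := if k then t else s; pose ss' k := if k then t' else s'.
have fl k z : y <= z <= e -> arc k lo' hi' z = ht (ss' k) z.
  move=> zz; rewrite arc_glue /glue; case: (ltgtP z y) => zy; first lra.
    by case: k; rewrite /= follow_left //; lra.
  by rewrite zy; case: (k).
have fr k z : e <= z <= x -> arc k lo' hi' z = ht (ss k) z.
  move=> zz; rewrite arc_glue /glue leNgt (_ : (y < z) = true) /=; last lra.
  by case: k; rewrite /= follow_right //; lra.
have key k : corner_prod k (region x0 x lo' hi') =
   let cp := corner_prod k (region x0 y lo hi) in
   if k then cp * turn k (ss k) (ss' k) e else turn k (ss k) (ss' k) e * cp.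
  rewrite /= /corner_prod (corner_arc k Ax) (corner_arc k Ay) /turn.
  apply: (@corner_prod_step _ (arc k lo hi)).
  - rewrite (arc_corner_step L Ax xy (s := ss k) (s' := ss' k) (k := k)) //.
    + by rewrite arc_corner_glue.
    + by case: (k).
    + by case: (k).
    + exact: fl.
    + exact: fr.
  - exact: finite_arc_corner.
  - by move=> p [/= uu -> _]; split=> //; lra.
rewrite !bdry_wordE EL !key /=.
exact: mul5_assoc.
Qed.

End BoundaryWords.

(** * The matrix of disk counts *)

Lemma sum_pair1 (A : nzRingType) (I : finType) (f : I -> I -> A) (s t : I) :
  (forall s' t', (s', t') <> (s, t) -> f s' t' = 0) ->
  \sum_s' \sum_t' f s' t' = f s t.
Proof.
move=> H; rewrite (bigD1 s) //= [X in _ + X]big1 ?addr0; last first.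
  by move=> s' ss; apply: big1 => t' _; apply: H => -[E _]; rewrite E eqxx in ss.
rewrite (bigD1 t) //= [X in _ + X]big1 ?addr0 // => t' tt.
by apply: H => -[E]; rewrite E eqxx in tt.
Qed.

Lemma sum_delta (A : nzRingType) (I : finType) (s t : I) (f : I -> I -> A) :
  \sum_s' \sum_t' (s == s')%:R * f s' t' * (t' == t)%:R = f s t.
Proof.
rewrite (sum_pair1 (s := s) (t := t)) ?eqxx ?mul1r ?mulr1 // => s' t' ne.
have [ss|_] := eqVneq s s'; last by rewrite !mul0r.
have [tt|_] := eqVneq t' t; last by rewrite mulr0.
by case: ne; rewrite ss tt.
Qed.

Section DiskCounts.
Context (R : realType) (F : front R) (c c' : R).
Implicit Types (s t r : strand F) (p q v : R * R) (a b x y z e : R).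
Implicit Types (f g lo hi : R -> R) (k : bool) (D : set (R * R)).

Notation A := (freeAlg (DA_gen F c c')).
Notation vg := (vgen F c c').
Notation wd := (bdry_word F c c').

Lemma mul1r1 (B : nzRingType) (a : B) : 1 * a * 1 = a.
Proof. by rewrite mul1r mulr1. Qed.

(** Corners lie at crossings, which are events. *)
Lemma no_corner k x1 x0 lo hi : arcs F c x1 x0 lo hi ->
  (forall z, x0 < z < x1 -> ~ event F z) ->
  corner_prod F c c' k (region x0 x1 lo hi) = 1.
Proof.
move=> Ax ne; apply: corner_prod0; rewrite (corner_arc k Ax).
apply/seteqP; split=> // p [xx _ [s [t [cr _]]]].
by apply: (ne _ xx); right; exists p => //; exists s, t.
Qed.

Lemma word_cusp y e x s t : lone F y e x -> c < y -> lft s = e -> t = lmate s ->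
  above x s t -> wd (region e x (ht t) (ht s)) = 1.
Proof.
move=> L cy se ts st; have [ye ex Lz] := L.
have [Ax _] := cusp_arcs L cy se ts st.
have ne z : e < z < x -> ~ event F z by move=> zz; apply: Lz; lra.
rewrite bdry_wordE !(no_corner _ Ax) // mul1r1 /left_letter.
case: pickP => // st' /= /asboolP[[_ _ h1] h2].
have /h2[/= h3 _] : ht st'.2 c <= ht st'.2 c <= ht st'.1 c by lra.
by exfalso; lra.
Qed.

Lemma word_line x s t : ~ event F c -> c < x -> no_event F c x -> above x s t ->
  wd (region c x (ht t) (ht s)) = rho c c' s t.
Proof.
move=> nc cx ne st.
have [Ax _] := line_arcs cx ne st.
have stc : above c s t by apply: (above_const ne _ _ st); lra.
have nez z : c < z < x -> ~ event F z by move=> zz; apply: ne; lra.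
rewrite bdry_wordE !(no_corner _ Ax) // mul1r1 /left_letter.
case: pickP => [[s' t'] /= /asboolP[h1 h2]|/(_ (s, t)) /=].
  have [|/= <- <-//] := slice_unique nc stc h1.
  by move=> z; rewrite -h2 region_line //; lra.
move=> /asboolPn; case; split=> // z.
by rewrite region_line //; lra.
Qed.

Lemma word_wedge y e x z0 (a b : strand F) D : lone F y e x -> c < y -> above y a b ->
  ht a e = z0 -> ht b e = z0 -> half_disk c y a b D -> wd (D `|` wedge y e a b) = wd D.
Proof.
move=> L cy ab ae be hD; have [ye ex Lz] := L.
have EL : left_letter F c c' (D `|` wedge y e a b) = left_letter F c c' D.
  apply: left_letter_slice => z; split=> [[//|[/= ]]|]; first by lra.
  by left.
move: hD EL => [x0 [lo [hi [Ay le h1 h2 ->]]]].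
have [[cx xy] _ _ _ _] := Ay.
rewrite -(wedge_region L (ltW xy) h1 h2).
set lo' := glue y lo _; set hi' := glue y hi _ => EL.
have Ax : arcs F c e x0 lo' hi' by exact: (wedge_arcs L).
rewrite !bdry_wordE EL.
suff key k : corner_prod F c c' k (region x0 e lo' hi') =
   corner_prod F c c' k (region x0 y lo hi) :> A by rewrite !key.
rewrite /corner_prod (corner_arc k Ax) (corner_arc k Ay) (arc_corner_end L _ _ _ xy).
by rewrite arc_corner_glue.
Qed.

(** Over the right dividing line this is the value of [w] on the generator of [s]
    and [t].  Setting it to 0 unless [s] is above [t] makes it a strictly
    triangular matrix, so that sums over all strands can be used. *)
Definition disk_mx x s t : A :=
  if `[< above x s t >] then \sum_(D \in Half_DA c x s t) wd D else 0.

Lemma Half_DA_set x s t : above x s t -> Half_DA c x s t = half_disk c x s t.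
Proof. by move=> st; apply/seteqP; split=> D; rewrite Half_DAP. Qed.

Lemma disk_mx_above x s t : above x s t -> disk_mx x s t = \sum_(D \in half_disk c x s t) wd D.
Proof. by move=> st; rewrite /disk_mx asboolT // Half_DA_set. Qed.

Lemma disk_mx_not_above x s t : ~ above x s t -> disk_mx x s t = 0.
Proof. by move=> st; rewrite /disk_mx asboolF. Qed.

Lemma disk_mx_neq0 x s t : disk_mx x s t != 0 -> above x s t /\ exists D, half_disk c x s t D.
Proof.
rewrite /disk_mx; case: asboolP => [st|]; last by rewrite eqxx.
rewrite Half_DA_set // => W0; split=> //; apply/not_existsP => H.
move: W0; rewrite (_ : half_disk c x s t = set0) ?fsbig_set0 ?eqxx //.
by apply/seteqP; split=> D // /H.
Qed.

Lemma disk_mx_line x s t : ~ event F c -> c < x -> no_event F c x -> above x s t ->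
  disk_mx x s t = rho c c' s t.
Proof.
move=> nc cx ne st; rewrite disk_mx_above //.
rewrite (_ : half_disk c x s t = [set region c x (ht t) (ht s)]).
  by rewrite fsbig_set1; exact: word_line.
by apply/seteqP; split=> D /=; rewrite half_line.
Qed.

Definition step_ok y e x (s t : strand F) (i : strand F * strand F) : Prop :=
  [/\ above y i.1 i.2, arc_step false e s i.1 & arc_step true e t i.2].

Definition extend y e x (s t : strand F) (i : strand F * strand F) D :=
  D `|` strip y x e s i.1 t i.2.

Definition newborn e x s t : set (set (R * R)) :=
  [set D | [/\ lft s = e, t = lmate s & D = region e x (ht t) (ht s)]].

Definition grown y e x s t (i : strand F * strand F) : set (set (R * R)) :=
  [set D | step_ok y e x s t i /\
     exists2 D', half_disk c y i.1 i.2 D' & D = extend y e x s t i D'].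

Lemma half_decomp y e x s t : lone F y e x -> c < y -> above x s t -> forall D,
  half_disk c x s t D <-> newborn e x s t D \/ exists i, grown y e x s t i D.
Proof.
move=> L cy st D; split.
  move=> /(half_cases L cy st)[[s' [t' [h1 h2 h3 h4 h5]]]|]; last by left.
  by right; exists (s', t'); split=> //; exists (cut y D).
move=> [[h1 h2 ->]|[[s' t'] [[h1 h2 h3] [D' hD' ->]]]]; first exact: (half_cusp L cy h1 h2 st).
exact: (half_extend L).
Qed.

Lemma finite_half : ~ event F c -> forall x, c < x <= c' -> ~ event F x ->
  forall s t, above x s t -> finite_set (half_disk c x s t).
Proof.
move=> nc; apply: event_ind => // [x cx ne s t st|y e x cy xc L IH s t st].
  apply: (@sub_finite_set _ _ [set region c x (ht t) (ht s)]) => //.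
  by move=> D; rewrite half_line //; lra.
apply: (@sub_finite_set _ _ ([set region e x (ht t) (ht s)] `|`
   \bigcup_(i in [set i | step_ok y e x s t i])
      extend y e x s t i @` half_disk c y i.1 i.2)).
  move=> D /(half_decomp L cy st)[[_ _ ->]|[i [ok [D' hD' ->]]]]; first by left.
  by right; exists i => //; exists D'.
rewrite finite_setU; split=> //; apply: bigcup_finite; first exact: finite_finset.
by move=> i [h1 h2 h3]; apply: finite_image; exact: IH.
Qed.

Definition crossing_mx e (a b : strand F) : A :=
  if `[< crossing a b (e, ht a e) >] then vg (e, ht a e) else 0.

(** At [e] an arc stays on its strand or turns at a crossing. *)
Definition step_mx e (a b : strand F) : A := (a == b)%:R + crossing_mx e a b.

Definition born e s t : A := if (lft s == e) && (t == lmate s) then 1 else 0.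

Lemma step_mx_turn_up e s s' : arc_step false e s s' -> step_mx e s s' = turn c c' false s s' e.
Proof.
rewrite /step_mx /crossing_mx /turn => -[[<- se]|cr].
  by rewrite eqxx asboolF ?addr0 // => /crossing_neq.
have [_ _ _ /eqP/negbTE->] := cross_meet cr.
by rewrite !asboolT // add0r.
Qed.

Lemma step_mx_turn_low e t t' : arc_step true e t t' -> step_mx e t' t = turn c c' true t t' e.
Proof.
rewrite /step_mx /crossing_mx /turn => -[[<- se]|cr].
  by rewrite eqxx asboolF ?addr0 // => /crossing_neq.
have [_ _ E /eqP] := cross_meet cr; rewrite eq_sym => /negbTE->.
by rewrite -E !asboolT // add0r.
Qed.

Lemma step_mx_neq0 e (a b : strand F) : step_mx e a b != 0 -> a = b \/ crossing a b (e, ht a e).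
Proof.
rewrite /step_mx /crossing_mx; have [->|ab] := eqVneq a b; first by left.
by case: asboolP => cr; [right|rewrite add0r eqxx].
Qed.

Lemma step_mx_up y e x s s' : lone F y e x -> inside s x -> inside s' y ->
  step_mx e s s' != 0 -> arc_step false e s s'.
Proof.
move=> L sx sy /step_mx_neq0[E|cr]; last by right.
subst s'; left; split=> //; have [ye ex _] := L.
by move: sx sy; rewrite /inside; lra.
Qed.

Lemma step_mx_low y e x t t' : lone F y e x -> inside t x -> inside t' y ->
  step_mx e t' t != 0 -> arc_step true e t t'.
Proof.
move=> L tx ty /step_mx_neq0[E|cr].
  subst t'; left; split=> //; have [ye ex _] := L.
  by move: tx ty; rewrite /inside; lra.
right; rewrite /cross; suff -> : ht t e = ht t' e by [].
by case: cr => /= _ _ _ ->.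
Qed.

(** The transfer formula: [step_mx] lists the ways in which the upper arc (on the
    left) and the lower arc (on the right) of a half-disk can pass the event, and
    the other half-disks are born at a left cusp. *)
Lemma disk_mx_step y e x s t : ~ event F c -> lone F y e x -> c < y -> x <= c' ->
  above x s t ->
  disk_mx x s t = (\sum_s' \sum_t' step_mx e s s' * disk_mx y s' t' * step_mx e t' t) + born e s t.
Proof.
move=> nc L cy xc st; have [ye ex Lz] := L; have [sx tx _] := st.
have nx : ~ event F x by apply: Lz; lra.
have ny : ~ event F y by apply: Lz; lra.
rewrite disk_mx_above // (fsum_partition wd (finite_half nc _ nx st) (half_decomp L cy st)).
- rewrite addrC; congr (_ + _).
    rewrite pair_bigA /=; apply: eq_bigr => -[s' t'] _ /=.
    have [[st' us lt]|nok] := pselect (step_ok y e x s t (s', t')).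
      rewrite (_ : grown _ _ _ _ _ _ = extend y e x s t (s', t') @` half_disk c y s' t'); last first.
        by apply/seteqP; split=> D [] => [_ [D' h ->]|D' h <-]; [exists D'|split=> //; exists D'].
      rewrite fsbig_image; last first.
        move=> D1 D2 /set_mem h1 /set_mem h2 E.
        rewrite -(cut_extend L s t st' h1) -(cut_extend L s t st' h2).
        exact: (congr1 (cut y) E).
      rewrite step_mx_turn_up // step_mx_turn_low // disk_mx_above // -fsum_distr; last first.
        by apply: finite_half => //; lra.
      by apply: eq_fsbigr => D /set_mem hD; rewrite (word_extend _ L).
    rewrite (_ : grown _ _ _ _ _ _ = set0) ?fsbig_set0; last by apply/seteqP; split=> // D [].
    have [->|W0] := eqVneq (disk_mx y s' t') 0; first by rewrite mulr0 mul0r.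
    have [st' _] := disk_mx_neq0 W0; have [sy ty _] := st'.
    have [->|u0] := eqVneq (step_mx e s s') 0; first by rewrite !mul0r.
    have [->|l0] := eqVneq (step_mx e t' t) 0; first by rewrite mulr0.
    case: nok; split=> //; [exact: step_mx_up L sx sy u0|exact: step_mx_low L tx ty l0].
  rewrite /born; case: ifPn => [/andP[/eqP se /eqP ts]|nb].
    rewrite (_ : newborn _ _ _ _ = [set region e x (ht t) (ht s)]).
      by rewrite fsbig_set1; exact: word_cusp L cy se ts st.
    by apply/seteqP; split=> D /=; [case|].
  rewrite (_ : newborn _ _ _ _ = set0) ?fsbig_set0 //.
  apply/seteqP; split=> // D [se ts _]; move: nb; rewrite se ts !eqxx //.
- by lra.
- move=> [s' t'] D [[st' us _] _] [se _ _].
  have [] := arc_step_meet us; rewrite /inside se ltxx //.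
- move=> [s1 t1] [s2 t2] D [[/= st1 _ _] [D1 h1 E1]] [[/= st2 _ _] [D2 h2 E2]].
  have E : D1 = D2.
    have C1 := cut_extend L s t st1 h1; have C2 := cut_extend L s t st2 h2.
    by rewrite -C1 -C2; move: E1 E2; rewrite /extend /= => <- ->.
  have [z|-> ->//] := slice_unique ny st1 st2.
  by rewrite -(half_slice h1) E (half_slice h2).
Qed.

(** An abscissa between [y] and [x] can play the part of the event: without
    crossings and cusps over it the transfer matrix is the identity. *)
Lemma disk_mx_const y x s t : ~ event F c -> c < y -> y < x -> x <= c' -> no_event F y x ->
  above x s t -> disk_mx x s t = disk_mx y s t.
Proof.
move=> nc cy yx xc ne st.
pose e := (y + x) / 2.
have L : lone F y e x by split; rewrite /e; [lra|lra|move=> z zz _; apply: ne].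
have nee : ~ event F e by apply: ne; rewrite /e; lra.
have U1 (a b : strand F) : step_mx e a b = (a == b)%:R.
  rewrite /step_mx /crossing_mx asboolF ?addr0 // => cr; apply: nee; right.
  by exists (e, ht a e) => //; exists a, b.
rewrite (disk_mx_step nc L) // /born ifF; last first.
  by apply/negP => /andP[/eqP E _]; apply: nee; left; exists s; left.
rewrite addr0 -[RHS](sum_delta s t (disk_mx y)).
by apply: eq_bigr => s' _; apply: eq_bigr => t' _; rewrite !U1.
Qed.

(** A disk that ends at a vertex is cut just before it, which leaves a half-disk
    that ends on the two strands meeting there; filling in the wedge between these
    strands gives the disk back. *)
Lemma dif_vertex y e x z0 (a b : strand F) : ~ event F c -> lone F y e x -> c < y ->
  e <= c' -> above y a b -> ht a e = z0 -> ht b e = z0 ->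
  (forall r, inside r y -> ht r e = z0 -> r = a \/ r = b) ->
  ~ is_left_cusp F (e, z0) ->
  DA_dif_vertex F c c' (e, z0) =
    (if `[< is_right_cusp F (e, z0) >] then 1 else 0) + disk_mx y a b.
Proof.
move=> nc L cy ec ab ae be only nlc; have [ye ex Lz] := L.
have ny : ~ event F y by apply: Lz; lra.
rewrite /DA_dif_vertex -addrA; congr (_ + _).
have EU : Disk F c c' (e, z0) `|` Half_D F c c' (e, z0) =
          (fun D => D `|` wedge y e a b) @` half_disk c y a b.
  apply/seteqP; split=> D.
    move=> /(@Disk_fullP _ F c c' (e, z0) D ec) [x0 [lo [hi [Ae le h1 h2 ->]]]].
    have [_ hh ->] := full_cases L cy ab only nlc Ae le h1 h2.
    by exists (region x0 y lo hi).
  move=> [D' hD' <-]; apply/(@Disk_fullP _ F c c' (e, z0) _ ec).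
  exact: full_extend L ab ae be _ hD'.
have fU : finite_set (Disk F c c' (e, z0) `|` Half_D F c c' (e, z0)).
  by rewrite EU; apply: finite_image; apply: finite_half => //; lra.
rewrite -fsbigU //=; first last.
- by rewrite Disk_Half_disj.
- by apply: sub_finite_set fU => D; right.
- by apply: sub_finite_set fU => D; left.
rewrite EU fsbig_image; last first.
  move=> D1 D2 /set_mem h1 /set_mem h2 E.
  by rewrite -(cut_full L h1) -(cut_full L h2); exact: (congr1 (cut y) E).
rewrite (disk_mx_above ab); apply: eq_fsbigr => D /set_mem hD.
exact: word_wedge L cy ab ae be hD.
Qed.

End DiskCounts.

(** * Gauge transformations in characteristic 2 *)

Section Gauge.
Context (A : nzRingType) (I : finType) (d : A -> A).
Hypothesis add2 : forall a : A, a + a = 0.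
Hypothesis dD : forall a b, d (a + b) = d a + d b.
Hypothesis dM : forall a b, d (a * b) = d a * b + a * d b.
Implicit Types f g h : I -> I -> A.

Let mx f : 'M[A]_(#|I|) := \matrix_(i, j) f (enum_val i) (enum_val j).

Let mx_mul f g : mx f *m mx g = mx (fun s t => \sum_r f s r * g r t).
Proof.
apply/matrixP => i j; rewrite !mxE.
rewrite [RHS](reindex (@enum_val I predT)) /=; last first.
  by apply: onW_bij; exact: enum_val_bij.
by apply: eq_bigr => k _; rewrite !mxE.
Qed.

Let mx_add f g : mx f + mx g = mx (fun s t => f s t + g s t).
Proof. by apply/matrixP => i j; rewrite !mxE. Qed.

Let mx1 : mx (fun s t => (s == t)%:R) = 1%:M.
Proof. by apply/matrixP => i j; rewrite !mxE (inj_eq enum_val_inj). Qed.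

Let mx_inj f g : mx f = mx g -> forall s t, f s t = g s t.
Proof.
move=> /matrixP E s t; have := E (enum_rank s) (enum_rank t).
by rewrite !mxE !enum_rankK.
Qed.

Let mx0P f : (forall s t, f s t = 0) -> mx f = 0.
Proof. by move=> H; apply/matrixP => i j; rewrite !mxE H. Qed.

Let d0 : d 0 = 0.
Proof. by apply: (@addrI _ (d 0)); rewrite -dD !addr0. Qed.

Let d1 : d 1 = 0.
Proof. by apply: (@addrI _ (d 1)); have := dM 1 1; rewrite !mulr1 mul1r addr0. Qed.

Let dsum (J : Type) (r : seq J) (P : pred J) (F : J -> A) :
  d (\sum_(i <- r | P i) F i) = \sum_(i <- r | P i) d (F i).
Proof. exact: (big_morph d dD d0). Qed.

Let mx_add2 (M : 'M[A]_(#|I|)) : M + M = 0.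
Proof. by apply/matrixP => i j; rewrite !mxE add2. Qed.

Definition conjugate (U W : I -> I -> A) s t := \sum_s' \sum_t' U s s' * W s' t' * U t' t.

Let mx_conj U W : mx (conjugate U W) = mx U *m mx W *m mx U.
Proof.
rewrite !mx_mul; apply/matrixP => i j; rewrite !mxE /conjugate.
rewrite exchange_big /=; apply: eq_bigr => t' _; rewrite mulr_suml.
by [].
Qed.

Variables (W V P : I -> I -> A).
Hypothesis dV : forall a b, d (V a b) = P a b.
Hypothesis VV : forall a r b, V a r * V r b = 0.
Hypothesis VP : forall a r b, V a r * P r b = 0.
Hypothesis PV : forall a r b, P a r * V r b = 0.
Hypothesis PP : forall a r b, P a r * P r b = 0.

Let U a b := (a == b)%:R + V a b.
Let X := conjugate U W.
Definition curvature (f : I -> I -> A) s t := d (f s t) + \sum_r f s r * f r t.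

(** A gauge transformation by [U = 1 + V] turns the connection [d + W] into
    [d + U W U + dV], because [U * U = 1] and [V * dV = 0]; the curvatures are
    conjugate. *)
Lemma gauge s t :
  d (X s t) + \sum_r (X s r + P s r) * (X r t + P r t) =
  conjugate U (curvature W) s t.
Proof.
pose MU := mx U; pose MW := mx W; pose MP := mx P.
have mulz f g : (forall a r b, f a r * g r b = 0) -> mx f *m mx g = 0.
  by move=> H; rewrite mx_mul; apply: mx0P => a b; apply: big1.
have UE : MU = 1%:M + mx V by rewrite /MU -mx1 mx_add.
have UU : MU *m MU = 1%:M.
  rewrite UE mulmxDl mul1mx mulmxDr mulmx1 (mulz V V) // addr0 -addrA mx_add2.
  by rewrite addr0.
have UP : MU *m MP = MP by rewrite UE mulmxDl mul1mx (mulz V P) // addr0.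
have PU : MP *m MU = MP by rewrite UE mulmxDr mulmx1 (mulz P V) // addr0.
have PP0 : MP *m MP = 0 by exact: mulz.
have dU a b : d (U a b) = P a b.
  by rewrite /U dD dV; case: (a == b); rewrite ?d0 ?d1 add0r.
have dX : mx (fun s t => d (X s t)) =
    MP *m MW *m MU + MU *m mx (fun s t => d (W s t)) *m MU + MU *m MW *m MP.
  rewrite /MP /MW /MU !mx_mul !mx_add; apply/matrixP => i j; rewrite !mxE.
  rewrite /X /conjugate dsum -!big_split /=.
  rewrite (eq_bigr (fun s' => \sum_t' (P (enum_val i) s' * W s' t' * U t' (enum_val j)
    + U (enum_val i) s' * d (W s' t') * U t' (enum_val j)
    + U (enum_val i) s' * W s' t' * P t' (enum_val j)))); last first.
    move=> s' _; rewrite dsum; apply: eq_bigr => t' _.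
    by rewrite !dM !dU mulrDl.
  rewrite exchange_big /=; apply: eq_bigr => t' _.
  by rewrite !big_split /= !mulr_suml.
apply: (@mx_inj (fun s t => d (X s t) + \sum_r (X s r + P s r) * (X r t + P r t))).
rewrite -(mx_add (fun s t => d (X s t))) -(mx_mul (fun s r => X s r + P s r)) -mx_add.
rewrite dX mx_conj -(mx_add (fun s t => d (W s t))) -mx_mul -/MU -/MW -/MP.
rewrite (mx_conj U W) -/MU -/MW.
set DW := mx _.
rewrite mulmxDl !mulmxDr PP0 addr0.
have -> : MU *m MW *m MU *m (MU *m MW *m MU) = MU *m (MW *m MW) *m MU.
  by rewrite -!mulmxA (mulmxA MU MU) UU mul1mx.
have -> : MU *m MW *m MU *m MP = MU *m MW *m MP by rewrite -mulmxA UP.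
have -> : MP *m (MU *m MW *m MU) = MP *m MW *m MU by rewrite !mulmxA PU.
rewrite mulmxDl.
set a := MP *m MW *m MU; set b := MU *m DW *m MU; set c := MU *m MW *m MP.
set e := MU *m (MW *m MW) *m MU.
rewrite [a + b]addrC -!addrA; congr (_ + _).
rewrite [e + _]addrC !addrA -[RHS]add0r; congr (_ + _).
by rewrite -[a + c + c]addrA mx_add2 addr0 mx_add2.
Qed.

(** The relation [d W = W * W] implies [d (W * W) = W * W * W + W * W * W]. *)
Lemma curvature_sq (f : I -> I -> A) : (forall s t, d (f s t) = \sum_r f s r * f r t) ->
  forall s t, d (\sum_r f s r * f r t) = 0.
Proof.
move=> df s t; rewrite dsum.
rewrite (eq_bigr (fun r => (\sum_q f s q * f q r) * f r t + f s r * (\sum_q f r q * f q t)));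
  last by move=> r _; rewrite dM !df.
rewrite big_split /=.
rewrite (eq_bigr (fun r => \sum_q f s q * f q r * f r t)); last by move=> r _; rewrite mulr_suml.
rewrite exchange_big /=.
rewrite (eq_bigr (fun r => f s r * (\sum_q f r q * f q t))) ?add2 // => r _.
by rewrite mulr_sumr; apply: eq_bigr => q _; rewrite mulrA.
Qed.

End Gauge.

(** * The two strands that meet at a vertex *)

Section Vertices.
Context (R : realType) (F : front R).
Implicit Types (s t r a b : strand F) (p q v : R * R) (c x y z e : R).

Lemma avoid_right (S : set R) (x z : R) : finite_set S -> x < z ->
  exists2 w, x < w < z & forall u, x < u <= w -> ~ S u.
Proof.
move=> fS xz; have [w ww H] := avoid (finite_image (fun u => - u) fS) (ltac:(lra) : - z < - x).
exists (- w); first by lra.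
by move=> u uu Su; apply: (H (- u)); [lra|exists u].
Qed.

Lemma lone_exists c c' e : c < e < c' -> exists y x,
  [/\ lone F y e x, c < y & x < c'].
Proof.
move=> ce; have [y yy Hy] := avoid (finite_event F) (ltac:(lra) : c < e).
have [x xx Hx] := avoid_right (finite_event F) (ltac:(lra) : e < c').
exists y, x; split; [|lra|lra]; split; [lra|lra|move=> z zz /eqP; rewrite neq_lt].
by move=> /orP[h|h]; [apply: Hy|apply: Hx]; lra.
Qed.

(** What [dif_vertex] needs to know about the two strands at a vertex. *)
Definition meeting y e (z0 : R) a b : Prop :=
  [/\ above y a b, ht a e = z0, ht b e = z0,
      forall r, inside r y -> ht r e = z0 -> r = a \/ r = b &
      ~ is_left_cusp F (e, z0)].

Lemma closed_in s x : inside s x -> lft s <= x <= rgt s.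
Proof. by rewrite /inside; lra. Qed.

Lemma crossing_meeting y e x z0 a b : lone F y e x -> crossing a b (e, z0) ->
  meeting y e z0 a b /\ ~ is_right_cusp F (e, z0).
Proof.
move=> L cr; have [ab _] := lone_crossing L cr; have [/= ae be ha hb _] := cr.
have ends r : lft r <= e <= rgt r -> ht r e = z0 -> inside r e.
  move=> rc rz; have [<-//|/eqP ar] := eqVneq a r.
  by apply: (inside_no_end ae rc ar); rewrite ha.
split; last first.
  move=> [r [E1 E2]]; have lr := @lft_lt_rgt _ F r.
  have : inside r e by apply: ends; [lra|rewrite E2 E1].
  by rewrite /inside -E1 ltxx andbF.
split=> //; last first.
  move=> [r [E1 E2]]; have lr := @lft_lt_rgt _ F r.
  have : inside r e by apply: ends; [lra|rewrite E2 E1].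
  by rewrite /inside -E1 ltxx.
move=> r ry rz; have rc := lone_closed_left L ry.
have [E|E|E] := triple (closed_in ae) (closed_in be) rc (etrans ha (esym hb))
  (etrans hb (esym rz)).
- by case: (crossing_neq cr).
- by right.
- by left.
Qed.

Lemma right_cusp_meeting y e x z0 : lone F y e x -> is_right_cusp F (e, z0) ->
  exists a b, [/\ meeting y e z0 a b, rgt a = e, b = rmate a &
                  ~ is_crossing F (e, z0)].
Proof.
move=> L; have [ye ex Lz] := L; move=> [r [E1 E2]].
have ny : ~ event F y by apply: Lz; lra.
have re : rgt r = e by [].
have nr : ~ inside r e by rewrite /inside re ltxx andbF.
have ry (q : strand F) : rgt q = e -> inside q y.
  move=> qe; rewrite /inside qe ye andbT ltNge; apply/negP => h.
  have lq := @lft_lt_rgt _ F q; rewrite qe in lq.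
  by apply: (Lz (lft q)); [lra|lra|left; exists q; left].
have re' : rgt (rmate r) = e by rewrite rgt_rmate.
have hr : ht r e = z0 by rewrite E2 re.
have hr' : ht (rmate r) e = z0 by rewrite -re -rmate_meet re.
have lr := @lft_lt_rgt _ F r.
have only (q : strand F) : lft q <= e <= rgt q -> ht q e = z0 -> q = r \/ q = rmate r.
  move=> qc qz; have [<-|/eqP rq] := eqVneq r q; first by left.
  have rc : lft r <= e <= rgt r by lra.
  have [[h _]|[_ ->]] := meet_end rq rc qc (etrans hr (esym qz)) nr.
  - by exfalso; lra.
  - by right.
have nlc : ~ is_left_cusp F (e, z0).
  move=> [q [F1 F2]]; have lq := @lft_lt_rgt _ F q.
  have qc : lft q <= e <= rgt q by lra.
  have qz : ht q e = z0 by rewrite F2 -F1.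
  have [] := only q qc qz.
  - by move=> h; rewrite h in F1; lra.
  - by move=> h; rewrite h in F1 lq; lra.
have ncr : ~ is_crossing F (e, z0).
  move=> [s [t [/= se te hs ht' h]]].
  have [] := only s (closed_in se) hs => E; first by subst s.
  by move: se; rewrite /inside E re' ltxx andbF.
have only' (q : strand F) : inside q y -> ht q e = z0 -> q = r \/ q = rmate r.
  by move=> qy; apply: only; exact: lone_closed_left L qy.
have rr : r <> rmate r by move=> h; apply: (@rmate_neq _ F r); rewrite -h.
have [ab|ab] := above_total ny (ry r re) (ry _ re') rr.
  by exists r, (rmate r).
exists (rmate r), r; split=> //; last by rewrite rmateK.
by split=> // q qy qz; have [->|->] := only' q qy qz; [right|left].
Qed.

Lemma vertex_meeting c c' v : ~ event F c -> vertices F c c' v -> exists y x a b,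
  [/\ lone F y v.1 x, c < y, x < c', meeting y v.1 v.2 a b &
      (crossing a b v /\ ~ is_right_cusp F v) \/
      [/\ rgt a = v.1, b = rmate a, is_right_cusp F v & ~ is_crossing F v]].
Proof.
move=> nc; case: v => e z0 [/= ce vP]; have [y [x [L cy xc]]] := lone_exists ce.
case: vP => [[a [b cr]]|rc].
  have [m nrc] := crossing_meeting L cr.
  by exists y, x, a, b; split=> //; left.
have [a [b [m h1 h2 h3]]] := right_cusp_meeting L rc.
by exists y, x, a, b; split=> //; right.
Qed.

Lemma crossing_vertex c c' a b e : c < e < c' -> crossing a b (e, ht a e) ->
  vertices F c c' (e, ht a e).
Proof. by move=> ce cr; split=> //; left; exists a, b. Qed.

End Vertices.

(** * Disk counts in larger pieces *)

Section Inclusions.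
Context (R : realType) (F : front R).
Implicit Types (s t r a b : strand F) (p q v : R * R) (c x y z e : R).

Lemma vgenE c c' v : vertices F c c' v ->
  exists2 w : set_type (vertices F c c'), val w = v &
    vgen F c c' v = fgen (inl w : DA_gen F c c').
Proof.
move=> vv; rewrite /vgen; case: insubP => [w _ E|]; first by exists w.
by move=> /negP[]; exact/mem_set.
Qed.

Lemma vgen_val c c' (w : set_type (vertices F c c')) :
  vgen F c c' (val w) = fgen (inl w : DA_gen F c c').
Proof.
have [w' E ->] := vgenE (set_valP w).
by congr (fgen (inl _ : DA_gen F c c')); exact: val_inj.
Qed.

Lemma rhoE c c' s t : line_pairs c (s, t) ->
  exists2 w : set_type (line_pairs (F := F) c), val w = (s, t) &
    rho c c' s t = fgen (inr w : DA_gen F c c').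
Proof.
move=> vv; rewrite /rho; case: insubP => [w _ E|]; first by exists w.
by move=> /negP[]; exact/mem_set.
Qed.

Lemma rho_val c c' (w : set_type (line_pairs (F := F) c)) :
  rho c c' (val w).1 (val w).2 = fgen (inr w : DA_gen F c c').
Proof.
have h : line_pairs c ((val w).1, (val w).2).
  by rewrite -surjective_pairing; exact: set_valP.
have [w' E ->] := rhoE c' h.
by congr (fgen (inr _ : DA_gen F c c')); apply: val_inj; rewrite E -surjective_pairing.
Qed.

Lemma rho0 c c' s t : ~ line_pairs c (s, t) -> rho c c' s t = 0.
Proof.
move=> vv; rewrite /rho; case: insubP => [w H E|//].
by case: vv; exact/set_mem.
Qed.

Lemma DA_incl_vgen c c' c'' v : vertices F c c' v ->
  DA_incl c c' c'' (vgen F c c' v) = vgen F c c'' v.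
Proof. by move=> /vgenE[w <- ->]; rewrite /DA_incl alg_ext_gen. Qed.

Lemma DA_incl_rho c c' c'' s t :
  DA_incl c c' c'' (rho c c' s t) = rho c c'' s t.
Proof.
have [l|l] := pselect (line_pairs c (s, t)); last first.
  by rewrite !rho0 // /DA_incl alg_ext0.
by have [w E ->] := rhoE c' l; rewrite /DA_incl alg_ext_gen E.
Qed.

Lemma DA_w_vgen c c' c'' v : vertices F c' c'' v ->
  DA_w c c' c'' (vgen F c' c'' v) = vgen F c c'' v.
Proof. by move=> /vgenE[w <- ->]; rewrite /DA_w alg_ext_gen. Qed.

Lemma DA_w_rho c c' c'' s t : line_pairs c' (s, t) ->
  DA_w c c' c'' (rho c' c'' s t) = DA_incl c c' c'' (w_elt c c' s t).
Proof. by move=> l; have [w E ->] := rhoE c'' l; rewrite /DA_w alg_ext_gen E. Qed.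

(** The transfer formula is the same noncommutative polynomial in both algebras,
    and an algebra map commutes with it. *)
Lemma transfer_step c1 c1' c2 c2' (f : DA_gen F c1 c1' -> freeAlg (DA_gen F c2 c2'))
    y e x : ~ event F c1 -> ~ event F c2 -> lone F y e x -> c1 < y -> c2 < y ->
  x <= c1' -> x <= c2' ->
  (forall v, v.1 = e -> is_crossing F v ->
     alg_ext f (vgen F c1 c1' v) = vgen F c2 c2' v) ->
  (forall s t, above y s t -> alg_ext f (disk_mx c1 c1' y s t) = disk_mx c2 c2' y s t) ->
  forall s t, above x s t -> alg_ext f (disk_mx c1 c1' x s t) = disk_mx c2 c2' x s t.
Proof.
move=> n1 n2 L y1 y2 x1 x2 fV fW s t st.
have fW' s' t' : alg_ext f (disk_mx c1 c1' y s' t') = disk_mx c2 c2' y s' t'.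
  have [st'|st'] := pselect (above y s' t'); first exact: fW.
  by rewrite !disk_mx_not_above // alg_ext0.
have fU a b : alg_ext f (step_mx c1 c1' e a b) = step_mx c2 c2' e a b.
  rewrite /step_mx alg_extD; congr (_ + _).
    by case: (a == b); rewrite ?alg_ext1 ?alg_ext0.
  rewrite /crossing_mx; case: asboolP => cr; last by rewrite alg_ext0.
  by apply: fV => //; exists a, b.
rewrite (disk_mx_step n1 L) // (disk_mx_step n2 L) // alg_extD; congr (_ + _); last first.
  by rewrite /born; case: ifP; rewrite ?alg_ext1 ?alg_ext0.
rewrite alg_ext_sum; apply: eq_bigr => s' _.
rewrite alg_ext_sum; apply: eq_bigr => t' _.
by rewrite !alg_extM fW' !fU.
Qed.

Lemma incl_disk_mx c c' c'' : ~ event F c -> c < c' -> c' <= c'' ->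
  forall x, c < x <= c' -> ~ event F x -> forall s t, above x s t ->
  DA_incl c c' c'' (disk_mx c c' x s t) = disk_mx c c'' x s t.
Proof.
move=> nc cc cc'; apply: event_ind => // [x cx ne s t st|y e x cy xc L IH].
  by rewrite !disk_mx_line // ?DA_incl_rho //; lra.
have [ye ex _] := L.
apply: (transfer_step nc nc L cy cy xc); [lra| |exact: IH].
move=> v ve cr; apply: DA_incl_vgen; split; [lra|by left].
Qed.

Lemma w_eltE c c' s t : above c' s t -> w_elt c c' s t = disk_mx c c' c' s t.
Proof. by move=> st; rewrite /w_elt /disk_mx asboolT. Qed.

(** Extending a piece to the left replaces the generators of its dividing line
    by the counts of the half-disks that end there. *)
Lemma w_disk_mx c c' c'' : ~ event F c -> ~ event F c' -> c < c' -> c' < c'' ->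
  forall x, c' < x <= c'' -> ~ event F x -> forall s t, above x s t ->
  DA_w c c' c'' (disk_mx c' c'' x s t) = disk_mx c c'' x s t.
Proof.
move=> nc nc' cc cc'; apply: event_ind => // [x cx ne s t st|y e x cy xc L IH].
  have st' : above c' s t by apply: (above_const ne _ _ st); lra.
  rewrite disk_mx_line //; last lra.
  rewrite DA_w_rho // w_eltE // incl_disk_mx //; [|lra|lra].
  by rewrite -(disk_mx_const nc cc _ _ ne) //; lra.
have [ye ex _] := L.
apply: (transfer_step nc' nc L cy _ xc); [lra|lra| |exact: IH].
move=> v ve cr; apply: DA_w_vgen; split; [lra|by left].
Qed.

End Inclusions.

(** * The curvature of the matrix of disk counts *)

Lemma mul3_neq0 (A : nzRingType) (a b c : A) : a * b * c != 0 ->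
  [/\ a != 0, b != 0 & c != 0].
Proof.
move=> H; split; apply: contraNneq H => ->; first by rewrite !mul0r.
  by rewrite mulr0 mul0r.
by rewrite mulr0.
Qed.

Lemma mul2_neq0 (A : nzRingType) (a b : A) : a * b != 0 -> a != 0 /\ b != 0.
Proof.
by move=> H; split; apply: contraNneq H => ->; rewrite ?mul0r ?mulr0.
Qed.

Lemma sum_neq0 (A : nmodType) (I : finType) (f : I -> A) :
  \sum_i f i != 0 -> exists i, f i != 0.
Proof.
move=> H; apply/not_existsP => N; move: H; rewrite big1 ?eqxx // => i _.
by apply: contrapT => /eqP; exact: N.
Qed.

Lemma add_eq0_2 (A : nzRingType) (a b : A) : (forall c : A, c + c = 0) -> a = b -> a + b = 0.
Proof. by move=> add2 ->. Qed.

(** In a sum over the middle strand [r] the [w] are counts after an event, the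
    [x + p] gauge transforms of the counts before it, and the [dead] strands those
    that end at the event. *)
Lemma middle_sum (A : nzRingType) (I : finType) (wl wr xl xr pl pr : I -> A)
    (dead : pred I) :
  (forall r, wl r * wr r = (xl r + pl r) * (xr r + pr r) +
             (if dead r then xl r * xr r else 0)) ->
  \sum_r wl r * wr r = \sum_r (xl r + pl r) * (xr r + pr r) +
                       \sum_(r | dead r) xl r * xr r.
Proof. by move=> H; rewrite [X in _ + X]big_mkcond /= -big_split /=; apply: eq_bigr. Qed.

(** The four fates of a middle strand at an event: it ends there, is absent on
    both sides, passes, or is born there. *)
Section ProductCases.
Context (A : nzRingType) (wl wr xl xr pl pr bl br : A).

Lemma product_dead : (forall a : A, a + a = 0) -> wl = 0 -> pl = 0 -> pr = 0 ->
  wl * wr = (xl + pl) * (xr + pr) + xl * xr.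
Proof. by move=> add2 -> -> ->; rewrite mul0r !addr0 add2. Qed.

Lemma product_absent : wl * wr = 0 -> xl = 0 -> pl = 0 ->
  wl * wr = (xl + pl) * (xr + pr) + 0.
Proof. by move=> -> -> ->; rewrite !addr0 mul0r. Qed.

Lemma product_live : wl = xl + pl -> wr = xr + pr ->
  wl * wr = (xl + pl) * (xr + pr) + 0.
Proof. by move=> -> ->; rewrite addr0. Qed.

Lemma product_born : wl = xl + bl -> wr = xr + br -> xl = 0 -> xr = 0 ->
  bl * br = 0 -> wl * wr = 0.
Proof. by move=> -> -> -> -> ?; rewrite !add0r. Qed.

Lemma eq_add0 : wl = 0 -> xl = pl -> (forall a : A, a + a = 0) -> wl = xl + pl.
Proof. by move=> -> -> ->. Qed.

Lemma eq_add0r : wl = xl + bl -> bl = 0 -> pl = 0 -> wl = xl + pl.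
Proof. by move=> -> -> ->. Qed.

Lemma add0_eq : pl = 0 -> xl + pl = xl.
Proof. by move=> ->; rewrite addr0. Qed.

Lemma curvature_assoc : wl = xl -> wr = xr + pr -> xl + xr = br ->
  wl + wr = br + pr.
Proof. by move=> -> -> <-; rewrite addrA. Qed.

Lemma mul0l : wl = 0 -> wl * wr = 0.
Proof. by move=> ->; rewrite mul0r. Qed.

Lemma mul0_r : wr = 0 -> wl * wr = 0.
Proof. by move=> ->; rewrite mulr0. Qed.

Lemma zero_or (Q : Prop) : (wl != 0 -> Q) -> wl = 0 \/ Q.
Proof. by have [->|w] := eqVneq wl 0; [left|right; auto]. Qed.

Lemma not_neq0 : (wl != 0 -> False) -> wl = 0.
Proof. by have [//|w H] := eqVneq wl 0; case: H. Qed.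

End ProductCases.

Section Curvature.
Context (R : realType) (F : front R) (c c' : R).
Implicit Types (s t r a b : strand F) (x y z e : R).

Notation A := (freeAlg (DA_gen F c c')).
Notation dd := (der_ext (@DA_dif_gen R F c c')).
Notation WW := (@disk_mx R F c c').
Notation UU := (@step_mx R F c c').

Lemma ddD (a b : A) : dd (a + b) = dd a + dd b.
Proof. exact: der_extD. Qed.

Lemma ddM (a b : A) : dd (a * b) = dd a * b + a * dd b.
Proof. exact: der_extM. Qed.

(** The differential of [crossing_mx], see [dd_crossing_mx]. *)
Definition crossing_dmx y e a b : A :=
  if `[< crossing a b (e, ht a e) >] then WW y a b else 0.

Lemma dd_vgen v : vertices F c c' v -> dd (vgen F c c' v) = DA_dif_vertex F c c' v.
Proof. by move=> /vgenE[w <- ->]; rewrite der_ext_gen. Qed.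

Lemma dd_rho s t : line_pairs c (s, t) -> dd (rho c c' s t) = DA_dif_rho c c' s t.
Proof. by move=> /(rhoE c')[w E ->]; rewrite der_ext_gen /DA_dif_gen E. Qed.

Lemma dd_crossing_mx y e x a b : ~ event F c -> lone F y e x -> c < y -> e < c' ->
  dd (crossing_mx c c' e a b) = crossing_dmx y e a b.
Proof.
move=> nc L cy ec; have [ye ex _] := L.
rewrite /crossing_mx /crossing_dmx; case: asboolP => cr; last by rewrite der_ext0.
rewrite dd_vgen; last by apply: (crossing_vertex _ cr); lra.
have [[ab ha hb only nlc] nrc] := crossing_meeting L cr.
rewrite (dif_vertex nc L cy (ltW ec) ab ha hb only nlc) asboolF // add0r.
by [].
Qed.

Definition moved_mx y e := conjugate (UU e) (WW y).

Definition defect x := curvature dd (WW x).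

Lemma step_mx_id e s : UU e s s = 1.
Proof. by rewrite /step_mx /crossing_mx eqxx asboolF ?addr0 // => /crossing_neq. Qed.

Lemma moved_mx_neq0 y e s r : moved_mx y e s r != 0 -> exists s' r',
  [/\ UU e s s' != 0, WW y s' r' != 0 & UU e r' r != 0].
Proof.
by move=> /sum_neq0[s' /sum_neq0[r' /mul3_neq0[]]]; exists s', r'.
Qed.

Lemma crossing_dmx_neq0 y e a b : crossing_dmx y e a b != 0 -> crossing a b (e, ht a e).
Proof. by rewrite /crossing_dmx; case: asboolP => //; rewrite eqxx. Qed.

Lemma crossing_inside a b e z : crossing a b (e, z) -> inside a e /\ inside b e.
Proof. by move=> [? ? _ _ _]. Qed.

Lemma step_mx_out e r r' : ~ inside r e -> UU e r r' != 0 \/ UU e r' r != 0 -> r' = r.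
Proof.
by move=> nr [] /step_mx_neq0[-> // |/crossing_inside[? ?]].
Qed.

(** A crossing pair is no longer a pair of boundary strands in the same order;
    the transform still has its old count there, and [crossing_dmx] cancels it. *)
Lemma moved_mx_not_above y e x s r : lone F y e x -> inside s x -> inside r x ->
  ~ above x s r -> moved_mx y e s r = crossing_dmx y e s r.
Proof.
move=> L sx rx nsr; have [ye ex Lz] := L.
have nx : ~ event F x by apply: Lz; lra.
have key s' r' : UU e s s' * WW y s' r' * UU e r' r != 0 ->
    [/\ s' = s, r' = r & crossing s r (e, ht s e)].
  move=> /mul3_neq0[u0 /disk_mx_neq0[st' _] l0].
  have [sy ry _] := st'.
  have us := step_mx_up L sx sy u0; have lr := step_mx_low L rx ry l0.
  have [h1 h2] := steps_apart L us lr st'.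
  have [srE|sr] := eqVneq s r; last first.
    apply: h2; last exact/eqP.
    apply/eqP; rewrite eq_le h1 leNgt; apply/negP => h3.
    by apply: nsr; exact: lone_event_above L sx rx h3.
  exfalso; subst r; have [se se' Es] := arc_step_meet us; have [_ re' Er] := arc_step_meet lr.
  case: us => [[E1 _]|/= cr1]; case: lr => [[E2 _]|/= cr2].
  - by subst s' r'; exact: above_irr st'.
  - have [h _] := lone_crossing L cr2; subst s'; exact: above_asym h st'.
  - have [h _] := lone_crossing L cr1; subst r'; exact: above_asym h st'.
  have [E3|E3|E3] := triple (closed_in se') (closed_in se) (closed_in re') (esym Es) Er.
  - by case: (crossing_neq cr1).
  - by case: (crossing_neq cr2).
  - by subst r'; exact: above_irr st'.
rewrite /moved_mx /conjugate /crossing_dmx; case: asboolP => cr.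
  rewrite (sum_pair1 (s := s) (t := r)); first by rewrite !step_mx_id mul1r1.
  move=> s' r' ne; apply: not_neq0 => /key [h1 h2 _].
  by apply: ne; rewrite h1 h2.
apply: big1 => s' _; apply: big1 => r' _.
by apply: not_neq0 => /key [].
Qed.

Lemma disk_mx_moved y e x s t : ~ event F c -> lone F y e x -> c < y -> x <= c' ->
  above x s t -> WW x s t = moved_mx y e s t + born c c' e s t.
Proof. exact: disk_mx_step. Qed.

(** A strand contributes the product of the gauge transforms, whether it passes or
    is born at the event.  The exception is a strand that ends there: nothing is
    left of it after the event, although the transforms need not vanish. *)
Lemma product_step y e x s r t : ~ event F c -> lone F y e x -> c < y -> x <= c' ->
  above x s t -> WW x s r * WW x r t =
  (moved_mx y e s r + crossing_dmx y e s r) * (moved_mx y e r t + crossing_dmx y e r t) +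
  (if rgt r == e then moved_mx y e s r * moved_mx y e r t else 0).
Proof.
move=> nc L cy xc st; have [sx tx _] := st; have [ye ex Lz] := L.
have Pout a b : ~ inside a e \/ ~ inside b e -> crossing_dmx y e a b = 0.
  by move=> H; apply: not_neq0 => /crossing_dmx_neq0 /crossing_inside[]; tauto.
have Xout : ~ inside r e -> ~ inside r y -> moved_mx y e s r = 0 /\ moved_mx y e r t = 0.
  move=> H1 H2; split; apply: not_neq0 => /moved_mx_neq0[s' [r' [u0 /disk_mx_neq0[[h1 h2 _] _] l0]]].
    by apply: H2; rewrite -(step_mx_out H1 (or_intror l0)).
  by apply: H2; rewrite -(step_mx_out H1 (or_introl u0)).
case: ifPn => [/eqP re|/eqP re].
  have nre : ~ inside r e by rewrite /inside re ltxx andbF.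
  have nrx : ~ inside r x by rewrite /inside re; move=> /andP[_]; lra.
  apply: product_dead; first exact: addff.
  - by apply: disk_mx_not_above => -[_ ? _].
  - by apply: Pout; right.
  - by apply: Pout; left.
have [rx|nrx] := pselect (inside r x); last first.
  have nre : ~ inside r e by move=> /(lone_inside_event L)[].
  have nry : ~ inside r y.
    move=> ry; have rc := lone_closed_left L ry.
    have lr : rgt r <= x.
      by rewrite leNgt; apply/negP => h; apply: nrx; move: rc ry; rewrite /inside; lra.
    by apply: (Lz (rgt r)); [lra|exact: re|left; exists r; right].
  apply: product_absent; last by apply: Pout; right.
    by apply: mul0l; apply: disk_mx_not_above => -[_ ? _].
  exact: (proj1 (Xout nre nry)).
have [le|le] := eqVneq (lft r) e.
  have nre : ~ inside r e by rewrite /inside le ltxx.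
  have nry : ~ inside r y by rewrite /inside le; move=> /andP[? _]; lra.
  have [X1 X2] := Xout nre nry.
  apply: product_absent; [|exact: X1|by apply: Pout; right].
  have [sr|sr] := pselect (above x s r); last by apply: mul0l; exact: disk_mx_not_above.
  have [rt|rt] := pselect (above x r t); last by apply: mul0_r; exact: disk_mx_not_above.
  apply: (product_born (disk_mx_moved nc L cy xc sr) (disk_mx_moved nc L cy xc rt) X1 X2).
  rewrite /born; case: ifPn => [/andP[_ /eqP rs]|]; last by rewrite mul0r.
  case: ifPn => [/andP[_ /eqP tr]|]; last by rewrite mulr0.
  by exfalso; apply: (@above_irr _ F x s); move: st; rewrite tr rs lmateK.
have one a b : inside a x -> inside b x -> (b = r \/ a = r) -> WW x a b = moved_mx y e a b + crossing_dmx y e a b.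
  move=> ax bx abr; have [ab|nab] := pselect (above x a b); last first.
    apply: eq_add0; [exact: disk_mx_not_above|exact: moved_mx_not_above L ax bx nab|exact: addff].
  apply: (eq_add0r (disk_mx_moved nc L cy xc ab)).
    rewrite /born ifF //.
    apply/negP => /andP[/eqP h1 /eqP h2]; case: abr => h; subst r.
      by move: le; rewrite h2 lft_lmate h1 eqxx.
    by move: le; rewrite h1 eqxx.
  apply: not_neq0 => /crossing_dmx_neq0 cr; have [_ h] := lone_crossing L cr.
  exact: above_asym ab h.
by apply: product_live; apply: one => //; [left|right].
Qed.

(** How the failure of [d W = W * W] propagates: crossings conjugate it, left cusps
    leave it alone, and a right cusp adds the pairs of half-disks that end on one
    of its strands. *)
Lemma defect_step y e x s t : ~ event F c -> lone F y e x -> c < y -> x <= c' ->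
  above x s t -> defect x s t =
  conjugate (UU e) (defect y) s t + \sum_(r | rgt r == e) moved_mx y e s r * moved_mx y e r t.
Proof.
move=> nc L cy xc st; have [ye ex Lz] := L.
have ec : e < c' by lra.
have cross0 (f g : strand F -> strand F -> A) :
    (forall a b, f a b != 0 -> crossing a b (e, ht a e)) ->
    (forall a b, g a b != 0 -> crossing a b (e, ht a e)) ->
    forall a r b, f a r * g r b = 0.
  move=> hf hg a r b; apply: not_neq0 => /mul2_neq0[/hf c1 /hg c2].
  have [h1 _] := lone_crossing L c1; have [h2 _] := lone_crossing L c2.
  have [ae re] := crossing_inside c1; have [_ be] := crossing_inside c2.
  have [E3|E3|E3] := triple (closed_in ae) (closed_in re) (closed_in be)
    (crossing_meet c1) (crossing_meet c2).
  - exact: (crossing_neq c1).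
  - exact: (crossing_neq c2).
  - by subst b; exact: above_asym h1 h2.
have Vn a b : crossing_mx c c' e a b != 0 -> crossing a b (e, ht a e).
  by rewrite /crossing_mx; case: asboolP => //; rewrite eqxx.
have Pn := @crossing_dmx_neq0 y e.
have G := @gauge _ _ _ (@addff _) ddD ddM (WW y) (crossing_mx c c' e) (crossing_dmx y e)
  (fun a b => dd_crossing_mx a b nc L cy ec) (cross0 _ _ Vn Vn) (cross0 _ _ Vn Pn)
  (cross0 _ _ Pn Vn) (cross0 _ _ Pn Pn) s t.
have M := middle_sum (fun r => product_step r nc L cy xc st).
have B : dd (born c c' e s t) = 0.
  by rewrite /born; case: ifP => _; rewrite ?der_ext1 ?der_ext0.
have D : dd (WW x s t) = dd (moved_mx y e s t).
  by rewrite (disk_mx_moved nc L cy xc st) ddD; exact: add0_eq.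
exact: curvature_assoc D M G.
Qed.

Lemma defect_not_above x s t : ~ above x s t -> defect x s t = 0.
Proof.
move=> st; rewrite /defect /curvature disk_mx_not_above // der_ext0 add0r; apply: big1 => r _.
have [->|/disk_mx_neq0[sr _]] := eqVneq (WW x s r) 0; first by rewrite mul0r.
have [->|/disk_mx_neq0[rt _]] := eqVneq (WW x r t) 0; first by rewrite mulr0.
by case: st; exact: above_trans sr rt.
Qed.

Lemma dd_rho_sum s t : dd (rho c c' s t) = \sum_r rho c c' s r * rho c c' r t.
Proof.
have [st|st] := pselect (line_pairs c (s, t)).
  rewrite dd_rho // /DA_dif_rho big_mkcond; apply: eq_bigr => r _.
  case: ifPn => // H.
  have [sr|sr] := pselect (line_pairs c (s, r)); last by rewrite (rho0 c' sr) mul0r.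
  have [rt|rt] := pselect (line_pairs c (r, t)); last by rewrite (rho0 c' rt) mulr0.
  move: H sr rt => /negP H [/= h1 h2 h3] [/= _ h4 h5].
  by exfalso; apply: H; rewrite h2 h5.
rewrite rho0 // der_ext0 big1 // => r _.
have [sr|sr] := pselect (line_pairs c (s, r)); last by rewrite (rho0 c' sr) mul0r.
have [rt|rt] := pselect (line_pairs c (r, t)); last by rewrite (rho0 c' rt) mulr0.
by case: st; exact: above_trans sr rt.
Qed.

Lemma defect_line x s t : ~ event F c -> c < x -> no_event F c x -> defect x s t = 0.
Proof.
move=> nc cx ne.
have Wr s' t' : WW x s' t' = rho c c' s' t'.
  have [st|st] := pselect (above x s' t'); first exact: disk_mx_line.
  rewrite disk_mx_not_above // rho0 // => st'; apply: st.
  by apply: (above_const ne _ _ st'); lra.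
rewrite /defect /curvature Wr dd_rho_sum; apply: add_eq0_2; first exact: addff.
by apply: eq_bigr => r _; rewrite !Wr.
Qed.

End Curvature.

(** * Simplicity and trapped right cusps *)

Section CompactRegions.
Context (R : realType).
Implicit Types (lo hi : R -> R).

Lemma region_closed x0 x1 lo hi : ctsw x0 x1 lo -> ctsw x0 x1 hi ->
  closed (region x0 x1 lo hi).
Proof.
move=> cl ch; rewrite -openC openE => -[u z] nq; rewrite /interior /=.
apply/near2P; have [ux|ux] := boolP (x0 <= u <= x1); last first.
  exists (if u < x0 then x0 - u else u - x1).
    by move: ux; rewrite negb_and -!ltNge; case: ifP; lra.
  move=> q /= qu _ [/= qq _]; move: qu ux; rewrite negb_and -!ltNge.
  by case: ifP; rewrite ltr_norml; lra.
have [zl|zl] := ltP z (lo u).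
  have [d d0 Hd] := cl u ux _ (ltac:(lra) : 0 < (lo u - z) / 2).
  exists (Num.min d ((lo u - z) / 2)); first by rewrite lt_min; lra.
  move=> q /=; rewrite !lt_min => /andP[qd _] /andP[_ qz] [/= qq q2].
  by move: (Hd _ qq qd) qz; rewrite !ltr_norml; lra.
have zh : hi u < z by rewrite ltNge; apply/negP => zh; apply: nq; split=> //=; rewrite zl.
have [d d0 Hd] := ch u ux _ (ltac:(lra) : 0 < (z - hi u) / 2).
exists (Num.min d ((z - hi u) / 2)); first by rewrite lt_min; lra.
move=> q /=; rewrite !lt_min => /andP[qd _] /andP[_ qz] [/= qq q2].
by move: (Hd _ qq qd) qz; rewrite !ltr_norml; lra.
Qed.

Lemma region_compact x0 x1 lo hi : ctsw x0 x1 lo -> ctsw x0 x1 hi ->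
  compact (region x0 x1 lo hi).
Proof.
move=> cl ch; have [x01|x01] := ltP x1 x0.
  rewrite (_ : region _ _ _ _ = set0); first exact: compact0.
  by apply/seteqP; split=> // -[u z] [/= uu _]; lra.
have [m _ Hm] := EVT_min x01 (iffLR (ctswP _ _ _) cl).
have [M _ HM] := EVT_max x01 (iffLR (ctswP _ _ _) ch).
apply: (@subclosed_compact _ _ (`[x0, x1] `*` `[lo m, hi M])).
- exact: region_closed.
- by apply: compact_setX; exact: segment_compact.
move=> [u z] [/= uu zz].
have ui : u \in `[x0, x1] by rewrite in_itv.
by split; rewrite /= in_itv //=; have := Hm u ui; have := HM u ui; lra.
Qed.

End CompactRegions.

Section Simplicity.
Context (R : realType) (F : front R).
Implicit Types (s t r a b : strand F) (p q v : R * R) (c x y z e : R).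
Implicit Types (lo hi : R -> R) (K D : set (R * R)).

(** Compact sets as in the definition of simplicity, with a vertical segment
    between two strands as their right end. *)
Definition blob c x s t K : Prop :=
  [/\ compact K, forall q, K q -> c <= q.1 <= x,
      forall q, K q -> ~ K° q -> [\/ q.1 = c, q.1 = x | front_set F q] &
      exists2 w, w < x & forall q, w <= q.1 <= x ->
        (K q <-> ht t q.1 <= q.2 <= ht s q.1)].

Lemma interior_mono K K' q : K `<=` K' -> K° q -> K'° q.
Proof. by move=> KK; apply: filterS. Qed.

Lemma blob_half c x s t D : ~ event F x -> above x s t -> half_disk c x s t D ->
  blob c x s t D.
Proof.
move=> nx [sx tx _] [x0 [lo [hi [A le h1 h2 ->]]]].
have [[cx xx] [cl ch] fr lt Aat] := A; split.
- exact: region_compact.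
- by move=> q [/= qq _]; lra.
- move=> [u z] [/= uu zz] nq.
  have [ux|ux] := eqVneq u x; first by constructor 2.
  have [ux0|ux0] := eqVneq u x0.
    case: le => [[E _]|[E _]]; last by constructor 1; rewrite ux0.
    constructor 3; have [h _] := fr u uu; rewrite (_ : z = lo u) //.
    by move: zz; rewrite ux0 E; lra.
  have uu' : x0 < u < x by rewrite !lt_neqAle eq_sym ux0 ux.
  have [cl' ch'] := arcs_cts A uu'; have [h3 h4] := fr u uu.
  have [k ->] := region_frontier cl' ch' uu' (conj uu zz) nq.
  by constructor 3; case: k.
have [w ww Hw] := avoid (finite_event F) xx.
have ne z : w < z <= x -> ~ event F z.
  move=> zz; have [zx|zx] := ltP z x; first by apply: Hw; lra.
  by rewrite (_ : z = x) //; lra.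
have wx : x0 <= w by lra.
have wx' : w < x by lra.
exists ((w + x) / 2); first by lra.
move=> [u z] /= uu.
have [_ E1] := arc_back A (k := false) wx wx' ne sx h1 (z := u) ltac:(lra).
have [_ E2] := arc_back A (k := true) wx wx' ne tx h2 (z := u) ltac:(lra).
rewrite /= in E1 E2; rewrite -E1 -E2; apply: region_line; lra.
Qed.

(** Near [y] the strand [r] bounds the first set from below and the second one from
    above, so that their vertical segments unite to one. *)
Lemma blob_join c y s r t K1 K2 : ~ event F y -> above y s r -> above y r t ->
  blob c y s r K1 -> blob c y r t K2 -> blob c y s t (K1 `|` K2).
Proof.
move=> ny sr rt [c1 b1 f1 [w1 wy1 s1]] [c2 b2 f2 [w2 wy2 s2]]; split.
- exact: compactU.
- by move=> q [/b1|/b2].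
- move=> q [Kq|Kq] nq; [apply: f1 => // h|apply: f2 => // h]; apply: nq.
    by apply: interior_mono h => ? ?; left.
  by apply: interior_mono h => ? ?; right.
have [w3 ww Hw] := avoid (finite_event F) (ltac:(lra) : y - 1 < y).
pose w := Num.max w3 (Num.max w1 w2).
have [l3 l1 l2] : [/\ w3 <= w, w1 <= w & w2 <= w].
  by rewrite /w !le_max !lexx !orbT.
exists w; first by rewrite !gt_max; lra.
move=> [u z] /= uu.
have ne : no_event F u y.
  move=> v vv; have [vy|vy] := ltP v y; first by apply: Hw; lra.
  by rewrite (_ : v = y) //; lra.
have [_ _ h1] : above u s r by apply: (above_const ne _ _ sr); lra.
have [_ _ h2] : above u r t by apply: (above_const ne _ _ rt); lra.
have S1 := s1 (u, z) ltac:(rewrite /=; lra); have S2 := s2 (u, z) ltac:(rewrite /=; lra).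
rewrite /= in S1 S2; split=> [[/S1|/S2]|zz]; [lra|lra|].
have [zr|zr] := leP (ht r u) z; first by left; apply/S1; lra.
by right; apply/S2; lra.
Qed.

(** Continuing a blob between two arcs: the segment over [y] becomes
    interior. *)
Lemma blob_glue c y x1 s t K lo hi : ~ event F y -> above y s t -> c < y -> y < x1 ->
  blob c y s t K -> ctsw y x1 lo -> ctsw y x1 hi ->
  (forall z, y <= z <= x1 -> front_set F (z, lo z) /\ front_set F (z, hi z)) ->
  (forall z, y < z < x1 -> lo z < hi z) ->
  (exists2 b, y < b & forall z, y <= z <= b -> hi z = ht s z /\ lo z = ht t z) ->
  [/\ compact (K `|` region y x1 lo hi),
      forall q, (K `|` region y x1 lo hi) q -> c <= q.1 <= x1 &
      forall q, (K `|` region y x1 lo hi) q -> ~ (K `|` region y x1 lo hi)° q ->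
        [\/ q.1 = c, q.1 = x1 /\ lo x1 <= q.2 <= hi x1 | front_set F q]].
Proof.
move=> ny [sy ty st] cy yx [cK bK fK [w wy sK]] cl ch fr lt [b yb gb].
set K' := K `|` _.
have KK' : K `<=` K' by move=> ? ?; left.
have RK' : region y x1 lo hi `<=` K' by move=> ? ?; right.
have [hy ly] := gb y ltac:(lra).
have at_y z : ht t y <= z <= ht s y -> ~ K'° (y, z) -> front_set F (y, z).
  move=> zz nq.
  have [zl|zl] := eqVneq z (ht t y).
    by exists t; split; [exact: closed_in|rewrite zl].
  have [zh|zh] := eqVneq z (ht s y).
    by exists s; split; [exact: closed_in|rewrite zh].
  exfalso; apply: nq.
  have zz' : ht t y < z < ht s y by rewrite !lt_neqAle eq_sym zl zh.
  have m0 : w < y < Num.min b x1 by rewrite wy lt_min yb.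
  have := region_interior (ht_cts ty) (ht_cts sy) m0 zz'.
  apply: filterS => -[u v] [/= uu vv].
  have [uy|uy] := leP u y; first by left; apply/sK => //=; lra.
  have [ub ux] : u <= b /\ u <= x1 by apply/andP; rewrite -le_min; lra.
  have [E1 E2] := gb u ltac:(lra).
  by right; split=> /=; [lra|rewrite E1 E2].
split.
- by apply: compactU => //; exact: region_compact.
- by move=> q [/bK|[/= qq _]]; lra.
move=> [u z] [Kq|[/= uu zz]] nq.
  have [uy|uy] := eqVneq u y.
    constructor 3; rewrite uy in Kq nq *; apply: at_y => //.
    by move: Kq => /(iffLR (sK (y, z) ltac:(rewrite /=; lra))).
  have [] := fK _ Kq => //.
  - by move=> h; apply: nq; exact: interior_mono h.
  - by constructor 1.
  - by move=> /= h; rewrite h eqxx in uy.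
  - by constructor 3.
have [uy|uy] := eqVneq u y.
  constructor 3; rewrite uy in zz nq *; apply: at_y => //.
  by rewrite -hy -ly.
have [ux|ux] := eqVneq u x1; first by constructor 2; split=> //=; rewrite -ux.
have uu' : y < u < x1 by rewrite !lt_neqAle eq_sym uy ux.
have [h3 h4] := fr u uu.
have [k ->] := region_frontier (ctsw_cts cl uu') (ctsw_cts ch uu') uu' (conj uu zz)
  (fun h => nq (interior_mono RK' h)).
by constructor 3; case: k.
Qed.

Lemma blob_extend c y e x s s' t t' K : lone F y e x -> c < y ->
  arc_step false e s s' -> arc_step true e t t' -> above y s' t' -> above x s t ->
  blob c y s' t' K -> blob c x s t (K `|` strip y x e s s' t t').
Proof.
move=> L cy us lt st' st bK; have [ye ex Lz] := L.
have [_ _ Es] := arc_step_meet us; have [_ _ Et] := arc_step_meet lt.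
have ny : ~ event F y by apply: Lz; lra.
have yx : y < x by lra.
have fr z : y <= z <= x -> front_set F (z, follow e t t' z) /\ front_set F (z, follow e s s' z).
  by move=> zz; split; [exact: (follow_front L lt zz)|exact: (follow_front L us zz)].
have ltf z : y < z < x -> follow e t t' z < follow e s s' z.
  by move=> zz; apply: (follow_lt L us lt st' st); lra.
have near_y : exists2 b, y < b & forall z, y <= z <= b ->
    follow e s s' z = ht s' z /\ follow e t t' z = ht t' z.
  by exists e => // z zz; rewrite !follow_left //; lra.
have [cK b f] := blob_glue ny st' cy yx bK (follow_ctsw L lt) (follow_ctsw L us)
  fr ltf near_y.
split=> //.
- by move=> q Kq /(f q Kq)[h|[h _]|h]; [constructor 1|constructor 2|constructor 3].
exists ((e + x) / 2); first by lra.
have [_ bK' _ _] := bK.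
move=> [u z] /= uu; rewrite -(@follow_right _ _ e s s' u Es ltac:(lra)).
rewrite -(@follow_right _ _ e t t' u Et ltac:(lra)).
split=> [[/bK' /= h|[]//]|zz]; first by exfalso; lra.
by right; split=> //=; lra.
Qed.

Definition trapped c x s t : Prop := exists2 K, blob c x s t K &
  exists p, [/\ is_right_cusp F p, c < p.1 < x & K° p].

Lemma trapped_extend c y e x s s' t t' : lone F y e x -> c < y ->
  arc_step false e s s' -> arc_step true e t t' -> above y s' t' -> above x s t ->
  trapped c y s' t' -> trapped c x s t.
Proof.
move=> L cy us lt st' st [K bK [p [rp cp Kp]]]; have [ye ex _] := L.
exists (K `|` strip y x e s s' t t'); first exact: (blob_extend L cy).
by exists p; split=> //; [lra|apply: interior_mono Kp => ? ?; left].
Qed.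

(** Two half-disks that are adjacent along a strand ending at a right cusp join to
    a compact set; as the outer two strands go on past the cusp, the cusp lies in
    the interior of its continuation. *)
Lemma trapped_cusp c y e x s s' t t' r D1 D2 : lone F y e x -> c < y ->
  arc_step false e s s' -> arc_step true e t t' -> above x s t -> rgt r = e ->
  above y s' r -> above y r t' -> half_disk c y s' r D1 -> half_disk c y r t' D2 ->
  trapped c x s t.
Proof.
move=> L cy us lt st re sr rt h1 h2; have [ye ex Lz] := L.
have ny : ~ event F y by apply: Lz; lra.
have st' := above_trans sr rt.
have bK := blob_join ny sr rt (blob_half ny sr h1) (blob_half ny rt h2).
exists ((D1 `|` D2) `|` strip y x e s s' t t'); first exact: (blob_extend L cy).
exists (e, ht r e); split=> /=; [by exists r; rewrite re|lra|].
have [_ se' Es] := arc_step_meet us; have [_ te' Et] := arc_step_meet lt.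
have [_ ry _] := sr; have rc := lone_closed_left L ry.
have nr : ~ inside r e by rewrite /inside re ltxx andbF.
have neq (q : strand F) : inside q e -> ht q e <> ht r e.
  move=> qe E; apply: nr; have [<-//|/eqP qr] := eqVneq q r.
  exact: inside_no_end qe rc qr E.
have exs : y < e < x by lra.
have hs : ht r e < ht s' e.
  by rewrite lt_neqAle (lone_above_event L sr) andbT; apply/eqP => /esym; exact: neq.
have ht' : ht t' e < ht r e.
  by rewrite lt_neqAle (lone_above_event L rt) andbT; apply/eqP; exact: neq.
apply: (@interior_mono (strip y x e s s' t t')); first by move=> ? ?; right.
apply: region_interior => //.
- exact: (ctsw_cts (follow_ctsw L lt) exs).
- exact: (ctsw_cts (follow_ctsw L us) exs).
- by rewrite !follow_left // ht'.
Qed.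

Lemma trapped_line c c' s t : simple_piece F c c' -> ~ trapped c c' s t.
Proof.
move=> simp [K [cK bK fK _] [p [rp cp Kp]]].
apply: (simp p rp cp); exists K; split=> // q Kq nq.
have [h|h|h] := fK q Kq nq; [by constructor 1|by constructor 2|].
by constructor 3; split=> //; exact: bK.
Qed.

(** The two strands close the blob at the vertex. *)
Lemma trapped_vertex c c' y e x z0 a b : simple_piece F c c' -> lone F y e x ->
  c < y -> e < c' -> above y a b -> ht a e = z0 -> ht b e = z0 -> ~ trapped c y a b.
Proof.
move=> simp L cy ec ab ae be [K bK [p [rp cp Kp]]]; have [ye ex Lz] := L.
have ny : ~ event F y by apply: Lz; lra.
have [ay by_ _] := ab.
have ac := lone_closed_left L ay; have bc := lone_closed_left L by_.
have cb : ctsw y e (ht b).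
  by apply: (ctsw_sub _ _ (@ht_ctsw _ F b)); move: by_; rewrite /inside; lra.
have ca : ctsw y e (ht a).
  by apply: (ctsw_sub _ _ (@ht_ctsw _ F a)); move: ay; rewrite /inside; lra.
have fr z : y <= z <= e -> front_set F (z, ht b z) /\ front_set F (z, ht a z).
  move=> zz; split; [exists b|exists a] => /=; split=> //.
    by move: by_; rewrite /inside; lra.
  by move: ay; rewrite /inside; lra.
have ltf z : y < z < e -> ht b z < ht a z.
  by move=> zz; have [] := lone_above_left L (z := z) ltac:(lra) ab.
have near_y : exists2 w, y < w & forall z, y <= z <= w -> ht a z = ht a z /\ ht b z = ht b z.
  by exists e.
have [cK bd f] := blob_glue ny ab cy ye bK cb ca fr ltf near_y.
apply: (simp p rp _); first by lra.
exists (K `|` region y e (ht b) (ht a)); split=> //.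
  by apply: interior_mono Kp => ? ?; left.
move=> q Kq nq; have bq := bd q Kq.
have [h|[h1 h2]|h] := f q Kq nq; first by constructor 1.
- constructor 3; split; first by lra.
  exists a; rewrite h1; split=> //=.
  by move: h2; rewrite ae be; lra.
by constructor 3; split=> //; lra.
Qed.

End Simplicity.

(** * The square of the differential *)

Lemma add_neq0 (A : nzRingType) (a b : A) : a + b != 0 -> a != 0 \/ b != 0.
Proof.
have [->|a0] := eqVneq a 0; last by left.
by rewrite add0r; right.
Qed.

Section SquareZero.
Context (R : realType) (F : front R) (c c' : R).
Implicit Types (s t r a b : strand F) (x y z e : R).

Notation A := (freeAlg (DA_gen F c c')).
Notation dd := (der_ext (@DA_dif_gen R F c c')).
Notation WW := (@disk_mx R F c c').
Notation EE := (@defect R F c c').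

(** By the transfer of the curvature, the relation [d W = W * W] can only fail for
    two strands that enclose a right cusp. *)
Lemma defect_trapped : ~ event F c -> forall x, c < x <= c' -> ~ event F x ->
  forall s t, EE x s t = 0 \/ (above x s t /\ trapped c x s t).
Proof.
move=> nc; apply: event_ind => // [x cx ne s t|y e x cy xc L IH s t].
  by left; apply: defect_line => //; lra.
have [st|st] := pselect (above x s t); last by left; exact: defect_not_above.
have [sx tx _] := st; have [ye ex Lz] := L.
apply: zero_or; rewrite (defect_step nc L cy xc st) => /add_neq0[].
  move=> /sum_neq0[s' /sum_neq0[t' /mul3_neq0[u0 E0 l0]]].
  have [E1|[st' tr]] := IH s' t'; first by case/eqP: E0.
  have [sy ty _] := st'; split=> //.
  exact: (trapped_extend L cy (step_mx_up L sx sy u0) (step_mx_low L tx ty l0) st' st tr).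
rewrite big_mkcond => /sum_neq0[r]; case: ifP => [/eqP re|_]; last by rewrite eqxx.
have nre : ~ inside r e by rewrite /inside re ltxx andbF.
move=> /mul2_neq0[/moved_mx_neq0[s' [r' [u0 W0 l0]]] /moved_mx_neq0[r'' [t' [u1 W1 l1]]]].
have E1 := step_mx_out nre (or_intror l0); have E2 := step_mx_out nre (or_introl u1).
subst r' r''.
have [sr [D1 h1]] := disk_mx_neq0 W0; have [rt [D2 h2]] := disk_mx_neq0 W1.
have [sy _ _] := sr; have [_ ty _] := rt; split=> //.
exact: (trapped_cusp L cy (step_mx_up L sx sy u0) (step_mx_low L tx ty l1) st re sr rt h1 h2).
Qed.

Lemma defect_eq0 x s t : EE x s t = 0 -> dd (WW x s t) = \sum_r WW x s r * WW x r t.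
Proof.
rewrite /defect /curvature; move: (dd _) (\sum_r _) => a b ab.
by apply/eqP; rewrite -subr_eq0 oppf; apply/eqP.
Qed.

(** Just before a vertex there is no third strand between the two that meet there,
    so that the corresponding entry of [W * W] is an empty sum. *)
Lemma dd_dif_vertex v : ~ event F c -> simple_piece F c c' -> vertices F c c' v ->
  dd (DA_dif_vertex F c c' v) = 0.
Proof.
move=> nc simp vv; have [/= vc _] := vv.
have [y [x [a [b [L cy xc [ab ae be only nlc] _]]]]] := vertex_meeting nc vv.
have [ye ex Lz] := L.
have ny : ~ event F y by apply: Lz; lra.
rewrite [v]surjective_pairing.
rewrite (dif_vertex nc L cy _ ab ae be only nlc); last lra.
rewrite ddD.
have -> : dd (if `[< is_right_cusp F (v.1, v.2) >] then 1 else 0) = 0.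
  by case: asboolP => _; [exact: der_ext1|exact: der_ext0].
have [E0|[_ tr]] := defect_trapped nc (x := y) ltac:(lra) ny a b; last first.
  by exfalso; apply: (trapped_vertex simp L cy _ ab ae be tr); lra.
rewrite (defect_eq0 E0) add0r; apply: big1 => r _; apply: not_neq0 => /mul2_neq0[].
move=> /disk_mx_neq0[ar _] /disk_mx_neq0[rb _].
have h1 := lone_above_event L ar; have h2 := lone_above_event L rb.
have [_ ry _] := ar; have re : ht r v.1 = v.2 by lra.
have [E1|E1] := only r ry re; subst r; first exact: above_irr ar.
exact: above_irr rb.
Qed.

Lemma dd_dif_gen (x : DA_gen F c c') : ~ event F c -> simple_piece F c c' ->
  dd (DA_dif_gen x) = 0.
Proof.
move=> nc simp; case: x => [v|r]; first exact: dd_dif_vertex nc simp (set_valP v).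
have st : line_pairs c ((val r).1, (val r).2).
  by rewrite -surjective_pairing; exact: set_valP.
rewrite /DA_dif_gen -dd_rho // dd_rho_sum.
exact: (curvature_sq (@addff _) (@ddD _ F c c') (@ddM _ F c c') (@dd_rho_sum _ F c c')).
Qed.

End SquareZero.

(** * Gradings and morphisms *)

Section Grading.
Context (R : realType) (F : front R) (Gam : zmodType) (u : Gam) (mu : strand F -> Gam).
Hypothesis maslov : is_maslov u mu.
Implicit Types (s t r a b : strand F) (c x y z e : R).

Notation hom c c' := (@homogeneous Gam (DA u mu c c')).

(** The word of a half-disk born at a left cusp is 1; the Maslov condition makes
    its degree the right one. *)
Lemma left_cusp_deg y e x s t : lone F y e x -> lft s = e -> t = lmate s ->
  above x s t -> mu s - mu t - u = 0.
Proof.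
move=> L se ts st; have [ye ex _] := L; subst t.
have [g|g] := left_cusps s; first by rewrite (maslov.1 _ g) addrAC addrK subrr.
exfalso; have [d d0 Hd] := germ_order (or_introl erefl) g.
have [w wx] := lone_probe_right L d0; rewrite ltr_norml => wd.
have := Hd w ltac:(rewrite mul1r se; lra).
by have [_ _] := lone_above_right L wx st; lra.
Qed.

Lemma right_cusp_deg y e x a b : lone F y e x -> rgt a = e -> b = rmate a ->
  above y a b -> mu a - mu b - u = 0.
Proof.
move=> L ae ba ab; have [ye ex _] := L; subst b.
have [g|g] := right_cusps a; first by rewrite (maslov.2 _ g) addrAC addrK subrr.
exfalso; have [d d0 Hd] := germ_order (or_intror erefl) g.
have [w wx] := lone_probe_left L d0; rewrite ltr_norml => wd.
have := Hd w ltac:(rewrite mulN1r ae; lra).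
by have [_ _] := lone_above_left L wx ab; lra.
Qed.

Lemma crossing_deg a b v : crossing a b v -> vertex_deg u mu v = mu a - mu b.
Proof.
move=> cr; rewrite /vertex_deg; case: pickP => [[s t] /= /asboolP cr'|/(_ (a, b))].
  have [ai bi ha hb hd] := cr; have [si ti hs ht' hd'] := cr'.
  have [E1|E1|E1] := triple (closed_in si) (closed_in ai) (closed_in bi)
    (etrans hs (esym ha)) (etrans ha (esym hb)).
  - subst s; have [E2|E2|E2] := triple (closed_in ti) (closed_in ai) (closed_in bi)
      (etrans ht' (esym ha)) (etrans ha (esym hb)).
    + by subst t; move: hd'; rewrite ltxx.
    + by case: (crossing_neq cr).
    + by subst t.
  - by case: (crossing_neq cr).
  - subst s; have [E2|E2|E2] := triple (closed_in ti) (closed_in ai) (closed_in bi)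
      (etrans ht' (esym ha)) (etrans ha (esym hb)).
    + by subst t; exfalso; lra.
    + by case: (crossing_neq cr).
    + by subst t; move: hd'; rewrite ltxx.
by move=> /asboolP [].
Qed.

Lemma not_crossing_deg v : ~ is_crossing F v -> vertex_deg u mu v = u.
Proof.
move=> nc; rewrite /vertex_deg; case: pickP => // -[s t] /asboolP cr.
by case: nc; exists s, t.
Qed.

Lemma hom_vgen c c' v : hom c c' (vertex_deg u mu v) (vgen F c c' v).
Proof.
have [vv|nv] := pselect (vertices F c c' v).
  have [w E ->] := vgenE vv; rewrite -E; exact: (@hom_gen _ (DA u mu c c') (inl w)).
rewrite /vgen; case: insubP => [w H _|_]; last exact: hom0.
by case: nv; exact/set_mem.
Qed.

Lemma hom_rho c c' s t : hom c c' (mu s - mu t - u) (rho c c' s t).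
Proof.
have [st|st] := pselect (line_pairs c (s, t)); last by rewrite rho0 //; exact: hom0.
have [w E ->] := rhoE c' st.
by have := @hom_gen _ (DA u mu c c') (inr w); rewrite /= E.
Qed.

Lemma hom_step_mx c c' e a b : hom c c' (mu a - mu b) (step_mx c c' e a b).
Proof.
apply: homD.
  have [->|_] := eqVneq a b; last exact: hom0.
  by rewrite subrr; exact: hom1.
rewrite /crossing_mx; case: asboolP => cr; last exact: hom0.
by rewrite -(crossing_deg cr); exact: hom_vgen.
Qed.

Lemma deg_telescope (B : zmodType) (p q r o w : B) :
  p - q + (q - r - w) + (r - o) = p - o - w.
Proof.
by rewrite -[q - r - w]addrA subrKA [- r - w]addrC [p + _]addrA subrKA addrAC.
Qed.

Lemma hom_disk_mx c c' : ~ event F c -> forall x, c < x <= c' -> ~ event F x ->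
  forall s t, above x s t -> hom c c' (mu s - mu t - u) (disk_mx c c' x s t).
Proof.
move=> nc; apply: event_ind => // [x cx ne s t st|y e x cy xc L IH s t st].
  by rewrite disk_mx_line //; [exact: hom_rho|lra].
rewrite (disk_mx_step nc L cy xc st); apply: homD.
  apply: hom_sum => s' _; apply: hom_sum => t' _.
  rewrite -(deg_telescope (mu s) (mu s') (mu t')).
  apply: homM; last exact: hom_step_mx; apply: homM; first exact: hom_step_mx.
  have [st'|st'] := pselect (above y s' t'); first exact: IH.
  by rewrite disk_mx_not_above //; exact: hom0.
rewrite /born; case: ifP => [/andP[/eqP se /eqP ts]|_]; last exact: hom0.
by rewrite (left_cusp_deg L se ts st); exact: hom1.
Qed.

Lemma hom_dif_vertex c c' v : ~ event F c -> vertices F c c' v ->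
  hom c c' (vertex_deg u mu v - u) (DA_dif_vertex F c c' v).
Proof.
move=> nc vv; have [/= vc _] := vv.
have [y [x [a [b [L cy xc [ab ae be only nlc] H]]]]] := vertex_meeting nc vv.
have [ye ex Lz] := L.
have ny : ~ event F y by apply: Lz; lra.
have -> : DA_dif_vertex F c c' v = DA_dif_vertex F c c' (v.1, v.2).
  by rewrite -surjective_pairing.
rewrite (dif_vertex nc L cy _ ab ae be only nlc); last lra.
rewrite -surjective_pairing.
have hW : hom c c' (mu a - mu b - u) (disk_mx c c' y a b) by apply: hom_disk_mx => //; lra.
case: H => [[cr nrc]|[ra rb rc ncr]].
  rewrite (crossing_deg cr); apply: homD => //.
  by rewrite asboolF //; exact: hom0.
rewrite (not_crossing_deg ncr) subrr; apply: homD.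
  by rewrite asboolT //; exact: hom1.
by rewrite -(right_cusp_deg L ra rb ab).
Qed.

Lemma hom_dif_gen c c' (x : DA_gen F c c') : ~ event F c ->
  hom c c' (DA_deg u mu x - u) (DA_dif_gen x).
Proof.
move=> nc; case: x => [v|r]; first exact: hom_dif_vertex nc (set_valP v).
rewrite /DA_deg /DA_dif_gen /DA_dif_rho; apply: hom_sum => q _.
have -> : mu (val r).1 - mu (val r).2 - u - u =
   (mu (val r).1 - mu q - u) + (mu q - mu (val r).2 - u).
  by rewrite [RHS]addrAC -[mu q - _ - u]addrA subrKA addrA.
by apply: homM; exact: hom_rho.
Qed.

Lemma DA_is_dga c c' : ~ event F c -> simple_piece F c c' -> is_dga u (DA u mu c c').
Proof.
move=> nc simp; split.
- by apply: add_zmod; exact: der_extD.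
- exact: der_extM.
- apply: (@hom_der_ext _ u (DA u mu c c')) => x; exact: hom_dif_gen.
- by apply: der_ext_sq => x; exact: dd_dif_gen.
Qed.

Lemma hom_incl c c' c'' g (a : freeAlg (DA_gen F c c')) : hom c c' g a -> hom c c'' g (DA_incl c c' c'' a).
Proof.
apply: (@hom_alg_ext _ (DA u mu c c') (DA u mu c c'')) => -[v|r].
  exact: hom_vgen.
exact: hom_rho.
Qed.

(** By [dif_vertex] both boundaries are entries of the matrices of disk counts. *)
Lemma dif_vertex_transfer c1 c1' c2 c2' (f : DA_gen F c1 c1' -> freeAlg (DA_gen F c2 c2')) v :
  ~ event F c1 -> ~ event F c2 -> c2 <= c1 -> vertices F c1 c1' v -> v.1 < c2' ->
  (forall y s t, c1 < y <= c1' -> ~ event F y -> above y s t ->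
     alg_ext f (disk_mx c1 c1' y s t) = disk_mx c2 c2' y s t) ->
  alg_ext f (DA_dif_vertex F c1 c1' v) = DA_dif_vertex F c2 c2' v.
Proof.
move=> n1 n2 cc vv vc' fW; have [/= vc _] := vv.
have [y [x [a [b [L cy xc [ab ae be only nlc] _]]]]] := vertex_meeting n1 vv.
have [ye ex Lz] := L.
have ny : ~ event F y by apply: Lz; lra.
rewrite [v]surjective_pairing.
rewrite (dif_vertex n1 L cy _ ab ae be only nlc); last lra.
rewrite (dif_vertex n2 L _ _ ab ae be only nlc); [|lra|lra].
rewrite alg_extD; congr (_ + _).
  by case: ifP => _; [exact: alg_ext1|exact: alg_ext0].
by apply: fW => //; lra.
Qed.

Lemma DA_incl_morphism c c' c'' : ~ event F c -> c < c' -> c' < c'' ->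
  @is_dga_morphism _ (DA u mu c c') (DA u mu c c'') (DA_incl c c' c'').
Proof.
move=> nc cc cc'; apply: (@alg_ext_morphism _ (DA u mu c c') (DA u mu c c'')).
- exact: der_extD.
- exact: der_extD.
- exact: der_extM.
- exact: der_extM.
- by move=> [v|r]; [exact: hom_vgen|exact: hom_rho].
move=> x /=; rewrite der_ext_gen -/(DA_incl c c' c'' (DA_dif_gen x)) -/(DA_incl c c' c'' (fgen x)); case: x => [v|r].
  rewrite -vgen_val DA_incl_vgen; last exact: set_valP.
  have vv := set_valP v; have [/= vc vP] := vv.
  rewrite dd_vgen; last by split; [lra|exact: vP].
  apply: dif_vertex_transfer => //; first by lra.
  by move=> y s t cy ny st; apply: incl_disk_mx => //; lra.
rewrite -rho_val DA_incl_rho /DA_dif_gen -dd_rho; last first.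
  by rewrite -surjective_pairing; exact: set_valP.
rewrite !dd_rho_sum [LHS]alg_ext_sum; apply: eq_bigr => q _.
by rewrite [LHS]alg_extM; congr (_ * _); exact: DA_incl_rho.
Qed.

Lemma DA_w_rho_disk_mx c c' c'' s t : ~ event F c -> ~ event F c' -> c < c' -> c' < c'' ->
  DA_w c c' c'' (rho c' c'' s t) = disk_mx c c'' c' s t.
Proof.
move=> nc nc' cc cc'; have [st|st] := pselect (line_pairs c' (s, t)).
  by rewrite DA_w_rho // w_eltE // incl_disk_mx //; lra.
by rewrite rho0 // disk_mx_not_above // /DA_w alg_ext0.
Qed.

Lemma DA_w_morphism c c' c'' : ~ event F c -> ~ event F c' -> c < c' -> c' < c'' ->
  simple_piece F c c' ->
  @is_dga_morphism _ (DA u mu c' c'') (DA u mu c c'') (DA_w c c' c'').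
Proof.
move=> nc nc' cc cc' simp; apply: (@alg_ext_morphism _ (DA u mu c' c'') (DA u mu c c'')).
- exact: der_extD.
- exact: der_extD.
- exact: der_extM.
- exact: der_extM.
- move=> [v|r]; first exact: hom_vgen.
  have st : above c' (val r).1 (val r).2 by exact: (set_valP r).
  apply: hom_incl; rewrite w_eltE //; apply: hom_disk_mx => //; lra.
move=> x /=; rewrite der_ext_gen -/(DA_w c c' c'' (DA_dif_gen x)) -/(DA_w c c' c'' (fgen x)); case: x => [v|r].
  rewrite -vgen_val DA_w_vgen; last exact: set_valP.
  have vv := set_valP v; have [/= vc vP] := vv.
  rewrite dd_vgen; last by split; [lra|exact: vP].
  apply: dif_vertex_transfer => //; [by lra|by lra|].
  by move=> y s t cy ny st; apply: w_disk_mx.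
rewrite -rho_val DA_w_rho_disk_mx // /DA_dif_gen -dd_rho; last first.
  by rewrite -surjective_pairing; exact: set_valP.
rewrite dd_rho_sum [LHS]alg_ext_sum.
(* Over the right end of a simple piece no right cusp is trapped, so that the
   disk counts there satisfy the relation that defines the boundary of the
   generators of the line. *)
have [E0|[_ tr]] := defect_trapped (c' := c'') nc (x := c') ltac:(lra) nc' (val r).1 (val r).2;
  last by case: (trapped_line simp tr).
rewrite (defect_eq0 E0); apply: eq_bigr => q _.
by rewrite [LHS]alg_extM; congr (_ * _); exact: DA_w_rho_disk_mx.
Qed.

End Grading.

(** * The pushout *)

Section Pushout.
Context (R : realType) (F : front R) (Gam : zmodType) (u : Gam) (mu : strand F -> Gam).
Context (c0 c1 c2 c3 : R).
Hypotheses (lt01 : c0 < c1) (lt12 : c1 < c2) (lt23 : c2 < c3).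
Hypothesis maslov : is_maslov u mu.
Hypothesis simp : simple_piece F c0 c1.
Hypotheses (n0 : ~ event F c0) (n1 : ~ event F c1).

Lemma vertex_neq c c' d v : ~ event F d -> vertices F c c' v -> v.1 != d.
Proof.
move=> nd [_ vP]; apply/eqP => E; apply: nd; case: vP => [cr|[s vs]].
  by right; exists v.
by left; exists s; right; rewrite -E vs.
Qed.

Lemma square_commutes :
  DA_w c0 c1 c3 \o DA_incl c1 c2 c3 =1
  DA_incl c0 c2 c3 \o DA_w c0 c1 c2 :> (freeAlg (DA_gen F c1 c2) -> _).
Proof.
have [l01 l12 l23] := And3 lt01 lt12 lt23.
apply: alg_map_eq; [by apply: alg_map_comp; exact: alg_map_ext|by apply: alg_map_comp; exact: alg_map_ext|].
move=> [v|r] /=.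
  have [vc vP] := set_valP v; have {}vc : c1 < (val v).1 < c2 by [].
  rewrite -vgen_val DA_incl_vgen // DA_w_vgen; last by split=> //; lra.
  by rewrite DA_w_vgen // DA_incl_vgen //; split=> //; lra.
rewrite -rho_val DA_incl_rho.
have st : above c1 (val r).1 (val r).2 by exact: (set_valP r).
rewrite !DA_w_rho_disk_mx //; last by lra.
by rewrite incl_disk_mx //; lra.
Qed.

(** Two algebra maps that agree on the images of the two corners are therefore
    equal, and a property of generators can be checked on these images. *)
Lemma generator_cases (x : DA_gen F c0 c3) :
  (exists b, DA_w c0 c1 c3 b = fgen x) \/
  (exists a, DA_incl c0 c2 c3 a = fgen x).
Proof.
have [l01 l12 l23] := And3 lt01 lt12 lt23.
case: x => [v|r]; last first.
  by right; exists (rho c0 c2 (val r).1 (val r).2); rewrite DA_incl_rho rho_val.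
have vv := set_valP v; have [vc vP] := vv; have {}vc : c0 < (val v).1 < c3 by [].
have [h|h] := ltP (val v).1 c2.
  right; exists (vgen F c0 c2 (val v)); rewrite DA_incl_vgen ?vgen_val //.
  by split=> //; lra.
left; exists (vgen F c1 c3 (val v)); rewrite DA_w_vgen ?vgen_val //.
by split=> //; lra.
Qed.

Section Universal.
Context (Z : dgdata Gam).
Variables (p : freeAlg (DA_gen F c1 c3) -> freeAlg (gen Z))
          (q : freeAlg (DA_gen F c0 c2) -> freeAlg (gen Z)).
Hypothesis Zdga : is_dga u Z.
Hypothesis hp : @is_dga_morphism _ (DA u mu c1 c3) Z p.
Hypothesis hq : @is_dga_morphism _ (DA u mu c0 c2) Z q.
Hypothesis pq : p \o DA_incl c1 c2 c3 =1 q \o DA_w c0 c1 c2.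

(** Vertices in the middle piece may be sent either way, by commutativity. *)
Definition glue_gen (x : DA_gen F c0 c3) : freeAlg (gen Z) :=
  match x with
  | inl v => if (val v).1 < c1 then q (vgen F c0 c2 (val v))
             else p (vgen F c1 c3 (val v))
  | inr r => q (rho c0 c2 (val r).1 (val r).2)
  end.

Definition glue_map : freeAlg (DA_gen F c0 c3) -> freeAlg (gen Z) := alg_ext glue_gen.

Lemma glue_map_vgen v : vertices F c0 c3 v ->
  glue_map (vgen F c0 c3 v) =
  if v.1 < c1 then q (vgen F c0 c2 v) else p (vgen F c1 c3 v).
Proof. by move=> /vgenE[w <- ->]; rewrite /glue_map alg_ext_gen. Qed.

Lemma glue_map_rho s t : glue_map (rho c0 c3 s t) = q (rho c0 c2 s t).
Proof.
have [qD _ _ _] := hq.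
have [st|st] := pselect (line_pairs c0 (s, t)); last first.
  by rewrite !rho0 // /glue_map alg_ext0 (add_zero (zmod_addP qD)).
by have [w E ->] := rhoE c3 st; rewrite /glue_map alg_ext_gen /glue_gen E.
Qed.

Lemma glue_map_right : glue_map \o DA_incl c0 c2 c3 =1 q.
Proof.
have [l01 l12 l23] := And3 lt01 lt12 lt23.
apply: alg_map_eq; [by apply: alg_map_comp; exact: alg_map_ext|exact: dga_alg_map hq|].
move=> [v|r] /=; last by rewrite -rho_val DA_incl_rho glue_map_rho.
have vv := set_valP v; have [vc vP] := vv; have {}vc : c0 < (val v).1 < c2 by [].
rewrite -vgen_val DA_incl_vgen // glue_map_vgen; last by split=> //; lra.
case: ltP => // h.
have v1 := vertex_neq n1 vv.
have vm : vertices F c1 c2 (val v).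
  by split=> //; rewrite lt_neqAle eq_sym v1 h; lra.
have := pq (vgen F c1 c2 (val v)); rewrite /= DA_incl_vgen // DA_w_vgen //.
Qed.

(** A generator [rho] of the line at [c1] comes from the middle piece, where [p] can
    be traded for [q]; the square then reduces the claim to [glue_map_right]. *)
Lemma glue_map_left : glue_map \o DA_w c0 c1 c3 =1 p.
Proof.
have [l01 l12 l23] := And3 lt01 lt12 lt23.
apply: alg_map_eq; [by apply: alg_map_comp; exact: alg_map_ext|exact: dga_alg_map hp|].
move=> [v|r] /=.
  have vv := set_valP v; have [vc vP] := vv; have {}vc : c1 < (val v).1 < c3 by [].
  rewrite -vgen_val DA_w_vgen // glue_map_vgen; last by split=> //; lra.
  by rewrite ltNge ltW //; lra.
rewrite -rho_val -(DA_incl_rho c1 c2 c3).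
have := pq (rho c1 c2 (val r).1 (val r).2); rewrite /= => ->.
have := square_commutes (rho c1 c2 (val r).1 (val r).2); rewrite /= => ->.
exact: glue_map_right.
Qed.

Lemma glue_map_morphism : @is_dga_morphism _ (DA u mu c0 c3) Z glue_map.
Proof.
have [_ _ ph pd] := hp; have [_ _ qh qd] := hq.
have [zD zM _ _] := Zdga.
have lt13 := lt_trans lt12 lt23; have lt02 := lt_trans lt01 lt12.
apply: (@alg_ext_morphism _ (DA u mu c0 c3) Z).
- exact: der_extD.
- exact: zmod_addP.
- exact: der_extM.
- exact: zM.
- move=> [v|r]; last by apply: qh; exact: hom_rho.
  rewrite /glue_gen; case: ifP => _; first by apply: qh; exact: hom_vgen.
  by apply: ph; exact: hom_vgen.
move=> x /=; have [[b <-]|[a <-]] := generator_cases x.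
  have [_ _ _ wd] := DA_w_morphism maslov n0 n1 lt01 lt13 simp.
  rewrite -[LHS]/(glue_map (@dif _ (DA u mu c0 c3) (DA_w c0 c1 c3 b))) -wd.
  exact: (etrans (glue_map_left _) (etrans (pd b) (congr1 (@dif _ Z) (esym (glue_map_left b))))).
have [_ _ _ id] := DA_incl_morphism u mu n0 lt02 lt23.
rewrite -[LHS]/(glue_map (@dif _ (DA u mu c0 c3) (DA_incl c0 c2 c3 a))) -id.
exact: (etrans (glue_map_right _) (etrans (qd a) (congr1 (@dif _ Z) (esym (glue_map_right a))))).
Qed.

End Universal.
End Pushout.

Theorem theorem2p20 (R : realType)
  (Gam : zmodType) (u : Gam) (Gam_cyclic : forall g : Gam, exists k : int, g = u *~ k)
  (F : front R) (mu : strand F -> Gam) (mu_maslov : is_maslov u mu)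
  (c0 c1 c2 c3 : R) (lt01 : c0 < c1) (lt12 : c1 < c2) (lt23 : c2 < c3)
  (line0 : dividing_line F c0) (line1 : dividing_line F c1)
  (line2 : dividing_line F c2) (line3 : dividing_line F c3)
  (simple1 : simple_piece F c0 c1) (simple2 : simple_piece F c1 c2)
  (simple3 : simple_piece F c2 c3) (simple12 : simple_piece F c0 c2)
  (simple23 : simple_piece F c1 c3) (simple123 : simple_piece F c0 c3) :
  is_pushout_square u
    (A := DA u mu c1 c2) (B := DA u mu c1 c3)
    (C := DA u mu c0 c2) (D := DA u mu c0 c3)
    (DA_incl c1 c2 c3) (DA_w c0 c1 c2)
    (DA_w c0 c1 c3) (DA_incl c0 c2 c3).
Proof.
have n0 := dividing_event line0; have n1 := dividing_event line1.
have lt13 := lt_trans lt12 lt23; have lt02 := lt_trans lt01 lt12.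
split.
- by split; exact: DA_is_dga.
- by split; [exact: DA_incl_morphism|exact: DA_w_morphism|exact: DA_w_morphism|
             exact: DA_incl_morphism].
- exact: square_commutes.
move=> Z Zdga p q hp hq pq; exists (glue_map p q).
have gl := glue_map_left lt01 lt12 lt23 n0 n1 hp hq pq.
have gr := glue_map_right lt01 lt12 lt23 n1 hq pq.
split=> //; first exact: glue_map_morphism.
move=> k hk kp kq; apply: alg_map_eq; [exact: dga_alg_map hk|exact: alg_map_ext|].
move=> x; have [[b <-]|[a <-]] := generator_cases lt01 lt12 lt23 x.
  exact: (etrans (kp b) (esym (gl b))).
exact: (etrans (kq a) (esym (gr a))).
Qed.
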